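(* Let $\Gamma((r^S)_{S\subseteq I})$ be a quitting game satisfying $r^i_i=0$ for all $i\in I$. Suppose that $I_*\neq\emptyset$ and that the problem $\mathrm{LCP}((\hat r^i)_{i=1}^n,\vec0)$ has no nontrivial solution, i.e. no solution $(w,z)$ with $z_0<1$. (1) If $\hat R$ is not a $Q$-matrix, then for every $\varepsilon>0$ the game has a stationary $\varepsilon$-equilibrium. (2) If $\hat R$ is a $Q$-matrix, then for every $\varepsilon>0$ the game has a sunspot $\varepsilon$-equilibrium in which at every stage at most one player quits with positive probability.
   Context: A quitting game $\Gamma((r^S)_{S\subseteq I})$: finite player set $I=[N]$, vectors $r^S\in[-1,1]^N$ for all $S\subseteq I$; at each stage $t\in\mathbb N$ each player chooses to continue or quit; with $t^*$ the first stage at which some player quits and $S^*$ the set of players quitting then ($S^*=\emptyset$ if nobody ever quits), the payoff is $r^{S^*}$. Write $r^i:=r^{\{i\}}$. Strategies (without signals) are sequences $x_i=(x_i^t)_t\subset[0,1]$ of conditional quitting probabilities; stationary if constant in $t$. $\gamma(x):=\mathbb E_x[r^{S^*}]$; $x$ is an $\varepsilon$-equilibrium if $\gamma_i(x)\ge\gamma_i(x_i',x_{-i})-\varepsilon$ for all $i,x_i'$. Sunspot version: at each stage the players publicly observe a signal uniform on $[0,1]$, independent of everything before; strategies are measurable maps $\xi_i^t:[0,1]^t\to[0,1]$ giving the quitting probability at stage $t$ given the signals so far; a sunspot $\varepsilon$-equilibrium is an $\varepsilon$-equilibrium of this extended game (no player gains more than $\varepsilon$ by any deviation in the extended game). Normal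 players: $I_0:=I$, $I_{l+1}:=\{i\in I_l:\ \exists j\in I_l,\ j\neq i,\ r^j_i\le0\}$, $I_*:=\bigcap_l I_l$; $n:=|I_*|$, players renamed so that $I_*=[n]$. $\hat r^i\in\mathbb R^n$ is the restriction of $r^i$ ($i\in[n]$) to coordinates in $I_*$, and $\hat R$ is the $n\times n$ matrix whose $i$-th column is $\hat r^i$. $\mathrm{LCP}((\hat r^i)_{i=1}^n,q)$: find $w\in\mathbb R^n_{\ge0}$ and $z\in\Delta(\{0,\dots,n\})$ with $w=z_0q+\sum_i z_i\hat r^i$ and $z_i=0$ or $w_i=0$ for each $i\in[n]$. An $n\times n$ matrix $R$ is a $Q$-matrix if for every $q\in\mathbb R^n$ there exist $z,w\in\mathbb R^n_{\ge0}$ with $w=q+Rz$ and $z_iw_i=0$ for all $i\in[n]$. *)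

(* Defs.v *)
From HB Require Import structures.
From mathcomp Require Import all_boot all_order all_algebra.
From mathcomp Require Import all_classical all_reals all_analysis.
Set Implicit Arguments. Unset Strict Implicit. Unset Printing Implicit Defensive.
Import Order.TTheory GRing.Theory Num.Theory.
Import numFieldNormedType.Exports.
Local Open Scope ring_scope.
Local Open Scope classical_set_scope.

Section QuittingGames.
Variable R : realType.
Variable N : nat.

Definition game := {set 'I_N} -> 'I_N -> R.

Definition payoffs_bounded (r : game) :=
  forall S i, -1 <= r S i <= 1.

Definition probS (p : 'I_N -> R) (S : {set 'I_N}) : R :=
  (\prod_(j in S) p j) * \prod_(j in ~: S) (1 - p j).

Definition stage_quit (r : game) (p : 'I_N -> R) (i : 'I_N) : R :=
  \sum_(S : {set 'I_N} | S != finset.set0) probS p S * r S i.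

(* a profile: x j t = conditional quitting probability of j at stage t *)
Definition profile := 'I_N -> nat -> R.

Definition is_strategy (y : nat -> R) := forall t, 0 <= y t <= 1.

Definition gamma_trunc (r : game) (x : profile) (i : 'I_N) (T : nat) : R :=
  \sum_(t < T) (\prod_(u < t) \prod_(j : 'I_N) (1 - x j u))
                 * stage_quit r (fun j => x j t) i
  + (\prod_(u < T) \prod_(j : 'I_N) (1 - x j u)) * r finset.set0 i.

(* gamma(x) = E_x[r^{S*}] : the limit of the truncated payoffs *)
Definition gamma (r : game) (x : profile) (i : 'I_N) : R :=
  limn (gamma_trunc r x i).

Definition dev (x : profile) (i : 'I_N) (y : nat -> R) : profile :=
  fun j => if j == i then y else x j.

Definition eps_equilibrium (r : game) (eps : R) (x : profile) :=
  (forall j, is_strategy (x j)) /\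
  forall (i : 'I_N) (y : nat -> R), is_strategy y ->
    gamma r (dev x i y) i - eps <= gamma r x i.

Definition stationary (x : profile) := forall j t, x j t = x j 0%N.

(* Histories of signals at stage t (stages numbered 0,1,2,...): the t.+1
   signals observed so far, stored as a tuple, most recent signal FIRST. *)
Definition sprofile := 'I_N -> forall t : nat, (t.+1).-tuple R -> R.

Definition sig_hist (t : nat) (h : t.-tuple R) := forall k : 'I_t, 0 <= tnth h k <= 1.

Definition is_sstrategy (xi : forall t : nat, (t.+1).-tuple R -> R) :=
  forall t, measurable_fun [set: (t.+1).-tuple R] (xi t) /\
            forall h : (t.+1).-tuple R, sig_hist h -> 0 <= xi t h <= 1.

(* continuation payoff of player i over the next k stages, starting at stage t
   after history h (nobody having quit yet); after the horizon r^emptyset is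
   paid.  Signals are uniform on [0,1] (Lebesgue measure on [0,1]). *)
Fixpoint scont (r : game) (xi : sprofile) (i : 'I_N) (k t : nat) (h : t.-tuple R)
  {struct k} : R :=
  match k with
  | 0%N => r finset.set0 i
  | k'.+1 =>
    Rintegral (@lebesgue_measure R) `[0%R, 1%R]%classic
      (fun s : R =>
         let h' := [tuple of s :: h] in
         stage_quit r (fun j => xi j t h') i
         + (\prod_(j : 'I_N) (1 - xi j t h')) * scont r xi i k' h')
  end.

Definition sgamma (r : game) (xi : sprofile) (i : 'I_N) : R :=
  limn (fun T => scont r xi i T [tuple]).

Definition sdev (xi : sprofile) (i : 'I_N) (eta : forall t : nat, (t.+1).-tuple R -> R)
  : sprofile := fun j => if j == i then eta else xi j.

Definition sunspot_eps_equilibrium (r : game) (eps : R) (xi : sprofile) :=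
  (forall j, is_sstrategy (xi j)) /\
  forall (i : 'I_N) (eta : forall t : nat, (t.+1).-tuple R -> R), is_sstrategy eta ->
    sgamma r (sdev xi i eta) i - eps <= sgamma r xi i.

Definition at_most_one_quits (xi : sprofile) :=
  forall t (h : (t.+1).-tuple R), sig_hist h ->
    forall j k : 'I_N, 0 < xi j t h -> 0 < xi k t h -> j = k.

Fixpoint Ilev (r : game) (l : nat) : {set 'I_N} :=
  match l with
  | 0%N => [set: 'I_N]
  | l'.+1 => [set i in Ilev r l' |
               [exists j in Ilev r l', (j != i) && (r [set j]%SET i <= 0)]]
  end.

Definition Istar (r : game) : {set 'I_N} :=
  [set i | `[< forall l, i \in Ilev r l >]].

Definition Rhat (r : game) : 'M[R]_(#|Istar r|) :=
  \matrix_(k, l) r [set enum_val l]%SET (enum_val k).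

End QuittingGames.

Section LCP.
Variable R : realType.

Definition LCP_sol n (M : 'M[R]_n) (q : 'cV[R]_n) (w : 'cV[R]_n) (z0 : R) (z : 'cV[R]_n) :=
  [/\ (forall i, 0 <= w i 0),
      (0 <= z0 /\ forall i, 0 <= z i 0),
      z0 + \sum_i z i 0 = 1,
      w = z0 *: q + M *m z &
      (forall i, z i 0 = 0 \/ w i 0 = 0)].

Definition Q_matrix n (M : 'M[R]_n) :=
  forall q : 'cV[R]_n, exists z w : 'cV[R]_n,
    [/\ (forall i, 0 <= z i 0), (forall i, 0 <= w i 0),
        w = q + M *m z & (forall i, z i 0 * w i 0 = 0)].

End LCP.

(* Main.v *)
Require Import Defs.
From HB Require Import structures.
From mathcomp Require Import all_boot all_order all_algebra.
From mathcomp Require Import all_classical all_reals all_analysis.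
From mathcomp Require Import measurable_realfun ring lra zify.
Import Order.TTheory GRing.Theory Num.Theory.
Import numFieldNormedType.Exports.
Set Implicit Arguments. Unset Strict Implicit. Unset Printing Implicit Defensive.
Local Open Scope classical_set_scope.
Local Open Scope ring_scope.

(* Let A i j be the payoff of i when j quits alone, and J the set of normal
   players.

   Not Q: choose q such that the problem on J has no solution, put q i = 1 off J, and let
   each quiet stage end with probability lam and payoff q. A stationary equilibrium x exists
   by a Brouwer-type theorem (a mod 2 count of labels on a grid). As lam tends to 0, either
   x tends to an equilibrium; or to a profile in which a single player i quits, who is then
   deterred from never quitting by a rare quitter who hurts him; or x tends to 0. In the
   last case the normalised limit of (lam, x) either is again a single quitter or solves the
   problem on J with data q or 0, which is excluded. Limits are taken along an ultrafilter.

   Q: a solution of w = q + A z, z >= 0, w >= 0, w i z i = 0 lets the players pass from value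
   w to value q: public signals call i at a small rate proportional to z i, and i obeys since
   his value is 0. So it suffices to chain such steps backwards until the total mass of z is
   large, with small errors. If this is impossible, every chain from the boundary of the
   orthant can be prolonged to a point V that admits no further step. The players with
   V i = 0 form a submatrix that is again R0 and Q; if it is proper, induction yields a chain
   near V, a contradiction. Hence V = 0. Starting from a unit vector d this gives
   d + A Z = 0; starting from the solution for q = - d it gives - d + A Z' = 0, so that
   A (Z + Z') = 0, which contradicts R0. *)

(** Quitting alone pays 0, so to first order a payoff is linear in the small rates of the other
    players, and equilibrium becomes complementarity: quit only at value 0. Putting [q i = 1] off
    the normal players forces the limit problem back onto them: a player who drops out of the
    elimination is hurt by nobody left at that level, so if he were in the support, his value 0
    would be a sum of nonnegative terms, and he would be the only quitter. In the sunspot case the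
    danger is a player who ignores his calls and so removes his own mass from the chain. R0 makes
    this harmless: each normal player hurts some normal player, whose nonnegative value bounds the
    mass of the first in terms of that of the others. Hence the mass of the others diverges as well,
    and the influence of the initial value and of play that never ends fades away. Chain errors are
    merely summed, so their total must be small. A called player obeys only with a small
    probability, so that a deviator gains little by quitting together with him. *)

(** * Labels on a cubical grid, counted mod 2 *)

Section Grid.
Variable N : nat.
Local Notation I := 'I_N.
Local Notation F2 := 'F_2.

Lemma F2_addxx (x : F2) : x + x = 0.
Proof. by case: x => -[|[|//]] ?; apply/val_inj. Qed.

Definition up (b : I -> nat) (j : I) : I -> nat := fun i => (b i + (i == j))%N.

Lemma upC b j k : up (up b j) k = up (up b k) j.
Proof. by apply: funext => i; rewrite /up addnAC. Qed.

(* The cup product of the coboundaries of the labels cs, summed over the monotone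
   lattice paths from b that use each direction of s once, coefficients mod 2. *)
Fixpoint cup (cs : seq ((I -> nat) -> bool)) (s : {set I}) (b : I -> nat) : F2 :=
  if cs is c :: cs' then
    \sum_(j in s) ((c b)%:R + (c (up b j))%:R) * cup cs' (s :\ j)%SET (up b j)
  else 1.

Lemma exch_setD1 (s : {set I}) (F : I -> I -> F2) :
  \sum_(j in s) \sum_(k in (s :\ j)%SET) F j k =
  \sum_(k in s) \sum_(j in (s :\ k)%SET) F j k.
Proof.
rewrite (exchange_big_dep (mem s)) /=; last by move=> j k _; rewrite !inE => /andP[].
apply: eq_bigr => k ks; apply: eq_bigl => j; rewrite !inE ks andbT.
by rewrite eq_sym andbC.
Qed.

(** Each unordered pair is counted twice, hence cancels mod 2. *)
Lemma sym_setD1 (s : {set I}) (F : I -> I -> F2) : (forall j k, F j k = F k j) ->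
  \sum_(j in s) \sum_(k in (s :\ j)%SET) F j k = 0.
Proof.
move=> Fsym.
pose G (j k : I) : F2 := if (j < k)%N then F j k else 0.
have -> : \sum_(j in s) \sum_(k in (s :\ j)%SET) F j k =
  \sum_(j in s) \sum_(k in (s :\ j)%SET) (G j k + G k j).
  apply: eq_bigr => j _; apply: eq_bigr => k; rewrite !inE => /andP[kj _].
  rewrite /G; case: (ltngtP j k) => [||/val_inj jk]; first by rewrite addr0.
    by rewrite add0r Fsym.
  by rewrite jk eqxx in kj.
under eq_bigr => j _ do rewrite big_split.
by rewrite big_split /= [X in _ + X]exch_setD1 F2_addxx.
Qed.

(** A Leibniz rule: the coboundary of a product of coboundaries vanishes. By induction only the
    terms containing [c] at the far corner [up (up b j) k] survive; they are symmetric in [j] and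
    [k] and cancel in pairs. *)
Lemma cup_closed cs (s : {set I}) b : #|s| = (size cs).+1 ->
  \sum_(j in s) (cup cs (s :\ j)%SET (up b j) + cup cs (s :\ j)%SET b) = 0.
Proof.
elim: cs s b => [|c cs IH] s b /= cs_s.
  by rewrite big1 // => j _; rewrite F2_addxx.
have E2 : \sum_(j in s) \sum_(k in (s :\ j)%SET)
      ((c b)%:R + (c (up b k))%:R) * cup cs (s :\ j :\ k)%SET (up b k) =
    \sum_(j in s) \sum_(k in (s :\ j)%SET)
      (c (up b j))%:R * cup cs (s :\ j :\ k)%SET (up (up b j) k).
  rewrite exch_setD1.
  have -> : \sum_(k in s) \sum_(j in (s :\ k)%SET)
      ((c b)%:R + (c (up b k))%:R) * cup cs (s :\ j :\ k)%SET (up b k) =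
    \sum_(k in s) ((c b)%:R * (\sum_(j in (s :\ k)%SET) cup cs (s :\ k :\ j)%SET (up (up b k) j))
     + \sum_(j in (s :\ k)%SET) (c (up b k))%:R * cup cs (s :\ k :\ j)%SET (up (up b k) j)).
    apply: eq_bigr => k ks.
    have cK : #|(s :\ k)%SET| = (size cs).+1.
      by have := cardsD1 k s; rewrite ks cs_s => -[].
    have /eqP := IH _ (up b k) cK.
    rewrite big_split /= addr_eq0 => /eqP EK.
    rewrite EK.
    have oppF2 (x : F2) : - x = x by apply/eqP; rewrite eq_sym -addr_eq0 F2_addxx.
    rewrite -[in RHS]big_distrr /= EK oppF2 -mulrDl big_distrr /=.
    by apply: eq_bigr => j _; rewrite finset.setDDl finset.setUC -finset.setDDl.
  rewrite big_split /= -big_distrr /= sym_setD1 ?mulr0 ?add0r // => j k.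
  by rewrite upC finset.setDDl finset.setUC -finset.setDDl.
under eq_bigr do rewrite addrC.
rewrite big_split /= E2 -big_split /=.
under eq_bigr => j _ do rewrite -big_split /=.
rewrite (eq_bigr (fun j => \sum_(k in (s :\ j)%SET)
    (c (up (up b j) k))%:R * cup cs (s :\ j :\ k)%SET (up (up b j) k))); last first.
  move=> j _; apply: eq_bigr => k _.
  by rewrite mulrDl addrA F2_addxx add0r.
by rewrite sym_setD1 // => j k; rewrite upC finset.setDDl finset.setUC -finset.setDDl.
Qed.

(** The paths do not leave the hyperplane of [x], where [c] is constant, so its factor is 0. This
    disposes of the side faces of the grid. *)
Lemma cup_const cs (s : {set I}) x (j : I) (c : (I -> nat) -> bool) v :
  List.In c cs -> j \notin s -> (forall y, y j = x j -> c y = v) -> cup cs s x = 0.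
Proof.
elim: cs s x => [//|c' cs IH] s x /= c_cs js cv.
rewrite big1 // => k ks.
have kj : (up x k) j = x j.
  by rewrite /up; case: eqP => [jk|]; rewrite ?addn0 // jk ks in js *.
case: c_cs => [->|c_cs]; first by rewrite cv // cv // F2_addxx mul0r.
rewrite IH ?mulr0 //; first by rewrite !inE (negbTE js) andbF.
by move=> y; rewrite kj => /cv.
Qed.

(** Some path has a nonzero term, and each label changes along its own edge of that path. *)
Lemma cup_neq0 cs (s : {set I}) b : cup cs s b != 0 -> forall c, List.In c cs ->
  exists u v, [/\ forall i, (b i <= u i <= (b i).+1)%N,
    forall i, (b i <= v i <= (b i).+1)%N, c u = true & c v = false].
Proof.
(* The induction needs the sharper bound: only directions in [s] are used. *)
suff H : cup cs s b != 0 -> forall c, List.In c cs ->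
  exists u v, [/\ forall i, (b i <= u i <= b i + (i \in s))%N,
    forall i, (b i <= v i <= b i + (i \in s))%N, c u = true & c v = false].
  move=> /H{}H c /H[u [v [hu hv cu cv]]]; exists u, v; split=> // i.
    by have /andP[-> /leq_trans->//] := hu i; rewrite -addn1 leq_add2l; case: (_ \in _).
  by have /andP[-> /leq_trans->//] := hv i; rewrite -addn1 leq_add2l; case: (_ \in _).
elim: cs s b => [//|c' cs IH] s b /= nz c c_cs.
have [j js nzj] : exists2 j, j \in s &
    ((c' b)%:R + (c' (up b j))%:R) * cup cs (s :\ j)%SET (up b j) != 0.
  apply/exists_inP; apply: contraNT nz; rewrite negb_exists_in => /forall_inP nz.
  by rewrite big1 // => j /nz /negPn /eqP.
have bup i : (b i <= (up b j) i <= b i + (i \in s))%N.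
  by rewrite /up leq_addr leq_add2l; case: eqP => // ->; rewrite js.
case: c_cs => [cc|c_cs].
  subst c'.
  have : c b != c (up b j).
    by apply: contraNneq nzj => ->; rewrite F2_addxx mul0r.
  have bb i : (b i <= b i <= b i + (i \in s))%N by rewrite leqnn leq_addr.
  case cb: (c b); case cu: (c (up b j)) => // _.
    by exists b, (up b j).
  by exists (up b j), b.
have nz' : cup cs (s :\ j)%SET (up b j) != 0.
  by apply: contraNneq nzj => ->; rewrite mulr0.
have [u [v [hu hv cu cv]]] := IH _ _ nz' c c_cs.
have aux (u' : I -> nat) : (forall i, (up b j i <= u' i <= up b j i + (i \in (s :\ j)%SET))%N) ->
   forall i, (b i <= u' i <= b i + (i \in s))%N.
  move=> hu' i; have := hu' i; rewrite /up !inE.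
  case: eqP => [->|_] /=; rewrite ?addn0 ?js // => /andP[h1 h2].
  by rewrite (leq_trans _ h1) ?h2 ?leq_addr.
by exists u, v; split=> //; apply: aux.
Qed.

Variable M : nat.
Local Notation top := M.+1.

Definition upd (f : {ffun I -> 'I_top}) j t : {ffun I -> 'I_top} :=
  [ffun i => if i == j then t else f i].

Lemma sum_upd (Phi : pred {ffun I -> 'I_top}) j (F : {ffun I -> 'I_top} -> F2) :
  (forall f t, Phi (upd f j t) = Phi f) ->
  \sum_(f | Phi f) F f =
  \sum_(g : {ffun I -> 'I_top} | Phi g && (g j == ord0)) \sum_(t : 'I_top) F (upd g j t).
Proof.
move=> PhiE.
rewrite (partition_big (fun f => upd f j ord0) (fun g => Phi g && (g j == ord0))) /=; last first.
  by move=> f Pf; rewrite PhiE Pf ffunE eqxx /=.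
apply: eq_bigr => g /andP[Pg /eqP gj].
rewrite (reindex_onto (fun t => upd g j t) (fun f => f j)) /=.
  apply: eq_bigl => t; rewrite PhiE Pg /= ffunE eqxx eqxx andbT.
  by apply/eqP/ffunP => i; rewrite !ffunE; case: eqP => // ->.
move=> f /andP[_ /eqP <-]; apply/ffunP => i.
by rewrite !ffunE; case: eqP => // ->.
Qed.

Lemma sum_telescope (h : nat -> F2) n : \sum_(t < n) (h t + h t.+1) = h 0%N + h n.
Proof.
elim: n => [|n IH]; first by rewrite big_ord0 F2_addxx.
by rewrite big_ord_recr /= IH addrA -[_ + _ + h n]addrA F2_addxx addr0.
Qed.

(** Lower corner of a cell in the face where the first [k] coordinates equal [top]. *)
Definition pt k (f : {ffun I -> 'I_top}) : I -> nat :=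
  fun i => if (i < k)%N then top else f i.

Definition setc (x : I -> nat) j t : I -> nat := fun i => if i == j then t else x i.

Variable c : I -> (I -> nat) -> bool.
Hypothesis c0 : forall i x, x i = 0%N -> c i x = false.
Hypothesis cM : forall i x, x i = top -> c i x = true.

(** [pt k] ignores the first [k] coordinates of [f]; fixing them at 0 counts each cell of the face
    once. [Ik k] is the mod 2 count, over the cells of that face, of the paths along which the
    labels from [k] on change one after the other. *)
Let Phi k (f : {ffun I -> 'I_top}) := [forall i : I, (i < k)%N ==> (f i == ord0)].
Let cs k := [seq c i | i <- drop k (enum I)].
Let ss k : {set I} := [set i : I | (k <= i)%N]%SET.
Let Ik k := \sum_(f | Phi k f) cup (cs k) (ss k) (pt k f).

Let csE k (hk : (k < N)%N) : cs k = c (Ordinal hk) :: cs k.+1.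
Proof.
rewrite /cs (drop_nth (Ordinal hk)) ?size_enum_ord //=; congr (c _ :: _).
by apply/val_inj; rewrite /= nth_enum_ord.
Qed.

Let in_cs k (j : I) : (k <= j)%N -> List.In (c j) (cs k).
Proof.
move=> kj; rewrite /cs.
have : j \in drop k (enum I).
  apply/(nthP j); exists (j - k)%N.
    by rewrite size_drop size_enum_ord ltn_sub2r // (leq_ltn_trans kj).
  by rewrite nth_drop subnKC //; apply/val_inj; rewrite /= nth_enum_ord.
elim: (drop _ _) => [//|a l IH]; rewrite inE => /orP[/eqP->|/IH] /=; by [left|right].
Qed.

(** Stokes: [cup (cs k)] is the coboundary of the label of [k] times [cup (cs k.+1)], so the sum
    over the face telescopes to its boundary. At both ends of a direction [j] other than [k] the
    label of [j] is constant and [cup] vanishes. In direction [k] the lower end carries the label 0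
    and the upper end is the next face. *)
Let Ik_step k : (k < N)%N -> Ik k = Ik k.+1.
Proof.
move=> kN; set j0 := Ordinal kN.
pose H j (x : I -> nat) : F2 := (c j0 x)%:R * cup (cs k.+1) (ss k :\ j)%SET x.
have card_ss l : #|ss l| = (N - l)%N.
  rewrite -sum1_card /ss; under eq_bigl do rewrite inE.
  rewrite -(big_mkord (fun i => (l <= i)%N) (fun=> 1%N)).
  elim: (N) => [|n IH]; first by rewrite big_geq.
  by rewrite big_mkcond big_nat_recr //= -big_mkcond IH; case: leqP; lia.
have cupE x : cup (cs k) (ss k) x = \sum_(j in ss k) (H j x + H j (up x j)).
  rewrite (csE kN) /= big_split /=.
  under eq_bigr do rewrite mulrDl.
  rewrite big_split /=; congr (_ + _).
  rewrite /H -!big_distrr /=; congr (_ * _).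
  apply/eqP; rewrite -subr_eq0 -sumrB; apply/eqP.
  rewrite -[RHS](@cup_closed (cs k.+1) (ss k) x); last first.
    by rewrite card_ss /cs size_map size_drop size_enum_ord; lia.
  apply: eq_bigr => j _; congr (_ + _).
  by apply/eqP; rewrite eq_sym -addr_eq0 F2_addxx.
rewrite /Ik; under eq_bigr do rewrite cupE.
rewrite exchange_big /=.
have tele j : j \in ss k ->
  \sum_(f | Phi k f) (H j (pt k f) + H j (up (pt k f) j)) =
  \sum_(f | Phi k f && (f j == ord0)) (H j (setc (pt k f) j 0%N) + H j (setc (pt k f) j top)).
  rewrite inE => kj.
  rewrite (sum_upd (j := j)); last first.
    move=> f t; apply: eq_forallb => i; case: ltnP => //= ik; rewrite ffunE.
    by case: (i =P j) => // ij; rewrite ij ltnNge kj in ik.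
  apply: eq_bigr => g _; rewrite -(sum_telescope (fun t => H j (setc (pt k g) j t))).
  apply: eq_bigr => t _.
  have -> : pt k (upd g j t) = setc (pt k g) j t.
    apply: funext => i; rewrite /pt /setc ffunE; case: eqP => // ->.
    by rewrite ltnNge kj.
  congr (_ + H j _); apply: funext => i; rewrite /up /setc.
  by case: eqP => _; rewrite ?addn1 ?addn0.
rewrite (bigD1 j0) ?inE //= [X in _ + X]big1 ?addr0; last first.
  move=> j /andP[jk jj0]; rewrite tele // big1 // => f _.
  have kj : (k.+1 <= j)%N by rewrite inE leq_eqVlt in jk; case/orP: jk => // /eqP kj;
    case/eqP: jj0; apply/val_inj; rewrite /= kj.
  have jn : j \notin (ss k :\ j)%SET by rewrite !inE eqxx.
  rewrite /H (@cup_const _ _ _ j (c j) false) ?mulr0 ?add0r //; last 2 first.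
  - exact: in_cs.
  - by move=> y; rewrite /setc eqxx => /c0.
  rewrite (@cup_const _ _ _ j (c j) true) ?mulr0 //; first exact: in_cs.
  by move=> y; rewrite /setc eqxx => /cM.
rewrite tele ?inE //; apply: eq_big => f.
  apply/andP/forallP => [[/forallP hf /eqP fj] i|hf].
    apply/implyP; rewrite ltnS leq_eqVlt => /orP[/eqP ik|ik]; last by have := hf i; rewrite ik.
    have -> : i = j0 by apply/val_inj.
    by rewrite fj.
  split; last by have := hf j0; rewrite /= ltnSn.
  by apply/forallP => i; apply/implyP => ik; have := hf i; rewrite ltnS ltnW.
move=> /andP[_ /eqP fj].
rewrite /H c0 ?cM /setc ?eqxx // mul0r mul1r add0r.
congr cup.
  by apply/setP => i; rewrite !inE ltn_neqAle eq_sym.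
apply: funext => i; rewrite /pt ltnS; case: (ltngtP i k) => [ik|ik|ik].
- by case: eqP => // ij; move: ik; rewrite ij ltnn.
- by case: eqP => // ij; move: ik; rewrite ij ltnn.
- by have -> : i == j0 by apply/eqP/val_inj.
Qed.

(** A discrete Poincare-Miranda theorem: the count over the whole grid equals that at the top
    corner, an empty product 1, so some cell has a nonzero count. *)
Lemma grid_labels : exists b : I -> nat, (forall i, (b i <= M)%N) /\
  forall i, exists u v, [/\ forall l, (b l <= u l <= (b l).+1)%N,
    forall l, (b l <= v l <= (b l).+1)%N, c i u = true & c i v = false].
Proof.
have I0N : Ik 0 = Ik N.
  have H k : (k <= N)%N -> Ik 0 = Ik k.
    by elim: k => [//|k IH] kN; rewrite (IH (ltnW kN)) (Ik_step kN).
  exact: H.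
have IN : Ik N = 1.
  rewrite /Ik (big_pred1 [ffun=> ord0]) /=; last first.
    move=> f; apply/forallP/eqP => [hf|-> i]; last by rewrite ffunE eqxx implybT.
    by apply/ffunP => i; rewrite ffunE; have := hf i; rewrite ltn_ord => /eqP.
  by rewrite /cs drop_oversize ?size_enum_ord.
have [f _ nz] : exists2 f, Phi 0 f & cup (cs 0) (ss 0) (pt 0 f) != 0.
  apply: contrapT => H; move: IN; rewrite -I0N /Ik big1 => [/eqP|f Pf].
    by rewrite eq_sym oner_eq0.
  by apply/eqP/negPn/negP => nz; apply: H; exists f.
exists (pt 0 f); split => [i|i]; first by rewrite /pt /= -ltnS.
exact: cup_neq0 nz _ (in_cs _).
Qed.

End Grid.

(** * Limits along an ultrafilter, and complementarity on the cube *)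

Section Ultra.
Variable R : realType.

Lemma nat_ultra : exists U : set_system nat, UltraFilter U /\ (\oo `<=` U).
Proof. exact: ultraFilterLemma. Qed.

Lemma ultra_cvg (U : set_system nat) (u : nat -> R) a b : UltraFilter U ->
  (forall n, a <= u n <= b) -> exists2 l : R, u @ U --> l & a <= l <= b.
Proof.
move=> UU uab.
have [p [/= pab clp]] : `[a, b]%classic `&` cluster (u @ U) !=set0.
  apply: (@segment_compact R a b); apply: (@filterS _ U _ setT) => [n _ /=|].
    by rewrite in_itv /= uab.
  exact: filterT.
exists p; last by rewrite in_itv /= in pab.
move=> B Bp.
have [//|UB] := in_ultra_setVsetC (u @^-1` B) UU.
by have [x [/= nBx]] := clp (~` B) B UB Bp.
Qed.

Lemma cvg_coarse (U : set_system nat) (u : nat -> R) (l : R) : \oo `<=` U -> (u @ \oo --> l) -> (u @ U --> l).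
Proof. by move=> sU ul; apply: cvg_trans ul => A /sU. Qed.

(** The reason for using ultrafilters: a disjunction that holds at each index is decided once and
    for all in the limit. *)
Lemma ultra_split (U : set_system nat) (P Q : nat -> Prop) : UltraFilter U ->
  (forall n, P n \/ Q n) -> U [set n | P n] \/ U [set n | Q n].
Proof.
move=> UU PQ; have [|UC] := in_ultra_setVsetC [set n | P n] UU; first by left.
by right; apply: filterS UC => n /= nP; case: (PQ n).
Qed.

Lemma cvg_eq_cst (U : set_system nat) (u : nat -> R) (l c : R) : ProperFilter U ->
  (u @ U --> l) -> U [set n | u n = c] -> l = c.
Proof.
move=> UP ul uc; apply/le_anti/andP; split.
  by apply: (cvgr_to_le ul); apply: filterS uc => n /= ->.
by apply: (cvgr_to_ge ul); apply: filterS uc => n /= ->.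
Qed.

Definition seq_cts n (f : ('I_n -> R) -> R) := forall U : set_system nat, UltraFilter U ->
  forall (x : nat -> 'I_n -> R) l, (forall i, (fun m => x m i) @ U --> l i) ->
  (fun m => f (x m)) @ U --> f l.

(** At a grid point a true label implies [x i = 1] or [f i x <= 0], a false one [x i = 0] or
    [f i x > 0]. Cells in which each label takes both values shrink to one limit point, which
    inherits both alternatives. *)
Lemma cube_complementarity n (f : 'I_n -> ('I_n -> R) -> R) : (forall i, seq_cts (f i)) ->
  exists x : 'I_n -> R, (forall i, 0 <= x i <= 1) /\
    forall i, (x i = 0 \/ 0 <= f i x) /\ (x i = 1 \/ f i x <= 0).
Proof.
move=> fc.
pose sc m (b : 'I_n -> nat) : 'I_n -> R := fun i => (b i)%:R / m.+1%:R.
pose c m (i : 'I_n) (b : 'I_n -> nat) :=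
  (b i == m.+1) || ((0 < b i)%N && (f i (sc m b) <= 0)).
have /choice[b hb] m : exists b : 'I_n -> nat, (forall i, (b i <= m)%N) /\
  forall i, exists u v, [/\ forall l, (b l <= u l <= (b l).+1)%N,
    forall l, (b l <= v l <= (b l).+1)%N, c m i u = true & c m i v = false].
  apply: grid_labels => i x xi; rewrite /c xi ?eqxx //.
have [U [UU sU]] := nat_ultra.
have UP : ProperFilter U := @ultra_proper _ _ UU.
have scb m i : 0 <= sc m (b m) i <= 1.
  rewrite /sc divr_ge0 //= ler_pdivrMr ?ltr0Sn // mul1r ler_nat.
  by rewrite ltnW // ltnS; case: (hb m) => + _; exact.
have /choice[x hx] i : exists l : R, (fun m => sc m (b m) i) @ U --> l /\ 0 <= l <= 1.
  by have [l ? ?] := ultra_cvg UU (scb ^~ i); exists l.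
exists x; split => [i|i]; first by have [] := hx i.
have inv0 : (fun m => m.+1%:R^-1 : R) @ U --> (0 : R).
  by apply: cvg_coarse sU _; exact: cvg_harmonic.
have scl (u : nat -> 'I_n -> nat) : (forall m l, (b m l <= u m l <= (b m l).+1)%N) ->
    forall l, (fun m => sc m (u m) l) @ U --> x l.
  move=> hu l; have [cl _] := hx l.
  apply: (@squeeze_cvgr _ _ _ _ (fun m => sc m (b m) l) (fun m => sc m (b m) l + m.+1%:R^-1)) => //.
    apply: nearW => m; rewrite /sc -[X in _ + X]mul1r -mulrDl.
    rewrite !ler_pM2r ?invr_gt0 ?ltr0Sn // natr1 !ler_nat.
    exact: hu.
  by rewrite -[x l]addr0; apply: cvgD.
have /choice[u /choice[v huv]] m := (hb m).2 i.
have fu : (fun m => f i (sc m (u m))) @ U --> f i x.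
  by apply: (fc i U UU); apply: scl => m; case: (huv m).
have fv : (fun m => f i (sc m (v m))) @ U --> f i x.
  by apply: (fc i U UU); apply: scl => m; case: (huv m).
have xu : (fun m => sc m (u m) i) @ U --> x i by apply: scl => m; case: (huv m).
have xv : (fun m => sc m (v m) i) @ U --> x i by apply: scl => m; case: (huv m).
split.
  have [m|U0|Uf] := @ultra_split U (fun m => v m i = 0%N) (fun m => 0 <= f i (sc m (v m))) UU.
  - have [_ _ _] := huv m; rewrite /c => /negbT; rewrite negb_or negb_and -leqNgt leqn0.
    by case/andP => _ /orP[/eqP|]; [left|rewrite -ltNge => /ltW; right].
  - left; apply: (@cvg_eq_cst U _ _ 0 UP xv); apply: filterS U0 => m /= v0.
    by rewrite /sc v0 mul0r.
  - by right; apply: (cvgr_to_ge fv).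
have [m|U0|Uf] := @ultra_split U (fun m => u m i = m.+1) (fun m => f i (sc m (u m)) <= 0) UU.
- have [_ _ + _] := huv m; rewrite /c.
  by case/orP => [/eqP|/andP[_]]; [left|right].
- left; apply: (@cvg_eq_cst U _ _ 1 UP xu); apply: filterS U0 => m /= um.
  by rewrite /sc um divff // pnatr_eq0.
- by right; apply: (cvgr_to_le fu).
Qed.

End Ultra.

(** * One-stage payoffs as multi-affine functions of the quitting probabilities *)

Section Stage.
Variables (R : realType) (N : nat).
Local Notation I := 'I_N.

Definition updf (p : I -> R) i y : I -> R := fun j => if j == i then y else p j.

Lemma updf_id p i : updf p i (p i) = p.
Proof. by apply: funext => j; rewrite /updf; case: eqP => // ->. Qed.

Lemma cvg_sumU (U : set_system nat) (P : pred I) (f : I -> nat -> R) (l : I -> R) : UltraFilter U ->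
  (forall i, P i -> f i @ U --> l i) -> (fun m => \sum_(i | P i) f i m) @ U --> \sum_(i | P i) l i.
Proof.
move=> UU fl; 
by apply: (@cvg_big R I +%R 0) => //; exact: add_continuous.
Qed.

Lemma cvg_prodU (U : set_system nat) (P : pred I) (f : I -> nat -> R) (l : I -> R) : UltraFilter U ->
  (forall i, P i -> f i @ U --> l i) -> (fun m => \prod_(i | P i) f i m) @ U --> \prod_(i | P i) l i.
Proof.
move=> UU fl.
by apply: (@cvg_big R I *%R 1) => //; exact: mul_continuous.
Qed.

Lemma probS_ge0 (p : I -> R) S : (forall j, 0 <= p j <= 1) -> 0 <= probS p S.
Proof.
move=> p01; rewrite /probS mulr_ge0 ?prodr_ge0 // => j _; have /andP[? ?] := p01 j => //.
by rewrite subr_ge0.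
Qed.

Lemma sum_probS (p : I -> R) : \sum_(S : {set I}) probS p S = 1.
Proof.
have <- : \prod_(j : I) (p j + (1 - p j)) = 1.
  by rewrite big1 // => j _; rewrite addrC subrK.
rewrite bigA_distr; apply: eq_bigr => S _.
rewrite /probS [in RHS](bigID (mem S)) /=; congr (_ * _).
  by apply: eq_bigr => j ->.
by apply: eq_big => [j|j]; rewrite inE // => /negbTE ->.
Qed.

Lemma probS_set0 (p : I -> R) : probS p finset.set0 = \prod_j (1 - p j).
Proof.
rewrite /probS big_set0 mul1r; apply: eq_bigl => j.
by rewrite !inE.
Qed.

Lemma sum_probS_neq0 (p : I -> R) :
  \sum_(S : {set I} | S != finset.set0) probS p S = 1 - \prod_j (1 - p j).
Proof.
have := sum_probS p; rewrite (bigD1 finset.set0) //= probS_set0 => E.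
by rewrite -[X in X - _]E addrC addrK.
Qed.

Lemma probS_updf p i y S : probS (updf p i y) S =
  y * probS (updf p i 1) S + (1 - y) * probS (updf p i 0) S.
Proof.
have pE z : probS (updf p i z) S =
  (if i \in S then z else 1 - z) *
  ((\prod_(j in S | j != i) p j) * \prod_(j in ~: S | j != i) (1 - p j)).
  rewrite /probS; case: ifP => iS.
    rewrite (bigD1 i) //= /updf eqxx -mulrA; congr (_ * (_ * _)).
      by apply: eq_bigr => j /andP[_ /negbTE ->].
    apply: eq_big => [j|j].
      by rewrite !inE; case: eqP => [->|]; rewrite ?iS ?andbT.
    by case: eqP => // ->; rewrite !inE iS.
  rewrite [X in _ * X](bigD1 i) ?inE ?iS //= /updf eqxx mulrCA; congr (_ * (_ * _)).
    apply: eq_big => [j|j]; first by case: eqP => [->|]; rewrite ?iS ?andbT.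
    by case: eqP => // ->; rewrite iS.
  by apply: eq_bigr => j /andP[_ /negbTE ->].
rewrite !pE; case: ifP => _; ring.
Qed.

Variable r : game R N.

Lemma stage_quit_updf p i y k : stage_quit r (updf p i y) k =
  y * stage_quit r (updf p i 1) k + (1 - y) * stage_quit r (updf p i 0) k.
Proof.
rewrite /stage_quit !big_distrr /= -big_split /=; apply: eq_bigr => S _.
by rewrite probS_updf mulrDl !mulrA.
Qed.

Lemma stage_quit_corner (T : {set I}) k : T != finset.set0 ->
  stage_quit r (fun j => (j \in T)%:R) k = r T k.
Proof.
have pE S : probS (fun j => (j \in T)%:R) S = (S == T)%:R :> R.
  rewrite /probS; case: eqP => [->|/eqP ST].
    rewrite !big1 ?mulr1 // => j; first by rewrite inE => /negbTE ->; rewrite subr0.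
    by move=> ->.
  have [/fintype.subsetP sST|/subsetPn[j jS jT]] := boolP (S \subset T); last first.
    by rewrite (bigD1 j) //= (negbTE jT) !mul0r.
  have /subsetPn[j jT jS] : ~~ (T \subset S).
    by apply: contra ST => TS; rewrite finset.eqEsubset TS andbT; apply/fintype.subsetP.
  by rewrite [X in _ * X](bigD1 j) ?inE //= jT subrr mul0r mulr0.
move=> T0; rewrite /stage_quit (bigD1 T) //= pE eqxx mul1r big1 ?addr0 // => S /andP[_ /negbTE ST].
by rewrite pE ST mul0r.
Qed.

Lemma stage_quit_none p k : (forall j, p j = 0) -> stage_quit r p k = 0.
Proof.
move=> p0; rewrite /stage_quit big1 // => S /finset.set0Pn[j jS].
by rewrite /probS (bigD1 j) //= p0 !mul0r.
Qed.

Lemma stage_quit_single p j k : (forall l, l != j -> p l = 0) ->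
  stage_quit r p k = p j * r [set j]%SET k.
Proof.
move=> p0; rewrite -{1}(updf_id p j) stage_quit_updf.
rewrite [X in _ + _ * X]stage_quit_none ?mulr0 ?addr0; last first.
  by move=> l; rewrite /updf; case: eqP => // /eqP /p0.
congr (_ * _); rewrite -stage_quit_corner; last by apply/finset.set0Pn; exists j; rewrite inE.
by congr stage_quit; apply: funext => l; rewrite /updf inE; case: eqP => // /eqP /p0.
Qed.

Lemma stage_quit_pair p i j k : i != j -> (forall l, l != i -> l != j -> p l = 0) ->
  stage_quit r p k = p i * (p j * r [set i; j]%SET k + (1 - p j) * r [set i]%SET k)
     + (1 - p i) * (p j * r [set j]%SET k).
Proof.
move=> ij p0; rewrite -{1}(updf_id p i) stage_quit_updf.
rewrite [X in _ + _ * X](@stage_quit_single _ j); last first.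
  by move=> l lj; rewrite /updf; case: eqP => // /eqP /p0; exact.
have -> : updf p i 0 j = p j by rewrite /updf eq_sym (negbTE ij).
congr (_ * _ + _); rewrite -{1}(updf_id (updf p i 1) j) stage_quit_updf.
have -> : updf p i 1 j = p j by rewrite /updf eq_sym (negbTE ij).
rewrite [X in _ + _ * X = _](@stage_quit_single _ i); last first.
  move=> l li; rewrite /updf (negbTE li); case: (l =P j) => // /eqP; exact: p0 li.
have -> : updf (updf p i 1) j 0 i = 1 by rewrite /updf (negbTE ij) eqxx.
rewrite mul1r; congr (_ * _ + _).
rewrite -stage_quit_corner; last by apply/finset.set0Pn; exists i; rewrite !inE eqxx.
congr stage_quit; apply: funext => l; rewrite /updf !inE.
case: (l =P j) => [_|/eqP lj]; first by rewrite orbT.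
by case: (l =P i) => // /eqP li; rewrite p0.
Qed.

Hypothesis rb : payoffs_bounded r.

Lemma r_norm S k : `|r S k| <= 1.
Proof. by rewrite ler_norml rb. Qed.

Lemma stage_quit_norm p k : (forall j, 0 <= p j <= 1) ->
  `|stage_quit r p k| <= 1 - \prod_j (1 - p j).
Proof.
move=> p01; rewrite -sum_probS_neq0; apply: le_trans (ler_norm_sum _ _ _) _.
apply: ler_sum => S _; rewrite normrM ger0_norm ?probS_ge0 //.
by rewrite ler_piMr ?probS_ge0 // r_norm.
Qed.

Lemma prod_1B_ge (P : pred I) (p : I -> R) : (forall j, 0 <= p j <= 1) ->
  1 - \sum_(j | P j) p j <= \prod_(j | P j) (1 - p j).
Proof.
move=> p01.
suff [_ //] : 0 <= \prod_(j | P j) (1 - p j) <= 1 /\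
    1 - \sum_(j | P j) p j <= \prod_(j | P j) (1 - p j).
apply: (big_rec2 (fun s q => 0 <= q <= 1 /\ 1 - s <= q)).
  by rewrite ler01 lexx subr0.
by move=> j s q _ [/andP[q0 q1] sq]; have /andP[? ?] := p01 j; split; nra.
Qed.

(** Two errors, each at most the square of [s = \sum_j p j]: the probabilities that exactly one
    given player quits fall short of the [p j], and several players may quit at once. *)
Lemma stage_quit_linear p k : (forall j, 0 <= p j <= 1) ->
  `|stage_quit r p k - \sum_j p j * r [set j]%SET k| <= 2 * (\sum_j p j) ^+ 2.
Proof.
move=> p01; set s := \sum_j p j.
pose A : {set {set I}} := [set [set j]%SET | j in [set: I]%SET]%SET.
have sumA (F : {set I} -> R) : \sum_(S in A) F S = \sum_j F [set j]%SET.
  rewrite big_imset /=; first by apply: eq_bigl => j; rewrite inE.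
  by move=> i j _ _; exact: finset.set1_inj.
have sub S : S \in A -> S != finset.set0.
  by case/imsetP => j _ ->; apply/finset.set0Pn; exists j; rewrite inE.
have splitA (F : {set I} -> R) : \sum_(S : {set I} | S != finset.set0) F S =
    \sum_j F [set j]%SET + \sum_(S : {set I} | (S != finset.set0) && (S \notin A)) F S.
  rewrite (bigID (mem A)) /= -sumA; congr (_ + _); apply: eq_bigl => S.
  by case: (boolP (S \in A)) => [/sub ->|]; rewrite ?andbF.
have pj j : p j * (1 - s) <= probS p [set j]%SET <= p j.
  have /andP[p0 p1] := p01 j.
  rewrite /probS big_set1; apply/andP; split.
    rewrite ler_wpM2l //; apply: le_trans (prod_1B_ge _ p01).
    rewrite lerD2l lerN2 /s [leRHS](bigID (mem (~: [set j])%SET)) /= lerDl.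
    by apply: sumr_ge0 => l _; case/andP: (p01 l).
  rewrite ler_piMr //; apply: prodr_ile1 => l _; have /andP[? ?] := p01 l.
  by rewrite subr_ge0 lerBlDr lerDl; apply/andP.
have E := sum_probS_neq0 p; rewrite splitA in E.
have s_le : 1 - \prod_j (1 - p j) <= s.
  by have := @prod_1B_ge xpredT p p01; rewrite -/s => h; lra.
have sumP : \sum_j probS p [set j]%SET >= s * (1 - s).
  by rewrite {1}/s mulr_suml; apply: ler_sum => j _; case/andP: (pj j).
rewrite /stage_quit splitA addrAC -sumrB.
apply: (@le_trans _ _ ((\sum_j (p j - probS p [set j]%SET)) +
   \sum_(S : {set I} | (S != finset.set0) && (S \notin A)) probS p S)); last first.
  by rewrite sumrB -/s; nra.
apply: le_trans (ler_normD _ _) _; apply: lerD.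
  apply: le_trans (ler_norm_sum _ _ _) _; apply: ler_sum => j _.
  have /andP[_ h] := pj j.
  have h' : 0 <= p j - probS p [set j]%SET by rewrite subr_ge0.
  by rewrite -mulrBl normrM distrC (ger0_norm h') ler_piMr // r_norm.
apply: le_trans (ler_norm_sum _ _ _) _; apply: ler_sum => S _.
by rewrite normrM ger0_norm ?probS_ge0 // ler_piMr ?probS_ge0 // r_norm.
Qed.

Lemma stage_quit_cts k : seq_cts (fun p => stage_quit r p k).
Proof.
move=> U UU x l xl; rewrite /stage_quit /probS.
apply: (@cvg_big R _ +%R 0) => [|S _]; first exact: add_continuous.
apply: cvgM; last exact: cvg_cst.
apply: cvgM; apply: cvg_prodU => // j _.
by apply: cvgB => //; exact: cvg_cst.
Qed.

End Stage.

(** * Convergence of payoffs and criteria for stationary equilibria *)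

Section Stationary.
Variables (R : realType) (N : nat).
Local Notation I := 'I_N.

(** [u + 2 * s] decreases, and it is bounded below because [u - 2 * s] increases. With [s] a
    survival probability this shows that the [limn] in the payoffs is a true limit. *)
Lemma cvg_variation (u s : nat -> R) : (forall n, 0 <= s n) ->
  (forall n, `|u n.+1 - u n| <= 2 * (s n - s n.+1)) -> cvgn u.
Proof.
move=> s0 us.
have sS n : s n.+1 <= s n by have := le_trans (normr_ge0 _) (us n); lra.
have s_ni : {homo s : m n / (m <= n)%N >-> n <= m} by apply/nonincreasing_seqP.
have s_lb : has_lbound (range s) by exists 0 => _ [n _ <-].
have s_cvg := nonincreasing_is_cvgn s_ni s_lb.
have v_cvg : cvgn (fun n => u n + 2 * s n).
  apply: nonincreasing_is_cvgn.
    by apply/nonincreasing_seqP => n; have := us n; rewrite ler_norml => /andP[_]; lra.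
  exists (u 0%N - 2 * s 0%N) => _ [n _ <-].
  suff : u 0%N - 2 * s 0%N <= u n - 2 * s n by have := s0 n; lra.
  elim: n => [//|n IH]; have := us n; rewrite ler_norml => /andP[]; lra.
have -> : u = (fun n => (u n + 2 * s n) - 2 * s n) by apply: funext => n; lra.
by apply: is_cvgB => //; apply: is_cvgMr.
Qed.

Definition no_quit (p : I -> R) : R := \prod_j (1 - p j).

Lemma no_quit_01 p : (forall j, 0 <= p j <= 1) -> 0 <= no_quit p <= 1.
Proof.
move=> p01; rewrite /no_quit prodr_ge0 ?prodr_ile1 // => j _; have /andP[? ?] := p01 j.
  by rewrite subr_ge0 lerBlDr lerDl; apply/andP.
by rewrite subr_ge0.
Qed.

Lemma no_quit_updf p i y : no_quit (updf p i y) = (1 - y) * no_quit (updf p i 0).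
Proof.
rewrite /no_quit (bigD1 i) //= [in RHS](bigD1 i) //= /updf eqxx subr0 mul1r.
by congr (_ * _); apply: eq_bigr => j /negbTE ->.
Qed.

Lemma no_quit_pair p i j : i != j -> (forall l, l != i -> l != j -> p l = 0) ->
  no_quit p = (1 - p i) * (1 - p j).
Proof.
move=> ij p0; rewrite /no_quit (bigD1 i) //= (bigD1 j) 1?eq_sym //= big1 ?mulr1 // => l /andP[li lj].
by rewrite p0 ?subr0.
Qed.

Definition surv (x : profile R N) T := \prod_(u < T) no_quit (fun j => x j u).

Lemma survS x T : surv x T.+1 = surv x T * no_quit (fun j => x j T).
Proof. by rewrite /surv big_ord_recr. Qed.

Lemma surv_ge0 x T : (forall j, is_strategy (x j)) -> 0 <= surv x T.
Proof.
by move=> xs; rewrite prodr_ge0 // => u _; case/andP: (@no_quit_01 (x^~ u) (fun j => xs j u)).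
Qed.

Variable r : game R N.

Lemma gamma_truncS x i T : gamma_trunc r x i T.+1 = gamma_trunc r x i T +
  surv x T * (stage_quit r (fun j => x j T) i
              - (1 - no_quit (fun j => x j T)) * r finset.set0 i).
Proof.
by rewrite /gamma_trunc !big_ord_recr /= -/(no_quit _) -/(surv _ _); ring.
Qed.

Hypothesis rb : payoffs_bounded r.

Lemma gamma_cvg x i : (forall j, is_strategy (x j)) -> cvgn (gamma_trunc r x i).
Proof.
move=> xs; apply: (@cvg_variation _ (surv x)) => T; first exact: surv_ge0.
have p01 j := xs j T.
rewrite gamma_truncS addrAC subrr add0r survS -{2}[surv x T]mulr1 -mulrBr.
rewrite normrM (ger0_norm (surv_ge0 _ xs)) mulrCA ler_wpM2l ?surv_ge0 //.
have := stage_quit_norm rb i p01; have := r_norm rb finset.set0 i.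
have /andP[] := no_quit_01 p01; rewrite -/(no_quit _).
set q := no_quit _; set s := stage_quit _ _ _; set e := r _ _.
rewrite !ler_norml => ? ? /andP[? ?] /andP[? ?]; nra.
Qed.

Lemma surv_cvg0 x c : (forall j, is_strategy (x j)) -> c < 1 ->
  (forall t, no_quit (fun j => x j t) <= c) -> surv x @ \oo --> 0.
Proof.
move=> xs c1 xc.
have c0 : 0 <= c.
  by apply: le_trans (xc 0%N); case/andP: (@no_quit_01 (x^~ 0%N) (fun j => xs j 0%N)).
apply: (@squeeze_cvgr _ _ _ _ (fun=> 0) (fun n => c ^+ n)).
- apply: nearW => n; rewrite surv_ge0 //= /surv.
  elim: n => [|n IH]; first by rewrite big_ord0.
  rewrite big_ord_recr /= exprSr ler_pM ?(surv_ge0 n xs) //.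
  by case/andP: (@no_quit_01 (x^~ n) (fun j => xs j n)).
- exact: cvg_cst.
- by apply: cvg_expr; rewrite ger0_norm.
Qed.

(** The factor [s] will be 1 or -1, so that one induction yields both bounds. The truncated payoff
    is compared with the mean of [b] and the payoff of never quitting, weighted by the survival
    probability. *)
Let gamma_bound x i (b s : R) : (forall j, is_strategy (x j)) -> surv x @ \oo --> 0 ->
  (forall t, s * stage_quit r (fun j => x j t) i <= s * (1 - no_quit (fun j => x j t)) * b) ->
  s * gamma r x i <= s * b.
Proof.
move=> xs x0 xb.
have gl : s * gamma_trunc r x i n @[n --> \oo] --> s * gamma r x i.
  by apply: cvgMr; exact: gamma_cvg.
have bl : s * ((1 - surv x n) * b + surv x n * r finset.set0 i) @[n --> \oo] --> s * b.
  have -> : s * b = s * ((1 - 0) * b + 0 * r finset.set0 i) by ring.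
  apply: cvgMr; apply: cvgD; last exact: cvgMl.
  by apply: cvgMl; apply: cvgB => //; exact: cvg_cst.
apply: (ler_cvg_to gl bl); apply: nearW => n.
elim: n => [|n IH]; first by rewrite /gamma_trunc /surv !big_ord0 subrr; lra.
rewrite gamma_truncS survS.
have := xb n; have := surv_ge0 n xs.
set q := no_quit _; set sq := stage_quit _ _ _; set e := r _ _ in IH *; set v := surv x n in IH *.
move=> v0 h; have := ler_wpM2l v0 h; nra.
Qed.

Lemma gamma_le x i b : (forall j, is_strategy (x j)) -> surv x @ \oo --> 0 ->
  (forall t, stage_quit r (fun j => x j t) i <= (1 - no_quit (fun j => x j t)) * b) ->
  gamma r x i <= b.
Proof.
move=> xs x0 xb; rewrite -(mul1r (gamma _ _ _)) -(mul1r b).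
by apply: gamma_bound => // t; rewrite !mul1r.
Qed.

Lemma gamma_ge x i b : (forall j, is_strategy (x j)) -> surv x @ \oo --> 0 ->
  (forall t, (1 - no_quit (fun j => x j t)) * b <= stage_quit r (fun j => x j t) i) ->
  b <= gamma r x i.
Proof.
move=> xs x0 xb; rewrite -lerN2 -[- b]mulN1r -[- gamma _ _ _]mulN1r.
by apply: gamma_bound => // t; rewrite -mulrA !mulN1r lerN2.
Qed.

(** At every stage a deviation of [i] mixes quitting at once with waiting; in either case the stage
    payoff is at most [b i] times the probability that the game stops, so [b i] bounds every
    deviation. *)
Lemma stationary_eps_eq eps (x b : I -> R) : (forall i, 0 <= x i <= 1) ->
  (forall i, no_quit (updf x i 0) < 1) ->
  (forall i, stage_quit r (updf x i 1) i <= b i) ->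
  (forall i, stage_quit r (updf x i 0) i <= (1 - no_quit (updf x i 0)) * b i) ->
  (forall i, (1 - no_quit x) * (b i - eps) <= stage_quit r x i) ->
  eps_equilibrium r eps (fun j _ => x j).
Proof.
move=> x01 c1 Ab Bb xb.
have xs j : is_strategy (fun=> x j) by move=> t.
split=> // i y ys.
have u01 j : 0 <= updf x i 0 j <= 1 by rewrite /updf; case: eqP => // _; rewrite lexx ler01.
have /andP[q0 q1] := no_quit_01 u01.
have devE t : (fun j => dev (fun j _ => x j) i y j t) = updf x i (y t).
  by apply: funext => j; rewrite /dev /updf; case: eqP.
apply: (@le_trans _ _ (b i - eps)).
  rewrite lerD2r; apply: gamma_le.
  - by move=> j; rewrite /dev; case: eqP.
  - apply: (@surv_cvg0 _ (no_quit (updf x i 0))) => // [j|t].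
      by rewrite /dev; case: eqP.
    rewrite devE no_quit_updf; have /andP[? ?] := ys t; nra.
  - move=> t; rewrite devE no_quit_updf stage_quit_updf.
    have := Ab i; have := Bb i; have /andP[? ?] := ys t.
    set A := stage_quit _ _ _; set B := stage_quit _ _ _; set q := no_quit _ in q0 q1 *; nra.
apply: gamma_ge => //.
apply: (@surv_cvg0 _ (no_quit x)) => //.
apply: le_lt_trans (c1 i); rewrite -{1}(updf_id x i) no_quit_updf.
have /andP[? ?] := x01 i; nra.
Qed.

(** [f] has the sign of the advantage of quitting now over never quitting. The bound [b i] chosen
    below is the larger of these two payoffs, and [x] attains it. *)
Lemma complementary_eps_eq eps (x : I -> R) : 0 <= eps -> (forall i, 0 <= x i <= 1) ->
  (forall i, no_quit (updf x i 0) < 1) ->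
  (forall i, let f := (1 - no_quit (updf x i 0)) * stage_quit r (updf x i 1) i
                - stage_quit r (updf x i 0) i in
     (x i = 0 \/ 0 <= f) /\ (x i = 1 \/ f <= 0)) ->
  eps_equilibrium r eps (fun j _ => x j).
Proof.
move=> e0 x01 c1 xf.
apply: (@stationary_eps_eq _ _ (fun i => if x i == 0
  then stage_quit r (updf x i 0) i / (1 - no_quit (updf x i 0)) else stage_quit r (updf x i 1) i)) => //= i;
  have := c1 i; have [f0 f1] := xf i; have /andP[x0 x1] := x01 i;
  set q := no_quit (updf x i 0) in f0 f1 *; set A := stage_quit _ (updf x i 1) _ in f0 f1 *;
  set B := stage_quit _ (updf x i 0) _ in f0 f1 * => q1;
  have D0 : 0 < 1 - q by rewrite subr_gt0.
- case: eqP => [xi|_] //.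
  rewrite ler_pdivlMr // mulrC; case: f1; lra.
- case: eqP => [xi|xi]; first by rewrite mulrC divfK // gt_eqF.
  by case: f0; lra.
- rewrite -(updf_id x i) no_quit_updf stage_quit_updf updf_id -/q -/A -/B.
  case: eqP => [->|xi].
    rewrite subr0 !mul1r mul0r add0r mulrBr mulrC divfK ?gt_eqF //.
    by rewrite lerBlDr lerDl mulr_ge0 // ltW.
  have {f0}f0 : 0 <= (1 - q) * A - B by case: f0.
  have : 0 <= (1 - (1 - x i) * q) * eps.
    by rewrite mulr_ge0 //; nra.
  have : (1 - x i) * ((1 - q) * A - B) <= 0.
    by case: f1 => [->|]; [rewrite subrr mul0r|nra].
  nra.
Qed.

(* i quits at rate a while j, who hurts i, quits at a much smaller rate eta: i is
   deterred from never quitting, and the payoffs stay close to those of i quitting alone. *)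
Lemma punished_eps_eq eps i j a : 0 < eps -> (forall i, r [set i]%SET i = 0) ->
  i != j -> 0 < a <= 1 -> r [set j]%SET i <= 0 ->
  (forall k, k != i -> a * r [set i; k]%SET k - eps / 2 <= r [set i]%SET k) ->
  exists x : profile R N, stationary x /\ eps_equilibrium r eps x.
Proof.
move=> e0 r0 ij /andP[a0 a1] rji hk.
(* The odds of [j] against [i] are about [eta / a], which this keeps below [eps / 8]. *)
pose eta := Num.min (a * eps / 8) 1.
have eta0 : 0 < eta by rewrite /eta lt_min ltr01 andbT; apply: divr_gt0 => //; exact: mulr_gt0.
have eta1 : eta <= 1 by rewrite /eta ge_min lexx orbT.
have etae : eta <= a * eps / 8 by rewrite /eta ge_min lexx.
clearbody eta.
have eta0' := ltW eta0; have a0' := ltW a0.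
have ae0 : 0 <= a * eta by rewrite mulr_ge0.
have ae1 : 0 <= (1 - a) * eta by rewrite mulr_ge0 ?subr_ge0.
have ji : j != i by rewrite eq_sym.
pose x : I -> R := fun l => if l == i then a else if l == j then eta else 0.
have xi : x i = a by rewrite /x eqxx.
have xj : x j = eta by rewrite /x (negbTE ji) eqxx.
have x0 l : l != i -> l != j -> x l = 0 by rewrite /x => /negbTE -> /negbTE ->.
exists (fun l _ => x l); split => //.
have b1 S k : -1 <= r S k <= 1 by exact: rb.
(* Player [i] gets at most [eta] by quitting at once and at most 0 by waiting for [j]. The others
   essentially face [i] quitting alone; [2 * eta / a] is the odds of [j] times the range 2 of
   payoffs. *)
pose b k := if k == i then eta else if k == j then r [set i]%SET j + eps / 2 else
  r [set i]%SET k + eps / 2 + 2 * eta / a.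
have nq k : no_quit (updf x k 0) = if k == i then 1 - eta else if k == j then 1 - a
   else (1 - a) * (1 - eta).
  rewrite (@no_quit_pair _ i j) //; last first.
    by move=> l li lj; rewrite /updf x0 //; case: eqP.
  rewrite /updf xi xj; case: (eqVneq k i) => [->|ki].
    by rewrite (negbTE ji) subr0 mul1r.
  by case: (eqVneq k j) => // _; rewrite subr0 mulr1.
have sq0 k : stage_quit r (updf x k 0) k = if k == i then eta * r [set j]%SET i
   else if k == j then a * r [set i]%SET j
   else a * (eta * r [set i; j]%SET k + (1 - eta) * r [set i]%SET k) + (1 - a) * (eta * r [set j]%SET k).
  rewrite (@stage_quit_pair _ _ _ _ i j) //; last first.
    by move=> l li lj; rewrite /updf x0 //; case: eqP.
  rewrite /updf xi xj; case: (eqVneq k i) => [->|ki].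
    by rewrite (negbTE ji); ring.
  by case: (eqVneq k j) => [->|//]; ring.
have sq1i : stage_quit r (updf x i 1) i = eta * r [set i; j]%SET i.
  rewrite (@stage_quit_pair _ _ _ _ i j) //; last first.
    by move=> l li lj; rewrite /updf x0 // (negbTE li).
  by rewrite /updf eqxx (negbTE ji) xj r0; ring.
have sq1j : stage_quit r (updf x j 1) j = a * r [set i; j]%SET j.
  rewrite (@stage_quit_pair _ _ _ _ i j) //; last first.
    by move=> l li lj; rewrite /updf x0 // (negbTE lj).
  by rewrite /updf eqxx (negbTE ij) xi r0; ring.
have sq1k k : k != i -> k != j -> stage_quit r (updf x k 1) k <= a * r [set i; k]%SET k + 2 * eta.
  move=> ki kj; set p := updf x k 1.
  have pj : p j = eta by rewrite /p /updf eq_sym (negbTE kj) xj.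
  rewrite -(updf_id p j) pj stage_quit_updf.
  have p01 l : 0 <= updf p j 1 l <= 1.
    rewrite /updf /p /updf; case: eqP => _; first by rewrite ler01 lexx.
    case: eqP => _; first by rewrite ler01 lexx.
    rewrite /x; case: eqP => _; first by rewrite ltW.
    by case: eqP => _; rewrite ?lexx ?ler01 // ltW.
  have := stage_quit_norm rb k p01; rewrite -/(no_quit _) ler_norml => /andP[_ h1].
  have /andP[h2 _] := no_quit_01 p01.
  have ik : i != k by rewrite eq_sym.
  have -> : stage_quit r (updf p j 0) k = a * r [set i; k]%SET k.
    rewrite (@stage_quit_pair _ _ _ _ i k) //; last first.
      move=> l li lk; rewrite /updf /p /updf (negbTE lk).
      by case: (eqVneq l j) => // /x0 ->.
    by rewrite /updf /p /updf (negbTE ij) (negbTE ik) xi (negbTE kj) eqxx r0; ring.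
  have /andP[? ?] := b1 [set i; k]%SET k.
  have h3 : -1 <= a * r [set i; k]%SET k by nra.
  have : eta * (stage_quit r (updf p j 1) k - a * r [set i; k]%SET k) <= eta * 2.
    by rewrite ler_wpM2l //; lra.
  lra.
apply: (@stationary_eps_eq _ _ b).
- move=> l; rewrite /x; case: eqP => _; first by rewrite ltW.
  by case: eqP => _; rewrite ?lexx ?ler01 // ltW.
- move=> k; rewrite nq; case: eqP => _; first by lra.
  case: eqP => _; first by lra.
  have : 0 <= (1 - a) * eta by rewrite mulr_ge0 ?subr_ge0 // ltW.
  lra.
- move=> k; rewrite /b; case: (eqVneq k i) => [->|ki].
    by rewrite sq1i; have /andP[? ?] := b1 [set i; j]%SET i; nra.
  have hki := hk _ ki; case: (eqVneq k j) => [kj|kj].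
    by rewrite kj sq1j; rewrite kj in hki; lra.
  apply: le_trans (sq1k _ ki kj) _.
  have : 2 * eta <= 2 * eta / a by rewrite ler_pdivlMr //; nra.
  lra.
- move=> k; rewrite sq0 nq /b; case: (eqVneq k i) => [_|ki]; first by nra.
  case: (eqVneq k j) => [kj|kj]; first by nra.
  have ea : eta = (eta / a) * a by rewrite divfK // gt_eqF.
  have /andP[u1 u2] := b1 [set i]%SET k; have /andP[v1 v2] := b1 [set j]%SET k.
  have /andP[w1 w2] := b1 [set i; j]%SET k.
  rewrite -[2 * eta / a]mulrA; have : 0 <= eta / a by rewrite divr_ge0 // ltW.
  move=> ya0.
  have h : (a + eta - a * eta) * (eta / a) >= eta by nra.
  have h1 : 0 <= (a + eta - a * eta) * eps by nra.
  have : a * eta * (r [set i; j]%SET k - r [set i]%SET k) <= a * eta * 2 by rewrite ler_wpM2l //; lra.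
  have : (1 - a) * eta * (r [set j]%SET k - r [set i]%SET k) <= (1 - a) * eta * 2.
    by rewrite ler_wpM2l //; lra.
  nra.
- move=> k; have nqx : no_quit x = (1 - a) * (1 - eta).
    by rewrite (@no_quit_pair _ i j) // xi xj.
  rewrite nqx -{1}(updf_id x k) stage_quit_updf sq0 /b.
  have -> : 1 - (1 - a) * (1 - eta) = a + eta - a * eta by ring.
  case: (eqVneq k i) => [->|ki].
    rewrite xi sq1i; have /andP[? ?] := b1 [set i; j]%SET i; have /andP[? ?] := b1 [set j]%SET i.
    have : a * eta * r [set i; j]%SET i >= - (a * eta) by nra.
    have : (1 - a) * eta * r [set j]%SET i >= - ((1 - a) * eta) by nra.
    have : (a + eta - a * eta) * (eta - eps) <= a * (eta - eps) by nra.
    nra.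
  case: (eqVneq k j) => [->|kj].
    rewrite xj sq1j; have /andP[? ?] := b1 [set i; j]%SET j; have /andP[? ?] := b1 [set i]%SET j.
    have : a * eta * r [set i; j]%SET j >= - (a * eta) by nra.
    have : (a + eta - a * eta) * (eps / 2) >= a * (eps / 2) by nra.
    have : eta * r [set i]%SET j <= eta by nra.
    nra.
  rewrite x0 // mul0r subr0 mul1r add0r.
  have ea : eta = (eta / a) * a by rewrite divfK // gt_eqF.
  have /andP[u1 u2] := b1 [set i]%SET k; have /andP[v1 v2] := b1 [set j]%SET k.
  have /andP[w1 w2] := b1 [set i; j]%SET k.
  rewrite -[2 * eta / a]mulrA; have : 0 <= eta / a by rewrite divr_ge0 // ltW.
  have : eta / a <= eps / 8 by rewrite ler_pdivrMr //; lra.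
  move=> ya8 ya0.
  have : a * eta * (r [set i; j]%SET k - r [set i]%SET k) >= a * eta * (- 2) by rewrite ler_wpM2l //; lra.
  have : (1 - a) * eta * (r [set j]%SET k - r [set i]%SET k) >= (1 - a) * eta * (- 2).
    by rewrite ler_wpM2l //; lra.
  have : (a + eta - a * eta) * (eps / 2 - 2 * (eta / a)) >= a * (eps / 2 - 2 * (eta / a)) by nra.
  nra.
Qed.

End Stationary.

(** * Normal players and the principal submatrix on them *)

Section Normal.
Variables (R : realType) (N : nat).
Local Notation I := 'I_N.

(* The linear complementarity problem for the principal submatrix of A indexed by J. *)
Definition lcp (A : I -> I -> R) (J : {set I}) (q z : I -> R) :=
  [/\ forall i, 0 <= z i, forall i, i \notin J -> z i = 0 &
      forall i, i \in J -> 0 <= q i + \sum_j z j * A i j /\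
        (z i = 0 \/ q i + \sum_j z j * A i j = 0)].

Definition R0_on A J := forall z, lcp A J (fun=> 0) z -> forall i, z i = 0.
Definition Q_on A J := forall q, exists z, lcp A J q z.

Lemma exists_small (P : pred I) (v b : I -> R) : (forall i, P i -> 0 < v i) ->
  exists2 t, 0 < t & forall i, P i -> t * b i <= v i.
Proof.
move=> v0; pose S := 1 + \sum_(i | P i) `|b i| / v i.
have S1 : 1 <= S.
  by rewrite lerDl sumr_ge0 // => i Pi; rewrite divr_ge0 // ltW // v0.
have S0 : 0 < S by rewrite (lt_le_trans _ S1).
exists S^-1; rewrite ?invr_gt0 // => i Pi.
rewrite mulrC ler_pdivrMr //; apply: le_trans (ler_norm _) _.
rewrite mulrC -ler_pdivrMr ?v0 //; apply: (@le_trans _ _ (\sum_(i | P i) `|b i| / v i)).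
  by rewrite (bigD1 i) //= lerDl sumr_ge0 // => j /andP[Pj _]; rewrite divr_ge0 // ltW // v0.
by rewrite lerDr.
Qed.

Lemma lcp_scale (A : I -> I -> R) (J : {set I}) q z s : 0 < s -> lcp A J q z ->
  lcp A J (fun i => s * q i) (fun i => s * z i).
Proof.
move=> s0 [z0 zJ zq]; split=> [i|i /zJ ->|i /zq]; first by rewrite mulr_ge0 // ltW.
  by rewrite mulr0.
have -> : s * q i + \sum_j s * z j * A i j = s * (q i + \sum_j z j * A i j).
  by rewrite mulrDr mulr_sumr; congr (_ + _); apply: eq_bigr => j _; rewrite mulrA.
move=> [w0 [->|->]]; rewrite mulr0; split; [|by left|by [] |by right].
by rewrite mulr_ge0 // ltW.
Qed.

Variable r : game R N.
Let A : I -> I -> R := fun i j => r [set j]%SET i.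

Lemma Ilev_sub l m : (l <= m)%N -> Ilev r m \subset Ilev r l.
Proof.
elim: m => [|m IH]; first by rewrite leqn0 => /eqP ->.
rewrite leq_eqVlt => /orP[/eqP -> //|]; rewrite ltnS => /IH; apply: fintype.subset_trans.
by apply/fintype.subsetP => i; rewrite inE => /andP[].
Qed.

Lemma in_Istar i : i \in Istar r <-> forall l, i \in Ilev r l.
Proof. by rewrite inE; split => [/asboolP|?]; [|apply/asboolP]. Qed.

Lemma Istar_stable : exists l, Istar r = Ilev r l.
Proof.
have [l hl] : exists l, Ilev r l.+1 = Ilev r l.
  apply: contrapT => H.
  have card l : (#|Ilev r l| + l <= N)%N.
    elim: l => [|l IH]; first by rewrite addn0 /= cardsT card_ord.
    have : (#|Ilev r l.+1| < #|Ilev r l|)%N.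
      apply: proper_card; rewrite finset.properEneq Ilev_sub ?leqnSn // andbT.
      by apply/negP => /eqP h; apply: H; exists l.
    by move: IH; lia.
  by have := card N.+1; lia.
have st m : Ilev r (l + m) = Ilev r l.
  elim: m => [|m IH]; first by rewrite addn0.
  by rewrite addnS -[RHS]hl /= IH.
exists l; apply/setP => i; apply/idP/idP => [/in_Istar //|il].
apply/in_Istar => m; apply: (fintype.subsetP (Ilev_sub (leq_addl l m))).
by rewrite st.
Qed.

(** The elimination stops at some level, so the witness that keeps [i] at the next level is itself
    normal. *)
Lemma Istar_punisher i : i \in Istar r -> exists j, [/\ j \in Istar r, j != i & A i j <= 0].
Proof.
have [l hl] := Istar_stable => iI; have /in_Istar /(_ l.+1) := iI.
rewrite /= inE => /andP[_ /exists_inP[j jl /andP[ji rj]]].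
by exists j; rewrite hl.
Qed.

(** Take the last level that contains [i]: he leaves because nobody there hurts him. *)
Lemma notin_Istar i : i \notin Istar r -> exists l, i \in Ilev r l /\
  forall j, j \in Ilev r l -> j != i -> 0 < A i j.
Proof.
move=> iI; have [l il] : exists l, i \notin Ilev r l.
  apply: contrapT => H; move/negP: iI; apply; apply/in_Istar => l.
  by apply/negPn/negP => il; apply: H; exists l.
elim: l il => [|l IH]; first by rewrite inE.
have [il|/IH //] := boolP (i \in Ilev r l).
rewrite /= inE il /= => /exists_inP H; exists l; split => // j jl ji.
by rewrite ltNge; apply/negP => h; apply: H; exists j => //; rewrite ji.
Qed.

Let J := Istar r.
Let ext (v : 'cV[R]_(#|J|)) : I -> R := fun i => \sum_(k | enum_val k == i) v k 0.

Let extE v k : ext v (enum_val k) = v k 0.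
Proof. by rewrite /ext (big_pred1 k) // => l; rewrite (inj_eq enum_val_inj). Qed.

Let ext0 v i : i \notin J -> ext v i = 0.
Proof.
by move=> iJ; rewrite /ext big1 // => k /eqP ki; rewrite -ki enum_valP in iJ.
Qed.

Let mulE z k : (forall i, i \notin J -> z i = 0) ->
  (Rhat r *m \col_l z (enum_val l)) k 0 = \sum_j z j * A (enum_val k) j.
Proof.
move=> z0; rewrite mxE [in RHS](bigID (mem J)) /= [X in _ = _ + X]big1 ?addr0; last first.
  by move=> i /z0 ->; rewrite mul0r.
rewrite [in RHS]big_enum_val; apply: eq_bigr => l _.
by rewrite !mxE mulrC.
Qed.

(** A nonzero homogeneous solution, rescaled to mass 1, is a solution with [z0 = 0]. *)
Lemma Rhat_R0 : (forall w z0 z, LCP_sol (Rhat r) 0 w z0 z -> ~ (z0 < 1)) -> R0_on A J.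
Proof.
move=> H z [z0 zJ zq] i; apply: contrapT => zi.
pose s := \sum_i z i.
have zi0 : 0 < z i by rewrite lt_neqAle z0 andbT eq_sym; apply/eqP.
have s0 : 0 < s by rewrite /s (bigD1 i) //= ltr_pwDl // sumr_ge0.
pose y := fun i => s^-1 * z i.
have : lcp A J (fun=> 0) y.
  have zl : lcp A J (fun=> 0) z by [].
  have si0 : 0 < s^-1 by rewrite invr_gt0.
  by have := lcp_scale si0 zl; rewrite mulr0.
move=> [y0 yJ yq].
apply: (H (Rhat r *m \col_l y (enum_val l)) 0 (\col_l y (enum_val l))); last exact: ltr01.
split.
- move=> k; rewrite mulE //; have [+ _] := yq _ (enum_valP k).
  by rewrite add0r.
- by split=> // k; rewrite mxE.
- rewrite add0r; under eq_bigr do rewrite mxE.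
  rewrite -(big_enum_val (fun i => y i)) /=.
  rewrite /y -big_distrr /=; suff -> : \sum_(i in J) z i = s by rewrite mulVf // gt_eqF.
  by rewrite /s [RHS](bigID (mem J)) /= [X in _ = _ + X]big1 ?addr0.
- by rewrite scaler0 add0r.
- by move=> k; rewrite mulE // mxE; have [_] := yq _ (enum_valP k); rewrite add0r.
Qed.

Lemma Rhat_Q : Q_matrix (Rhat r) -> Q_on A J.
Proof.
move=> H q; have [z [w [z0 w0 wE zw]]] := H (\col_l q (enum_val l)).
exists (ext z).
have zE : z = \col_l ext z (enum_val l) by apply/colP => k; rewrite mxE extE.
have e0 := @ext0 z; split => // [i|i iJ]; first by rewrite /ext sumr_ge0.
have [k ->] : exists k : 'I_#|J|, i = enum_val k by exists (enum_rank_in iJ i); rewrite enum_rankK_in.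
have -> : q (enum_val k) + \sum_j ext z j * A (enum_val k) j = w k 0.
  by rewrite wE mxE -(mulE k e0) -zE; congr (_ + _); rewrite mxE.
split=> //; rewrite extE; have /eqP := zw k; rewrite mulf_eq0 => /orP[] /eqP; by [left|right].
Qed.

Lemma Q_Rhat : Q_on A J -> Q_matrix (Rhat r).
Proof.
move=> H q; have [z [z0 zJ zq]] := H (ext q).
exists (\col_l z (enum_val l)), (q + Rhat r *m \col_l z (enum_val l)).
have wE k : (q + Rhat r *m \col_l z (enum_val l)) k 0 =
    ext q (enum_val k) + \sum_j z j * A (enum_val k) j.
  by rewrite mxE (mulE _ zJ) extE.
split=> // k; first by rewrite mxE.
  by rewrite wE; case: (zq _ (enum_valP k)).
rewrite wE mxE; case: (zq _ (enum_valP k)) => _ [] ->; by rewrite ?mul0r ?mulr0.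
Qed.

End Normal.

(** * Stationary equilibria when the matrix is not a Q-matrix *)

Section NotQ.
Variables (R : realType) (N : nat) (r : game R N).
Local Notation I := 'I_N.
Hypothesis rb : payoffs_bounded r.
Hypothesis r0 : forall i, r [set i]%SET i = 0.
Let A : I -> I -> R := fun i j => r [set j]%SET i.

(** Quitting alone pays 0, so only the events in which another player quits too contribute. *)
Lemma quit_now_norm x i : (forall j, 0 <= x j <= 1) ->
  `|stage_quit r (updf x i 1) i| <= 1 - no_quit (updf x i 0).
Proof.
move=> x01.
have p01 j : 0 <= updf x i 1 j <= 1 by rewrite /updf; case: eqP => // _; rewrite lexx ler01.
have i0 : [set i]%SET != finset.set0 :> {set I} by apply/finset.set0Pn; exists i; rewrite inE.
rewrite /stage_quit (bigD1 [set i]%SET) //= r0 mulr0 add0r.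
have := sum_probS_neq0 (updf x i 1); rewrite -/(no_quit _) no_quit_updf subrr mul0r subr0.
rewrite (bigD1 [set i]%SET) //=.
have -> : probS (updf x i 1) [set i]%SET = no_quit (updf x i 0).
  rewrite /probS big_set1 /updf eqxx mul1r /no_quit [RHS](bigD1 i) //= eqxx subr0 mul1r.
  apply: eq_big => [j|j]; first by rewrite !inE.
  by rewrite !inE => /negbTE ->.
move=> E; rewrite -[X in _ <= X - _]E addrAC subrr add0r.
apply: le_trans (ler_norm_sum _ _ _) _; apply: ler_sum => S _.
by rewrite normrM ger0_norm ?probS_ge0 // ler_piMr ?probS_ge0 // r_norm.
Qed.

(* Positive iff i prefers quitting now to never quitting, in the game where each quiet
   stage ends with probability lam with payoff q; both sides are multiplied by the
   positive denominator of the latter payoff. *)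
Definition gain lam (q : I -> R) i (x : I -> R) :=
  (1 - (1 - lam) * no_quit (updf x i 0)) * stage_quit r (updf x i 1) i
  - (stage_quit r (updf x i 0) i + lam * no_quit (updf x i 0) * q i).

Lemma updf_cvg (U : set_system nat) (x : nat -> I -> R) (l : I -> R) i y j :
  UltraFilter U -> (forall j, x m j @[m --> U] --> l j) ->
  updf (x m) i y j @[m --> U] --> updf l i y j.
Proof. by move=> UU xl; rewrite /updf; case: eqP => // _; exact: cvg_cst. Qed.

Lemma no_quit_cvg (U : set_system nat) (x : nat -> I -> R) (l : I -> R) :
  UltraFilter U -> (forall j, x m j @[m --> U] --> l j) ->
  no_quit (x m) @[m --> U] --> no_quit l.
Proof. by move=> UU xl; apply: cvg_prodU => // j _; apply: cvgB => //; exact: cvg_cst. Qed.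

Lemma gain_cvg (U : set_system nat) (lam : nat -> R) (lam0 : R) (x : nat -> I -> R) (l : I -> R) q i :
  UltraFilter U -> (forall j, x m j @[m --> U] --> l j) -> lam m @[m --> U] --> lam0 ->
  gain (lam m) q i (x m) @[m --> U] --> gain lam0 q i l.
Proof.
move=> UU xl laml.
have nqc : no_quit (updf (x m) i 0) @[m --> U] --> no_quit (updf l i 0).
  by apply: no_quit_cvg => // j; exact: updf_cvg.
have sqc y : stage_quit r (updf (x m) i y) i @[m --> U] --> stage_quit r (updf l i y) i.
  by apply: stage_quit_cts => // j; exact: updf_cvg.
have c1 : (1 : R) @[_ --> U] --> (1 : R) by exact: cvg_cst.
apply: cvgB.
  apply: cvgM; last exact: sqc.
  by apply: cvgB => //; apply: cvgM => //; apply: cvgB.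
by apply: cvgD; [exact: sqc|apply: cvgM; [exact: cvgM|exact: cvg_cst]].
Qed.

Lemma sum_updf0 (x : I -> R) i (F : I -> R) :
  \sum_j updf x i 0 j * F j = \sum_(j | j != i) x j * F j.
Proof.
rewrite (bigD1 i) //= /updf eqxx mul0r add0r.
by apply: eq_bigr => j /negbTE ->.
Qed.

(** The linear part comes from waiting alone: quitting at once is worth at most [s], and its
    coefficient in [gain] is at most [lam + s]. *)
Lemma gain_expansion lam q i x : 0 <= lam <= 1 -> (forall j, 0 <= x j <= 1) ->
  forall s, s = \sum_(j | j != i) x j ->
  `|gain lam q i x + (\sum_(j | j != i) x j * A i j + lam * q i)|
    <= 2 * s ^+ 2 + (lam + s) * s + lam * s * `|q i|.
Proof.
move=> /andP[l0 l1] x01 s sdef; rewrite /gain.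
have u01 j : 0 <= updf x i 0 j <= 1 by rewrite /updf; case: eqP => // _; rewrite lexx ler01.
have := stage_quit_linear rb i u01; have := quit_now_norm i x01.
have sE : \sum_j updf x i 0 j = s.
  rewrite sdef; have := sum_updf0 x i (fun=> 1).
  by under eq_bigr do rewrite mulr1; under [in RHS]eq_bigr do rewrite mulr1.
rewrite (sum_updf0 x i (fun j => r [set j]%SET i)) sE.
have := @prod_1B_ge _ _ xpredT _ u01; rewrite sE -/(no_quit _).
have /andP[] := no_quit_01 u01.
set c := no_quit _; set a := stage_quit _ _ _; set b := stage_quit _ _ _.
rewrite -/(A i); set L := \sum_(j | _) _ => c0 c1 cs ha hb.
have s0 : 0 <= s by rewrite sdef; apply: sumr_ge0 => j _; case/andP: (x01 j).
have -> : (1 - (1 - lam) * c) * a - (b + lam * c * q i) + (L + lam * q i) =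
  (1 - (1 - lam) * c) * a - (b - L) + lam * (1 - c) * q i by ring.
apply: le_trans (ler_normD _ _) _; apply: lerD.
  apply: le_trans (ler_normB _ _) _; rewrite addrC; apply: lerD => //.
  have d0 : 0 <= 1 - (1 - lam) * c by nra.
  rewrite normrM (ger0_norm d0); apply: ler_pM => //; last by lra.
  by nra.
rewrite normrM ler_wpM2r // ger0_norm ?mulr_ge0 ?subr_ge0 // ler_wpM2l //; lra.
Qed.

Lemma not_Q_stationary q : (forall i, i \notin Istar r -> q i = 1) ->
  R0_on A (Istar r) -> (forall z, ~ lcp A (Istar r) q z) ->
  forall eps, 0 < eps -> exists x : profile R N, stationary x /\ eps_equilibrium r eps x.
Proof.
move=> q1 HR0 HQ eps e0.
pose lam (m : nat) : R := m.+1%:R^-1.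
have lam01 m : 0 <= lam m <= 1.
  by rewrite /lam invr_ge0 ler0n invf_le1 ?ltr0Sn // ler1n.
have lam_gt0 m : 0 < lam m by rewrite /lam invr_gt0 ltr0Sn.
have /choice[x hx] m : exists x : I -> R, (forall i, 0 <= x i <= 1) /\
    forall i, (x i = 0 \/ 0 <= gain (lam m) q i x) /\ (x i = 1 \/ gain (lam m) q i x <= 0).
  apply: cube_complementarity => i U UU x l xl.
  by apply: gain_cvg => //; exact: cvg_cst.
have [U [UU sU]] := nat_ultra.
have UP : ProperFilter U := @ultra_proper _ _ UU.
have x01 m i : 0 <= x m i <= 1 by have [] := hx m.
have /choice[xs hxs] i : exists l : R, x m i @[m --> U] --> l /\ 0 <= l <= 1.
  by have [l ? ?] := ultra_cvg UU (x01 ^~ i); exists l.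
have xl i : x m i @[m --> U] --> xs i by have [] := hxs i.
have xs01 i : 0 <= xs i <= 1 by have [] := hxs i.
have lam0 : lam m @[m --> U] --> (0 : R).
  by apply: cvg_coarse sU _; exact: cvg_harmonic.
have xs_sol i : (xs i = 0 \/ 0 <= gain 0 q i xs) /\ (xs i = 1 \/ gain 0 q i xs <= 0).
  have gl := @gain_cvg U lam 0 x xs q i UU xl lam0.
  split.
    have [m|U0|U0] := @ultra_split U (fun m => x m i = 0) (fun m => 0 <= gain (lam m) q i (x m)) UU.
    - by case: (hx m) => _ /(_ i) [].
    - by left; exact: (@cvg_eq_cst _ U _ _ 0 UP (xl i) U0).
    - by right; exact: (cvgr_to_ge gl U0).
  have [m|U0|U0] := @ultra_split U (fun m => x m i = 1) (fun m => gain (lam m) q i (x m) <= 0) UU.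
  - by case: (hx m) => _ /(_ i) [].
  - by left; exact: (@cvg_eq_cst _ U _ _ 1 UP (xl i) U0).
  - by right; exact: (cvgr_to_le gl U0).
have xi_neq0 i : xs i != 0 -> U [set m | x m i != 0].
  move=> xi; have [//|UC] := in_ultra_setVsetC [set m | x m i != 0] UU.
  case/eqP: xi; apply: (@cvg_eq_cst _ U _ _ 0 UP (xl i)).
  by apply: filterS UC => m /= /negP/negPn/eqP.
(* A normal player has a punisher by construction. If nobody hurt another player [i], then [q i = 1]
   and the positive entries would make waiting strictly better to first order, whereas [x m i != 0]
   requires a nonnegative gain. *)
have punisher i : (forall j, j != i -> xs j = 0) -> U [set m | x m i != 0] ->
    exists2 j, j != i & A i j <= 0.
  move=> xs0 Ui.
  have [/Istar_punisher[j [_ ? ?]]|iJ] := boolP (i \in Istar r); first by exists j.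
  apply: contrapT => H.
  have [b b0 hb] : exists2 t, 0 < t & forall j, j != i -> t * 1 <= A i j.
    apply: exists_small => j ji; rewrite ltNge; apply/negP => h; apply: H.
    by exists j.
  have sl : \sum_(j | j != i) x m j @[m --> U] --> (0 : R).
    rewrite [X in _ --> X](_ : 0 = \sum_(j | j != i) xs j); first exact: cvg_sumU.
    by rewrite big1.
  (* With [s < d] the error [3 * s ^+ 2 + 2 * lam * s] is less than half of [b * s + lam]. *)
  pose d : R := Num.min (b / 8) (1 / 8).
  have d0 : 0 < d by rewrite /d lt_min !divr_gt0.
  have Us : U [set m | \sum_(j | j != i) x m j < d] by exact: (cvgr_lt _ sl).
  have Ul : U [set m | lam m < 1 / 8] by apply: (cvgr_lt _ lam0); rewrite divr_gt0.
  have [m /= [[xmi sd] ld]] : [set m | x m i != 0] `&` [set m | \sum_(j | j != i) x m j < d]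
     `&` [set m | lam m < 1 / 8] !=set0.
    by apply: (@filter_ex _ U); apply: filterI => //; exact: filterI.
  have g0 : 0 <= gain (lam m) q i (x m).
    by have [_ /(_ i) [[xm|//] _]] := hx m; rewrite xm eqxx in xmi.
  have := gain_expansion q (lam01 m) (x01 m) (erefl (\sum_(j | j != i) x m j)).
  rewrite (q1 _ iJ) normr1 !mulr1 ler_norml => /andP[_].
  move: sd; set s := \sum_(j | _) x m j => sd.
  have s0 : 0 <= s by apply: sumr_ge0 => j _; case/andP: (x01 m j).
  have : b * s <= \sum_(j | j != i) x m j * A i j.
    rewrite /s mulr_sumr; apply: ler_sum => j /hb; rewrite mulr1 => h.
    by rewrite mulrC ler_wpM2l //; case/andP: (x01 m j).
  move: sd; rewrite /d lt_min => /andP[sb s8]; have := lam_gt0 m.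
  have /andP[l0 l1] := lam01 m => lp h1.
  have : lam m * s <= lam m * (1 / 8) by rewrite ler_wpM2l // ltW.
  have : s * s <= s * (b / 8) by rewrite ler_wpM2l // ltW.
  nra.
(* If the opponents of each player quit with positive probability in the limit, the terms in [lam]
   disappear and [xs] is an exact equilibrium. *)
have [allq|] := pselect (forall i, no_quit (updf xs i 0) < 1).
  exists (fun j _ => xs j); split => //.
  apply: (complementary_eps_eq rb) => // [|i]; first exact: ltW.
  by have := xs_sol i; rewrite /gain subr0 mul1r mul0r mul0r addr0.
move=> /existsNP[i /negP]; rewrite -leNgt => nq1.
have xs0 j : j != i -> xs j = 0.
  move=> ji; apply/eqP; rewrite eq_le; have /andP[-> _] := xs01 j; rewrite andbT leNgt.
  apply/negP => xj0; move: nq1; apply/negP; rewrite -ltNge.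
  have -> : updf xs i 0 = updf (updf xs i 0) j (xs j).
    by apply: funext => k; rewrite /updf; case: (k =P j) => // ->; rewrite (negbTE ji).
  rewrite no_quit_updf.
  have : 0 <= no_quit (updf (updf xs i 0) j 0) <= 1.
    apply: no_quit_01 => k; rewrite /updf.
    by case: eqP => _; [|case: eqP => _]; rewrite ?lexx ?ler01.
  have /andP[_ xj1] := xs01 j; move=> /andP[? ?]; nra.
have [xi0|xi0] := eqVneq (xs i) 0; last first.
  have [j ji rj] := punisher i xs0 (xi_neq0 i xi0).
  have xi_gt0 : 0 < xs i by rewrite lt_neqAle eq_sym xi0; case/andP: (xs01 i).
  have /andP[_ xi1] := xs01 i.
  apply: (@punished_eps_eq _ _ r rb eps i j (xs i)) => //; rewrite 1?eq_sym ?xi_gt0 // => k ki.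
  have ik : i != k by rewrite eq_sym.
  (* As only [i] quits in the limit, the gain of [k] is [xs i] times the difference of the two sides
     to be compared, up to the slack [eps / 2]. *)
  have [_ [xk|]] := xs_sol k; first by have := xs0 _ ki; rewrite xk => /eqP; rewrite oner_eq0.
  have ui : updf xs k 0 i = xs i by rewrite /updf (negbTE ik).
  have ui1 : updf xs k 1 i = xs i by rewrite /updf (negbTE ik).
  have uk0 y : updf xs k y k = y by rewrite /updf eqxx.
  have u0 y l : l != i -> l != k -> updf xs k y l = 0.
    by move=> li lk; rewrite /updf (negbTE lk) xs0.
  rewrite /gain (@no_quit_pair _ _ _ i k ik (u0 0)) (@stage_quit_pair _ _ r _ i k k ik (u0 0)).
  rewrite (@stage_quit_pair _ _ r _ i k k ik (u0 1)) ui ui1 !uk0 r0.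
  rewrite !subr0 !mul1r !mul0r !mulr0 !addr0 !mulr1 add0r subKr -mulrBr pmulr_rle0 //.
  by rewrite subr_le0; lra.
have {xs0}xs0 j : xs j = 0 by case: (eqVneq j i) => [->//|/xs0].
(* Blow-up at 0: divided by their sum, the rates lie in a simplex, so the limit keeps mass 1. *)
pose sg m := lam m + \sum_j x m j.
have sx0 m : 0 <= \sum_j x m j by apply: sumr_ge0 => j _; case/andP: (x01 m j).
have sg0 m : 0 < sg m by rewrite /sg ltr_pwDl.
pose z0 m := lam m / sg m; pose z m j := x m j / sg m.
have z0_01 m : 0 <= z0 m <= 1.
  have /andP[l0 _] := lam01 m; rewrite /z0 divr_ge0 ?(ltW (sg0 m)) //= ler_pdivrMr // mul1r.
  by rewrite /sg lerDl.
have z_01 j m : 0 <= z m j <= 1.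
  have /andP[x0 _] := x01 m j; rewrite /z divr_ge0 ?(ltW (sg0 m)) //= ler_pdivrMr // mul1r.
  rewrite /sg (bigD1 j) //=; have /andP[l0 _] := lam01 m.
  have : 0 <= \sum_(k | k != j) x m k by apply: sumr_ge0 => k _; case/andP: (x01 m k).
  lra.
have [w0 z0l /andP[w00 w01]] := ultra_cvg UU z0_01.
have /choice[w hw] j : exists l : R, z m j @[m --> U] --> l /\ 0 <= l <= 1.
  by have [l ? ?] := ultra_cvg UU (z_01 j); exists l.
have zl j : z m j @[m --> U] --> w j by have [] := hw j.
have w_ge0 j : 0 <= w j by have [_ /andP[]] := hw j.
have wsum : w0 + \sum_j w j = 1.
  have cl : z0 m + \sum_j z m j @[m --> U] --> w0 + \sum_j w j.
    by apply: cvgD => //; apply: cvg_sumU.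
  apply: (cvg_eq_cst UP cl); apply: filterS (@filterT _ U _) => m _ /=.
  by rewrite /z0 /z -mulr_suml -mulrDl -/(sg m) divff ?gt_eqF.
have sl : \sum_j x m j @[m --> U] --> (0 : R).
  rewrite [X in _ --> X](_ : 0 = \sum_j xs j); first exact: cvg_sumU.
  by rewrite big1.
have A0 k : A k k = 0 by exact: r0.
have gl k : gain (lam m) q k (x m) / sg m @[m --> U] --> - (w0 * q k + \sum_j w j * A k j).
  have L1 : - (z0 m * q k + \sum_j z m j * A k j) @[m --> U] --> - (w0 * q k + \sum_j w j * A k j).
    apply: cvgN; apply: cvgD; first by apply: cvgM => //; exact: cvg_cst.
    by apply: cvg_sumU => j _; apply: cvgM => //; exact: cvg_cst.
  have L2 : (3 + `|q k|) * \sum_j x m j @[m --> U] --> (0 : R).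
    by rewrite -[X in _ --> X](mulr0 (3 + `|q k|)); apply: cvgMr.
  apply: (@squeeze_cvgr _ _ _ _
    (fun m => - (z0 m * q k + \sum_j z m j * A k j) - (3 + `|q k|) * \sum_j x m j)
    (fun m => - (z0 m * q k + \sum_j z m j * A k j) + (3 + `|q k|) * \sum_j x m j)); last 2 first.
  - by rewrite -[X in _ --> X]subr0; apply: cvgB.
  - by rewrite -[X in _ --> X]addr0; apply: cvgD.
  apply: nearW => m.
  have := gain_expansion q (lam01 m) (x01 m) (erefl (\sum_(j | j != k) x m j)).
  have -> : \sum_(j | j != k) x m j * A k j = \sum_j x m j * A k j.
    by rewrite [RHS](bigD1 k) //= A0 mulr0 add0r.
  set s' := \sum_(j | _) x m j => /= hg.
  have s'0 : 0 <= s' by apply: sumr_ge0 => j _; case/andP: (x01 m j).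
  have s's : s' <= \sum_j x m j by rewrite [leRHS](bigD1 k) //= lerDr; case/andP: (x01 m k).
  have Ez : z0 m * q k + \sum_j z m j * A k j = (lam m * q k + \sum_j x m j * A k j) / sg m.
    rewrite /z0 /z mulrDl mulr_suml mulrAC; congr (_ + _).
    by apply: eq_bigr => j _; rewrite mulrAC.
  rewrite Ez -ler_distl opprK -mulrDl normrM (gtr0_norm (x := (sg m)^-1)) ?invr_gt0 // ler_pdivrMr //.
  rewrite [lam m * q k + _]addrC; apply: le_trans hg _.
  have /andP[l0 l1] := lam01 m; rewrite /sg.
  set s := \sum_j x m j in s's *; have q0 := normr_ge0 (q k).
  have h1 : s' ^+ 2 <= s ^+ 2 by rewrite ler_sqr ?nnegrE // (le_trans s'0).
  have h2 : lam m * s' <= lam m * s by rewrite ler_wpM2l.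
  have h3 : lam m * s' * `|q k| <= lam m * s * `|q k| by rewrite ler_wpM2r.
  have : 0 <= s ^+ 2 * `|q k| by rewrite mulr_ge0 ?sqr_ge0.
  have : 0 <= lam m * s by rewrite mulr_ge0 // sx0.
  lra.
have w_sol k : 0 <= w0 * q k + \sum_j w j * A k j /\
    (w k = 0 \/ w0 * q k + \sum_j w j * A k j = 0).
  have W0 : 0 <= w0 * q k + \sum_j w j * A k j.
    rewrite -oppr_le0; apply: (cvgr_to_le (gl k)).
    (* Since [xs k = 0], the alternative [x m k = 1] is eventually excluded. *)
    have : U [set m | x m k < 1] by apply: (cvgr_lt _ (xl k)); rewrite xs0 ltr01.
    apply: filterS => m /= xk; rewrite ler_pdivrMr // mul0r.
    by have [_ /(_ k) [_ [xm|//]]] := hx m; rewrite xm ltxx in xk.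
  split=> //.
  have [m|U0|U0] := @ultra_split U (fun m => x m k = 0) (fun m => 0 <= gain (lam m) q k (x m)) UU.
  - by case: (hx m) => _ /(_ k) [].
  - left; apply: (@cvg_eq_cst _ U _ _ 0 UP (zl k)); apply: filterS U0 => m /= xm.
    by rewrite /z xm mul0r.
  - right; apply/eqP; rewrite eq_le W0 andbT -oppr_ge0; apply: (cvgr_to_ge (gl k)).
    by apply: filterS U0 => m /= g0; rewrite divr_ge0 // ltW.
have [[k wk]|nosingle] := pselect (exists k, w k = 1).
  have [w0_0 wj0] : w0 = 0 /\ forall j, j != k -> w j = 0.
    have : w0 + \sum_(j | j != k) w j = 0.
      by move: wsum; rewrite (bigD1 k) //= wk; lra.
    have s0 : 0 <= \sum_(j | j != k) w j by apply: sumr_ge0.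
    move=> h; split; first by lra.
    have : \sum_(j | j != k) w j = 0 by lra.
    by move/eqP; rewrite psumr_eq0 // => /allP hw0 j jk; have := hw0 j (mem_index_enum _);
       rewrite jk => /eqP.
  have Uk : U [set m | x m k != 0].
    have [//|UC] := in_ultra_setVsetC [set m | x m k != 0] UU.
    have : w k = 0.
      apply: (@cvg_eq_cst _ U _ _ 0 UP (zl k)); apply: filterS UC => m /= /negP/negPn/eqP xm.
      by rewrite /z xm mul0r.
    by rewrite wk => /eqP; rewrite oner_eq0.
  have [j jk rj] := punisher k (fun j _ => xs0 j) Uk.
  (* By [w_sol] the entries [A l k] are nonnegative, and at a rate of at most [eps / 2] joining [k]
     pays [l] at most [eps / 2]. *)
  apply: (@punished_eps_eq _ _ r rb eps k j (Num.min (eps / 2) 1)) => //.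
  - by rewrite eq_sym.
  - by rewrite lt_min ltr01 divr_gt0 //= ge_min lexx orbT.
  - move=> l lk; have [+ _] := w_sol l; rewrite w0_0 mul0r add0r (bigD1 k) //= wk mul1r.
    rewrite big1 ?addr0 => [h|i' /wj0 ->]; last by rewrite mul0r.
    apply: le_trans h.
    have m1 : Num.min (eps / 2) 1 <= eps / 2 by rewrite ge_min lexx.
    have m0 : 0 <= Num.min (eps / 2) 1 by rewrite le_min ler01 andbT ltW // divr_gt0.
    have := r_norm rb [set k; l]%SET l; rewrite ler_norml => /andP[_ ?]; nra.
(* If [i'] is in the support and drops out after level [l], then
   [w0 * q i' + \sum_j w j * A i' j = 0] has only nonnegative terms. So [w0 = 0] and nobody else has
   mass, which is the excluded single quitter. *)
have supp l i' : w i' != 0 -> i' \in Ilev r l.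
  elim: l i' => [|l IH] i' wi; first by rewrite inE.
  apply/negPn/negP => il.
  have iJ : i' \notin Istar r by apply/negP => /in_Istar /(_ l.+1); apply/negP.
  have Apos j : j \in Ilev r l -> j != i' -> 0 < A i' j.
    move=> jl ji; rewrite ltNge; apply/negP => h; move/negP: il; apply.
    by rewrite /= inE IH //=; apply/exists_inP; exists j => //; rewrite ji.
  have [_ [/eqP|]] := w_sol i'; first by rewrite (negbTE wi).
  rewrite (q1 _ iJ) mulr1 (bigD1 i') //= A0 mulr0 add0r => E.
  have T0 j : j != i' -> 0 <= w j * A i' j.
    move=> ji; have [->|wj] := eqVneq (w j) 0; first by rewrite mul0r.
    by rewrite mulr_ge0 // ltW // Apos // IH.
  have S0 : 0 <= \sum_(j | j != i') w j * A i' j by apply: sumr_ge0.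
  have w0_0 : w0 = 0 by lra.
  have : \sum_(j | j != i') w j * A i' j = 0 by lra.
  move/eqP; rewrite psumr_eq0 // => /allP hw0.
  apply: nosingle; exists i'; move: wsum; rewrite w0_0 add0r (bigD1 i') //= big1 ?addr0 // => j ji.
  have := hw0 j (mem_index_enum _); rewrite ji /= mulf_eq0 => /orP[/eqP //|].
  have [//|wj] := eqVneq (w j) 0.
  by rewrite gt_eqF // Apos // IH.
have [l hl] := Istar_stable r.
have wJ j : j \notin Istar r -> w j = 0.
  by rewrite hl => jl; apply/eqP/negPn/negP => /(supp l); apply/negP.
exfalso.
have [w0_0|w0_n0] := eqVneq w0 0.
  have wz : forall j, w j = 0.
    apply: HR0; split => // j _; have := w_sol j; by rewrite w0_0 mul0r.
  by move: wsum; rewrite w0_0 big1 // addr0 => /eqP; rewrite eq_sym oner_eq0.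
have w0_gt0 : 0 < w0 by rewrite lt_neqAle eq_sym w0_n0.
apply: (HQ (fun j => w0^-1 * w j)).
have -> : q = (fun j => w0^-1 * (w0 * q j)).
  by apply: funext => j; rewrite mulrA mulVf // mul1r.
by apply: lcp_scale; [rewrite invr_gt0|split].
Qed.

End NotQ.

(** * Long chains of complementarity steps *)

Section Viability.
Variables (R : realType) (N : nat).
Local Notation I := 'I_N.
Variable A : I -> I -> R.
Hypothesis A1 : forall i j, `|A i j| <= 1.

Definition amul (z : I -> R) i : R := \sum_j z j * A i j.

Lemma amulD z z' i : amul (fun j => z j + z' j) i = amul z i + amul z' i.
Proof. by rewrite /amul -big_split; apply: eq_bigr => j _; rewrite mulrDl. Qed.

Lemma amulZ s z i : amul (fun j => s * z j) i = s * amul z i.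
Proof. by rewrite /amul mulr_sumr; apply: eq_bigr => j _; rewrite mulrA. Qed.

Lemma amul0 i : amul (fun=> 0) i = 0.
Proof. by rewrite /amul big1 // => j _; rewrite mul0r. Qed.

Lemma amul_norm z i : (forall j, 0 <= z j) -> `|amul z i| <= \sum_j z j.
Proof.
move=> z0; apply: le_trans (ler_norm_sum _ _ _) _; apply: ler_sum => j _.
by rewrite normrM ger0_norm // ler_piMr.
Qed.

Lemma amul_close z z' d i : (forall j, `|z j - z' j| < d) -> `|amul z i - amul z' i| <= N%:R * d.
Proof.
move=> zd; rewrite /amul -sumrB; apply: le_trans (ler_norm_sum _ _ _) _.
apply: (@le_trans _ _ (\sum_(j : I) d)); last by rewrite sumr_const card_ord mulr_natl.
apply: ler_sum => j _; rewrite -mulrBl normrM; have := zd j; have := A1 i j.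
have := normr_ge0 (z j - z' j); have := normr_ge0 (A i j); nra.
Qed.

(** Every exact step with [z] nonzero ends in this set, since a quitter has value 0. *)
Definition bdry (J : {set I}) (W : I -> R) :=
  (forall i, i \in J -> 0 <= W i) /\ exists2 i, i \in J & W i = 0.

(* Finite chains of complementarity steps W -> W' = W + A z + error from W0, keeping track
   of the total quitting vector Z and of the total error e; read backwards in time, z i
   is the mass quitted by i, whose payoff W' i is 0 whenever z i > 0. *)
Inductive reach (J : {set I}) (W0 : I -> R) : (I -> R) -> (I -> R) -> R -> Prop :=
| reach0 : reach J W0 W0 (fun=> 0) 0
| reachS W Z e z W' Z' e' of reach J W0 W Z e & forall i, 0 <= z i &
    forall i, i \notin J -> z i = 0 & forall i, i \in J -> z i = 0 \/ W' i = 0 &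
    bdry J W' & (forall i, Z' i = Z i + z i) &
    e' = e + \sum_(i in J) `|W' i - (W i + amul z i)| : reach J W0 W' Z' e'.

Section Reach.
Variable J : {set I}.

Lemma reach_ge0 W0 W Z e : reach J W0 W Z e ->
  [/\ 0 <= e, forall i, 0 <= Z i & forall i, i \notin J -> Z i = 0].
Proof.
elim=> {W Z e} [|W Z e z W' Z' e' _ [e0 Z0 ZJ] z0 zJ _ _ ZE ->]; first by split.
split=> [|i|i iJ]; first by rewrite addr_ge0 // sumr_ge0.
  by rewrite ZE addr_ge0.
by rewrite ZE ZJ // zJ // addr0.
Qed.

Lemma reach_bdry W0 W Z e : bdry J W0 -> reach J W0 W Z e -> bdry J W.
Proof. by move=> W0b; case. Qed.

Lemma reach_balance W0 W Z e i : reach J W0 W Z e -> i \in J ->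
  `|W i - (W0 i + amul Z i)| <= e.
Proof.
move=> + iJ; elim=> {W Z e} [|W Z e z W' Z' e' _ IH z0 zJ _ _ ZE ->].
  by rewrite amul0 addr0 subrr normr0.
have -> : amul Z' i = amul Z i + amul z i.
  by rewrite -amulD; congr amul; apply: funext.
have -> : W' i - (W0 i + (amul Z i + amul z i)) =
  (W i - (W0 i + amul Z i)) + (W' i - (W i + amul z i)) by ring.
apply: le_trans (ler_normD _ _) _; apply: lerD => //.
by rewrite (bigD1 i) //= lerDl sumr_ge0.
Qed.

Lemma reach_cat W0 W1 Z1 e1 W2 Z2 e2 : reach J W0 W1 Z1 e1 -> reach J W1 W2 Z2 e2 ->
  reach J W0 W2 (fun i => Z1 i + Z2 i) (e1 + e2).
Proof.
move=> r1; elim=> {W2 Z2 e2} [|W Z e z W' Z' e' _ IH z0 zJ zc Wb ZE ->].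
  by rewrite addr0; have -> : (fun i => Z1 i + 0) = Z1 by apply: funext => i; rewrite addr0.
by apply: (reachS IH z0 zJ zc Wb) => [i|]; rewrite ?ZE addrA.
Qed.

(** A step without quitting, its whole displacement counted as error; it joins chains whose ends are
    merely close. *)
Lemma reach_jump W0 V : bdry J V -> reach J W0 V (fun=> 0) (\sum_(i in J) `|V i - W0 i|).
Proof.
move=> Vb; apply: (reachS (reach0 J W0) (z := fun=> 0)) => // [i _|i|]; first by left.
  by rewrite addr0.
by rewrite add0r; apply: eq_bigr => i _; rewrite amul0 addr0.
Qed.

Definition unb W := forall L d, 0 < d -> exists W' Z e,
  [/\ reach J W W' Z e, e < d & L <= \sum_i Z i].

(** Limits of total quitting vectors along chains of vanishing error. End points need no record: by
    [reach_balance] they tend to [W + A Z] on [J]. *)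
Definition rch W Z := [/\ forall i, 0 <= Z i, forall i, i \notin J -> Z i = 0 &
  forall d, 0 < d -> exists W' Z' e, [/\ reach J W W' Z' e, e < d & forall i, `|Z' i - Z i| < d]].

Lemma lcp_rch W z : lcp A J W z -> rch W z.
Proof.
move=> [z0 zJ zW]; split=> // d d0.
have [[i zi]|zn] := pselect (exists i, z i != 0).
  exists (fun i => W i + amul z i), z, 0; split=> // [|j]; last by rewrite subrr normr0.
  have iJ : i \in J by apply: contraNT zi => /zJ ->.
  apply: (reachS (reach0 J W) z0 zJ) => [j /zW[]//||j|]; last 2 first.
  - by rewrite add0r.
  - by rewrite add0r big1 // => j _; rewrite subrr normr0.
  split=> [j /zW[]//|]; exists i => //.
  by have [_ [z0i|]] := zW i iJ; first by rewrite z0i eqxx in zi.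
exists W, (fun=> 0), 0; split=> // [|i]; first exact: reach0.
have -> : z i = 0 by apply: contrapT => zi; apply: zn; exists i; apply/eqP.
by rewrite subrr normr0.
Qed.

Lemma rch_bdry W Z : bdry J W -> rch W Z -> bdry J (fun i => W i + amul Z i).
Proof.
move=> Wb [Z0 ZJ Zd].
have close d : 0 < d -> exists W', bdry J W' /\
    forall i, i \in J -> `|W' i - (W i + amul Z i)| <= N.+1%:R * d.
  move=> d0; have [W' [Z' [e [rW ed Zc]]]] := Zd d d0; exists W'.
  split; first exact: reach_bdry rW.
  move=> i iJ; have := reach_balance rW iJ; have := amul_close i Zc.
  set a := amul Z' i; set b := amul Z i => h1 h2.
  have -> : W' i - (W i + b) = (W' i - (W i + a)) + (a - b) by ring.
  apply: le_trans (ler_normD _ _) _; rewrite -natr1; lra.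
split=> [i iJ|].
  rewrite leNgt; apply/negP => h.
  have d0 : 0 < - (W i + amul Z i) / (2 * N.+1%:R) by rewrite divr_gt0 ?mulr_gt0 // ?oppr_gt0.
  have [W' [[W'0 _] /(_ i iJ)]] := close _ d0.
  rewrite invfM [_ * (2^-1 * _)]mulrA mulrC divfK // ler_norml => /andP[_].
  by have := W'0 i iJ; lra.
apply: contrapT => H.
have [t t0 ht] : exists2 t, 0 < t & forall i, i \in J ->
    t * 1 <= `|W i + amul Z i|.
  apply: exists_small => i iJ; rewrite normr_gt0; apply/eqP => h.
  by apply: H; exists i.
have d0 : 0 < t / (2 * N.+1%:R) by rewrite divr_gt0 ?mulr_gt0.
have [W' [[_ [i iJ Wi]] /(_ i iJ)]] := close _ d0.
rewrite invfM [_ * (2^-1 * _)]mulrA mulrC divfK // Wi sub0r normrN.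
by have := ht i iJ; lra.
Qed.

Lemma rch_trans W Z1 Z2 : bdry J W -> rch W Z1 -> rch (fun i => W i + amul Z1 i) Z2 ->
  rch W (fun i => Z1 i + Z2 i).
Proof.
move=> Wb r1 [Z20 Z2J Z2d]; have Vb := rch_bdry Wb r1.
case: r1 => Z10 Z1J Z1d; split=> [i|i iJ|d d0]; first by rewrite addr_ge0.
  by rewrite Z1J // Z2J // addr0.
(* The gap between the two chains costs at most [N * (N + 1) * d'], and the chains themselves less
   than [2 * d']. *)
pose c : R := N%:R * N.+1%:R + 3.
have c0 : 0 < c by rewrite /c ltr_wpDl // mulr_ge0.
pose d' := d / c.
have d'0 : 0 < d' by rewrite divr_gt0.
have dE : d = c * d' by rewrite /d' mulrC divfK // gt_eqF.
have [W1 [Z1' [e1 [R1 e1d Z1c]]]] := Z1d _ d'0.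
have [W2 [Z2' [e2 [R2 e2d Z2c]]]] := Z2d _ d'0.
exists W2, (fun i => Z1' i + (0 + Z2' i)), (e1 + (\sum_(i in J) `|(W i + amul Z1 i) - W1 i| + e2)).
split.
- by apply: (reach_cat R1); apply: (reach_cat (reach_jump W1 Vb)).
- have : \sum_(i in J) `|(W i + amul Z1 i) - W1 i| <= N%:R * (N.+1%:R * d').
    apply: (@le_trans _ _ (\sum_(i : I) (N.+1%:R * d'))); last first.
      by rewrite sumr_const card_ord [leRHS]mulr_natl.
    rewrite big_mkcond; apply: ler_sum => i _; case: ifP => iJ; last by rewrite mulr_ge0 // ltW.
    rewrite distrC; have := reach_balance R1 iJ; have := amul_close i Z1c.
    set a := amul Z1' i; set b := amul Z1 i => h1 h2.
    have -> : W1 i - (W i + b) = (W1 i - (W i + a)) + (a - b) by ring.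
    apply: le_trans (ler_normD _ _) _; rewrite -natr1; lra.
  rewrite dE /c; lra.
- move=> i; have -> : Z1' i + (0 + Z2' i) - (Z1 i + Z2 i) = (Z1' i - Z1 i) + (Z2' i - Z2 i) by ring.
  apply: le_lt_trans (ler_normD _ _) _; have := Z1c i; have := Z2c i.
  rewrite dE /c; have : 0 <= (N%:R * N.+1%:R + 1) * d' by rewrite mulr_ge0 ?(ltW d'0) // addr_ge0 ?mulr_ge0.
  lra.
Qed.

Lemma cvg_close (U : set_system nat) (Zm : nat -> I -> R) Z d : UltraFilter U -> 0 < d ->
  (forall i, Zm m i @[m --> U] --> Z i) -> U [set m | forall i, `|Zm m i - Z i| < d].
Proof.
move=> UU d0 Zl; apply: filter_forall => i.
by have /cvgrPdist_lt/(_ _ d0) := Zl i; apply: filterS => m; rewrite distrC.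
Qed.

Lemma rch_closed (U : set_system nat) (Zm : nat -> I -> R) Z W : UltraFilter U ->
  (forall i, Zm m i @[m --> U] --> Z i) ->
  (forall m, rch W (Zm m)) -> rch W Z.
Proof.
move=> UU Zl Zr; have UP : ProperFilter U := @ultra_proper _ _ UU; split.
- move=> i; apply: (cvgr_to_ge (Zl i)); apply: nearW => m.
  by case: (Zr m).
- move=> i iJ; apply: (cvg_eq_cst UP (Zl i)); apply: nearW => m.
  by case: (Zr m) => _ /(_ i iJ).
move=> d d0; have d20 : 0 < d / 2 by rewrite divr_gt0.
have [m /= Zc] := filter_ex (cvg_close UU d20 Zl).
have [_ _ /(_ _ d20)[W' [Z' [e [rW ed Z'c]]]]] := Zr m.
exists W', Z', e; split=> // [|i]; first by lra.
have -> : Z' i - Z i = (Z' i - Zm m i) + (Zm m i - Z i) by ring.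
apply: le_lt_trans (ler_normD _ _) _; have := Zc i; have := Z'c i; lra.
Qed.

Definition terminal V := bdry J V /\ forall Z, rch V Z -> forall i, Z i = 0.

(** Take [Z] of maximal mass: the masses are bounded since [W] is not [unb], the supremum is
    attained by [rch_closed], and by [rch_trans] a further nonzero step would exceed it. *)
Lemma exists_terminal W : bdry J W -> ~ unb W ->
  exists2 Z, rch W Z & terminal (fun i => W i + amul Z i).
Proof.
move=> Wb /existsNP[L /existsNP[d0 /not_implyP[d00 H]]].
pose L' := L + N%:R.
have bnd Z : rch W Z -> \sum_i Z i <= L'.
  move=> [Z0 ZJ Zd]; have d1 : 0 < Num.min d0 1 by rewrite lt_min d00 ltr01.
  have [W' [Z' [e [rW ed Zc]]]] := Zd _ d1.
  have : \sum_i Z' i < L.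
    rewrite ltNge; apply/negP => h; apply: H; exists W', Z', e; split=> //.
    by apply: (lt_le_trans ed); rewrite ge_min lexx.
  have : \sum_i Z i <= \sum_i (Z' i + 1).
    apply: ler_sum => i _; have := Zc i; rewrite ltr_norml => /andP[+ _].
    have : Num.min d0 1 <= 1 by rewrite ge_min lexx orbT.
    lra.
  by rewrite big_split /= sumr_const card_ord /L'; lra.
pose S := [set s | exists2 Z, rch W Z & s = \sum_i Z i].
have S0 : S !=set0.
  exists (\sum_(i : I) 0); exists (fun=> 0) => //; split=> // d dd.
  exists W, (fun=> 0), 0; split=> // [|i]; first exact: reach0.
  by rewrite subrr normr0.
have Sb : has_ubound S by exists L' => _ [Z /bnd ? ->].
have Ss : has_sup S by [].
have /choice[Zm hZm] m : exists Z, rch W Z /\ sup S - m.+1%:R^-1 < \sum_i Z i.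
  have m0 : 0 < m.+1%:R^-1 :> R by rewrite invr_gt0.
  by have [_ [Z rZ ->] h] := sup_adherent m0 Ss; exists Z.
have [U [UU sU]] := nat_ultra; have UP : ProperFilter U := @ultra_proper _ _ UU.
have Zmb m i : 0 <= Zm m i <= L'.
  have [rZ _] := hZm m; have := bnd _ rZ; case: rZ => Z0 _ _.
  rewrite (bigD1 i) //= Z0 => h; apply: le_trans h; rewrite lerDl; exact: sumr_ge0.
have /choice[Z hZ] i : exists l : R, Zm m i @[m --> U] --> l.
  by have [l ? _] := ultra_cvg UU (Zmb ^~ i); exists l.
have rZ : rch W Z by apply: (rch_closed UU hZ) => m; case: (hZm m).
exists Z => //; split; first exact: rch_bdry.
move=> Z' rZ'; have rT := rch_trans Wb rZ rZ'.
have sZ : sup S <= \sum_i Z i.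
  have l1 : \sum_i Zm m i + m.+1%:R^-1 @[m --> U] --> \sum_i Z i + 0.
    apply: cvgD; first exact: cvg_sumU.
    by apply: cvg_coarse sU _; exact: cvg_harmonic.
  rewrite -[leRHS]addr0; apply: (cvgr_to_ge l1); apply: nearW => m.
  by case: (hZm m) => _ h; rewrite -lerBlDr ltW.
have : \sum_i (Z i + Z' i) <= sup S by apply: sup_upper_bound => //; exists (fun i => Z i + Z' i).
rewrite big_split /= => h.
have Z'0 : forall i, 0 <= Z' i by case: rZ'.
move=> i; apply/eqP; rewrite eq_le Z'0 andbT.
have : \sum_i Z' i <= 0 by lra.
rewrite (bigD1 i) //=; have : 0 <= \sum_(j | j != i) Z' j by apply: sumr_ge0.
lra.
Qed.

Lemma lcp_closed (U : set_system nat) (qm zm : nat -> I -> R) q z : UltraFilter U ->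
  (forall i, qm m i @[m --> U] --> q i) -> (forall i, zm m i @[m --> U] --> z i) ->
  (forall m, lcp A J (qm m) (zm m)) -> lcp A J q z.
Proof.
move=> UU ql zl h; have UP : ProperFilter U := @ultra_proper _ _ UU.
have al i : qm m i + amul (zm m) i @[m --> U] --> q i + amul z i.
  by apply: cvgD => //; apply: cvg_sumU => j _; apply: cvgM => //; exact: cvg_cst.
split.
- move=> i; apply: (cvgr_to_ge (zl i)); apply: nearW => m.
  by case: (h m).
- move=> i iJ; apply: (cvg_eq_cst UP (zl i)); apply: nearW => m.
  by case: (h m) => _ /(_ i iJ).
move=> i iJ; split.
  apply: (cvgr_to_ge (al i)); apply: nearW => m.
  by case: (h m) => _ _ /(_ i iJ)[].
have [m|U0|U0] := @ultra_split U (fun m => zm m i = 0) (fun m => qm m i + amul (zm m) i = 0) UU.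
- by case: (h m) => _ _ /(_ i iJ)[].
- by left; exact: (cvg_eq_cst UP (zl i) U0).
- by right; exact: (cvg_eq_cst UP (al i) U0).
Qed.

End Reach.

Section Terminal.
Variables (J : {set I}) (V : I -> R).
Hypothesis Vt : terminal J V.
Let K : {set I} := [set i in J | V i == 0]%SET.

Let KV i : i \in J -> i \notin K -> 0 < V i.
Proof.
move=> iJ; rewrite inE iJ /= => Vi; rewrite lt_neqAle eq_sym Vi.
by case: Vt => -[+ _] _; exact.
Qed.

(** A homogeneous solution on [K], scaled down so that the positive coordinates of [V] stay
    nonnegative, is a step from [V], hence 0. *)
Lemma terminal_R0 : R0_on A K.
Proof.
move=> z [z0 zK zc].
have [t t0 ht] : exists2 t, 0 < t & forall i, (i \in J) && (i \notin K) -> t * `|amul z i| <= V i.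
  by apply: exists_small => i /andP[]; exact: KV.
have : rch J V (fun i => t * z i).
  apply: lcp_rch; split=> [i|i iJ|i iJ].
  - by rewrite mulr_ge0 // ltW.
  - by rewrite zK ?mulr0 // inE (negbTE iJ).
  - rewrite -/(amul _ i) amulZ; have [iK|iK] := boolP (i \in K).
      have [+ +] := zc _ iK; rewrite !add0r -/(amul z i).
      move: iK; rewrite inE iJ => /eqP ->; rewrite add0r => h0 h.
      split; first by rewrite mulr_ge0 // ltW.
      by case: h => ->; rewrite mulr0; [left|right].
    rewrite zK // mulr0; split; last by left.
    have := ht i; rewrite iJ iK => /(_ isT) h.
    have : - (t * `|amul z i|) <= t * amul z i.
      by rewrite -mulrN ler_wpM2l ?(ltW t0) // lerNl -normrN ler_norm.
    lra.
case: Vt => _ /[apply] h i; have /eqP := h i; rewrite mulf_eq0 (gt_eqF t0) /=.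
by move/eqP.
Qed.

(** Solve on [J] with data [V + d u], where [d] tends to 0. By R0 on [J] the normalised solutions
    keep a positive weight on [V], so their limit is a step from [V], hence 0. The coordinates
    outside [K] then stay positive, their players do not quit, and division by [d] gives a solution
    for [u] on [K]. *)
Lemma terminal_Q : R0_on A J -> Q_on A J -> Q_on A K.
Proof.
move=> HR HQ u; pose d m : R := m.+1%:R^-1.
have d0 m : 0 < d m by rewrite invr_gt0.
pose q m i := V i + d m * (if i \in K then u i else 0).
have /choice[z hz] m : exists z, lcp A J (q m) z by exact: HQ.
pose s m := \sum_i z m i.
have s0 m : 0 <= s m by apply: sumr_ge0 => i _; case: (hz m).
pose t m := (1 + s m)^-1.
have t0 m : 0 < t m by rewrite invr_gt0 ltr_pwDl.
have t01 m : 0 <= t m <= 1 by rewrite ltW //= invf_le1 ?ltr_pwDl // lerDl.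
pose y m i := t m * z m i.
have yl m : lcp A J (fun i => t m * q m i) (y m) by exact: lcp_scale.
have ysum m : t m + \sum_i y m i = 1.
  by rewrite /y -mulr_sumr -{1}[t m]mulr1 -mulrDr mulVf // gt_eqF // ltr_pwDl.
have y01 i m : 0 <= y m i <= 1.
  have y0 j : 0 <= y m j by case: (yl m).
  rewrite y0 /=; have := ysum m; rewrite (bigD1 i) //=.
  have : 0 <= \sum_(j | j != i) y m j by apply: sumr_ge0.
  by have /andP[] := t01 m; lra.
have [U [UU sU]] := nat_ultra; have UP : ProperFilter U := @ultra_proper _ _ UU.
have [tl tlc /andP[tl0 _]] := ultra_cvg UU t01.
have /choice[yl' hyl] i : exists l : R, y m i @[m --> U] --> l.
  by have [l ? _] := ultra_cvg UU (y01 i); exists l.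
have dl : d m @[m --> U] --> (0 : R) by apply: cvg_coarse sU _; exact: cvg_harmonic.
have ql i : t m * q m i @[m --> U] --> tl * V i.
  rewrite -[V i]addr0 -(mul0r (if i \in K then u i else 0)).
  apply: cvgM => //; apply: cvgD; first exact: cvg_cst.
  by apply: cvgM => //; exact: cvg_cst.
have lim : lcp A J (fun i => tl * V i) yl' by exact: (lcp_closed UU ql hyl).
have ylsum : tl + \sum_i yl' i = 1.
  have cl : t m + \sum_i y m i @[m --> U] --> tl + \sum_i yl' i.
    by apply: cvgD => //; apply: cvg_sumU.
  by apply: (cvg_eq_cst UP cl); apply: nearW => m; exact: ysum.
have tln0 : tl != 0.
  apply/eqP => tl_0; have yl0 i : yl' i = 0.
    apply: HR; case: lim => ? ? h; split => // j jJ.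
    by have := h j jJ; rewrite tl_0 mul0r.
  by move: ylsum; rewrite tl_0 big1 // addr0 => /eqP; rewrite eq_sym oner_eq0.
have tlp : 0 < tl by rewrite lt_neqAle eq_sym tln0.
have yl0 i : yl' i = 0.
  have : rch J V (fun i => tl^-1 * yl' i).
    apply: lcp_rch; have -> : V = (fun i => tl^-1 * (tl * V i)).
      by apply: funext => j; rewrite mulrA mulVf // mul1r.
    by apply: lcp_scale; rewrite ?invr_gt0.
  case: Vt => _ /[apply] /(_ i) /eqP; rewrite mulf_eq0 invr_eq0 (negbTE tln0) /=.
  by move/eqP.
have UJ : U [set m | forall i, (i \in J) && (i \notin K) -> z m i = 0].
  apply: filter_forall => i; have [/andP[iJ iK]|_] := boolP ((i \in J) && (i \notin K)); last first.
    by apply: nearW.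
  have al : t m * q m i + amul (y m) i @[m --> U] --> tl * V i + amul yl' i.
    by apply: cvgD => //; apply: cvg_sumU => j _; apply: cvgM => //; exact: cvg_cst.
  have Vp : 0 < tl * V i + amul yl' i.
    have -> : yl' = (fun=> 0) by apply: funext.
    by rewrite amul0 addr0 mulr_gt0 // KV.
  have hgt : U [set m | 0 < t m * q m i + amul (y m) i] by exact: (cvgr_gt _ al).
  apply: (@filterS _ U _ _ _ _ hgt) => m /= h _.
  have [_ _ /(_ i iJ)[_ [/eqP|h0]]] := yl m.
    by rewrite mulf_eq0 (gt_eqF (t0 m)) /= => /eqP.
  by rewrite /amul h0 ltxx in h.
have [m /= zJK] := filter_ex UJ.
exists (fun i => (d m)^-1 * z m i).
have dn : d m != 0 by rewrite gt_eqF.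
have -> : u = (fun i => (d m)^-1 * (d m * u i)).
  by apply: funext => i; rewrite mulrA mulVf // mul1r.
apply: lcp_scale; first by rewrite invr_gt0.
have [z0 zJ zc] := hz m; split=> // [i iK|i iK].
  have [iJ|/zJ //] := boolP (i \in J); by apply: zJK; rewrite iJ.
have iJ : i \in J by move: iK; rewrite inE => /andP[].
have := zc i iJ; rewrite /q iK; have -> : V i = 0 by move: iK; rewrite inE => /andP[_ /eqP].
by rewrite add0r.
Qed.

(** [V] vanishes on [K], so the chain scaled by [s] starts close to [V], with an initial jump of
    [s * \sum_(i in K) |X i|]. Outside [K] nobody quits, and a mass of at most [c] cannot push those
    values below 0. *)
Lemma reach_lift X W Z e c s : 0 < s -> bdry K X ->
  (forall i, i \in J -> i \notin K -> c <= V i) ->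
  reach K X W Z e -> s * \sum_i Z i <= c ->
  reach J V (fun i => if i \in K then s * W i else V i + s * amul Z i) (fun i => s * Z i)
    (s * (e + \sum_(i in K) `|X i|)).
Proof.
move=> s0 Xb cV.
have KJ i : i \in K -> i \in J by rewrite inE => /andP[].
have V0 i : i \in K -> V i = 0 by rewrite inE => /andP[_ /eqP].
have bd Y Z' : bdry K Y -> (forall i, 0 <= Z' i) -> s * \sum_i Z' i <= c ->
    bdry J (fun i => if i \in K then s * Y i else V i + s * amul Z' i).
  move=> [Y0 [k kK Yk]] Z'0 Zc; split; last by exists k; rewrite ?KJ ?kK ?Yk ?mulr0.
  move=> i iJ; case: ifP => iK; first by rewrite mulr_ge0 ?(ltW s0) // Y0.
  have := cV i iJ (negbT iK); have := amul_norm i Z'0; rewrite ler_norml => /andP[+ _].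
  by rewrite -(ler_pM2l s0); lra.
have sumK (F : I -> R) : (forall i, i \in J -> i \notin K -> F i = 0) ->
    \sum_(i in J) F i = \sum_(i in K) F i.
  move=> F0; rewrite (bigID (mem K)) /= [X in _ + X]big1 ?addr0; last by move=> i /andP[]; exact: F0.
  apply: eq_bigl => i; case: (boolP (i \in K)) => [/KJ ->|]; by rewrite ?andbF.
elim=> {W Z e} [|W Z e z W' Z' e' rW IH z0 zK zc Wb ZE ->] Zc.
  have := reach_jump V (bd X (fun=> 0) Xb (fun=> lexx _) Zc).
  have -> : (fun i : I => s * 0) = (fun=> 0) :> (I -> R) by apply: funext => i; rewrite mulr0.
  have -> // : \sum_(i in J) `|(if i \in K then s * X i else V i + s * amul (fun=> 0) i) - V i| =
    s * (0 + \sum_(i in K) `|X i|).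
  rewrite add0r sumK => [|i _ /negbTE ->]; last by rewrite amul0 mulr0 addr0 subrr normr0.
  rewrite mulr_sumr; apply: eq_bigr => i iK; rewrite iK V0 // subr0 normrM gtr0_norm //.
have [_ Z0 _] := reach_ge0 rW.
have Z'0 i : 0 <= Z' i by rewrite ZE addr_ge0.
have Zc' : s * \sum_i Z i <= c.
  apply: le_trans Zc; rewrite ler_pM2l //; apply: ler_sum => i _.
  by rewrite ZE lerDl.
apply: (reachS (IH Zc') (z := fun i => s * z i)).
- by move=> i; rewrite mulr_ge0 // ltW.
- by move=> i iJ; rewrite zK ?mulr0 //; apply: contra iJ => /KJ.
- move=> i iJ; case: ifP => iK; last by left; rewrite zK ?mulr0 ?iK.
  by case: (zc i iK) => ->; rewrite mulr0; [left|right].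
- exact: bd.
- by move=> i; rewrite ZE mulrDr.
rewrite sumK => [|i iJ /negbTE iK].
  rewrite -addrA [_ + \sum_(i in K) `|X i|]addrC addrA mulrDr; congr (_ + _).
  rewrite mulr_sumr; apply: eq_bigr => i iK; rewrite iK amulZ -mulrDr -mulrBr normrM gtr0_norm //.
rewrite iK amulZ; have -> : Z' = (fun i => Z i + z i) by apply: funext.
by rewrite amulD mulrDr addrA subrr normr0.
Qed.

(** A chain of mass [S] scaled by [c / S] has mass [c], while its error tends to 0 as [S] grows. The
    limit is a nonzero vector reachable from [V]. *)
Lemma terminal_not_unb X : (exists2 i, i \in J & i \notin K) -> bdry K X ->
  (forall L d, 0 < d -> exists W' Z e,
    [/\ reach K X W' Z e, e < d & L <= \sum_i Z i]) -> False.
Proof.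
move=> [k kJ kK] Xb Xu.
have [c c0 cV] : exists2 t, 0 < t & forall i, (i \in J) && (i \notin K) -> t * 1 <= V i.
  by apply: exists_small => i /andP[]; exact: KV.
have {}cV i : i \in J -> i \notin K -> c <= V i.
  by move=> iJ iK; rewrite -[c]mulr1; apply: cV; rewrite iJ.
have /choice[p hp] m : exists p : (I -> R) * (I -> R) * R,
    [/\ reach K X p.1.1 p.1.2 p.2, p.2 < 1 & m.+1%:R <= \sum_i p.1.2 i].
  by have [W' [Z [e h]]] := Xu m.+1%:R 1 ltr01; exists (W', Z, e).
pose S m := \sum_i (p m).1.2 i.
have S0 m : 0 < S m by case: (hp m) => _ _; apply: lt_le_trans.
pose s m := c / S m.
have s0 m : 0 < s m by rewrite divr_gt0.
have sS m : s m * S m = c by rewrite /s divfK // gt_eqF.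
pose y m i := s m * (p m).1.2 i.
have y0 m i : 0 <= y m i.
  by case: (hp m) => /reach_ge0[_ ? _] _ _; rewrite mulr_ge0 // ltW.
have ysum m : \sum_i y m i = c by rewrite -mulr_sumr.
have y01 i m : 0 <= y m i <= c.
  rewrite y0 -(ysum m) (bigD1 i) //= lerDl; exact: sumr_ge0.
have [U [UU sU]] := nat_ultra; have UP : ProperFilter U := @ultra_proper _ _ UU.
have /choice[Y hY] i : exists l : R, y m i @[m --> U] --> l.
  by have [l ? _] := ultra_cvg UU (y01 i); exists l.
have rY : rch J V Y.
  split=> [i|i iJ|d d0].
  - by apply: (cvgr_to_ge (hY i)); apply: nearW => m.
  - apply: (cvg_eq_cst UP (hY i)); apply: nearW => m /=.
    case: (hp m) => /reach_ge0[_ _ zK] _ _; rewrite /y zK ?mulr0 //.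
    by apply: contra iJ; rewrite inE => /andP[].
  have er0 : (c * (1 + \sum_(i in K) `|X i|)) * m.+1%:R^-1 @[m --> U] --> (0 : R).
    rewrite -[X in _ --> X](mulr0 (c * (1 + \sum_(i in K) `|X i|))); apply: cvgMr.
    by apply: cvg_coarse sU _; exact: cvg_harmonic.
  have Ue : U [set m | (c * (1 + \sum_(i in K) `|X i|)) * m.+1%:R^-1 < d] by exact: (cvgr_lt _ er0).
  have [m /= [em Ym]] := filter_ex (filterI Ue (cvg_close UU d0 hY)).
  have [rW e1 Sm] := hp m.
  have sc : s m * S m <= c by rewrite sS.
  have h := reach_lift (s0 m) Xb cV rW sc.
  set W' := (fun _ => _) in h; exists W', (y m), (s m * ((p m).2 + \sum_(i in K) `|X i|)).
  split=> //; apply: le_lt_trans em.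
  have X0 : 0 <= \sum_(i in K) `|X i| by apply: sumr_ge0.
  have sm : s m <= c * m.+1%:R^-1.
    by rewrite /s ler_wpM2l ?(ltW c0) // lef_pV2 ?posrE.
  have e0 : 0 <= (p m).2 by case: (reach_ge0 rW).
  rewrite [leRHS]mulrAC; apply: ler_pM => //; first by rewrite ltW.
    by rewrite addr_ge0.
  by rewrite lerD2r ltW.
case: Vt => _ /(_ Y rY) Y0.
have cY : \sum_i y m i @[m --> U] --> \sum_i Y i by exact: cvg_sumU.
have : \sum_i Y i = c by apply: (cvg_eq_cst UP cY); apply: nearW => m; exact: ysum.
by rewrite big1 // => c00; rewrite c00 ltxx in c0.
Qed.

End Terminal.

Theorem viable (J : {set I}) : J != finset.set0 -> (forall i, i \in J -> A i i = 0) ->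
  R0_on A J -> Q_on A J -> exists2 X, bdry J X & unb J X.
Proof.
have [n] := ubnP #|J|; elim: n J => // n IH J; rewrite ltnS => Jn J0 Ad HR HQ.
apply: contrapT => H.
have toz W : bdry J W -> exists2 Z, rch J W Z & forall i, i \in J -> W i + amul Z i = 0.
  move=> Wb; have [uW|Z rZ tV] := exists_terminal Wb; first by apply: H; exists W.
  exists Z => // i iJ; set V := (fun i => _) in tV.
  pose K : {set I} := [set i in J | V i == 0]%SET.
  have [//|Vi] := eqVneq (V i) 0; exfalso.
  have iK : i \notin K by rewrite inE (negbTE Vi) andbF.
  have KJ : K \subset J by apply/fintype.subsetP => k; rewrite inE => /andP[].
  have Kn : (#|K| < n)%N.
    apply: leq_trans Jn; apply: proper_card; apply/properP; split=> //.
    by exists i.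
  have K0 : K != finset.set0.
    by case: tV => -[_ [k kJ Vk]] _; apply/finset.set0Pn; exists k; rewrite inE kJ Vk eqxx.
  have KAd k : k \in K -> A k k = 0 by move/(fintype.subsetP KJ)/Ad.
  have [X Xb Xu] := IH K Kn K0 KAd (terminal_R0 tV) (terminal_Q tV HR HQ).
  by apply: (terminal_not_unb tV _ Xb) => //; exists i.
have [i0 i0J] := finset.set0Pn _ J0.
pose d : I -> R := fun i => (i == i0)%:R.
have d0 i : 0 <= d i by rewrite ler0n.
have dA i : amul d i = A i i0.
  rewrite /amul (bigD1 i0) //= /d eqxx mul1r big1 ?addr0 // => j /negbTE ->.
  by rewrite mul0r.
(* A second player puts [d] on the boundary. If [i0] were alone, [A i0 i0 = 0] would make [d] a
   homogeneous solution. *)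
have [j jJ ji] : exists2 j, j \in J & j != i0.
  apply: contrapT => Hj.
  have Ji i : i \in J -> i = i0.
    by move=> iJ; apply: contrapT => /eqP ii0; apply: Hj; exists i.
  have : lcp A J (fun=> 0) d.
    split=> // [i|i /Ji ->].
      by rewrite /d; case: eqP => // ->; rewrite i0J.
    by rewrite -/(amul d i0) dA Ad // addr0; split=> //; right.
  by move=> /HR /(_ i0) /eqP; rewrite /d eqxx oner_eq0.
have db : bdry J d by split=> //; exists j; rewrite // /d (negbTE ji).
have [Z [Z0 ZJ _] ZE] := toz _ db.
have [z hz] := HQ (fun i => - d i); have [z0 zJ zc] := hz.
have wb : bdry J (fun i => - d i + amul z i).
  split; first by move=> i /zc[].
  have [k zk] : exists k, z k != 0.
    apply: contrapT => Hz; have [+ _] := zc i0 i0J.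
    rewrite big1 => [|k _]; first by rewrite /d eqxx addr0 oppr_ge0 ler10.
    have -> : z k = 0 by apply: contrapT => /eqP zk; apply: Hz; exists k.
    by rewrite mul0r.
  have kJ : k \in J by apply: contraNT zk => /zJ ->.
  exists k => //; have [_ [zk0|//]] := zc k kJ; by rewrite zk0 eqxx in zk.
have [Y [Y0 YJ _] YE] := toz _ wb.
have : lcp A J (fun=> 0) (fun i => Z i + (z i + Y i)).
  split=> [i|i iJ|i iJ]; first by rewrite !addr_ge0.
    by rewrite ZJ // zJ // YJ // !addr0.
  have -> : \sum_k (Z k + (z k + Y k)) * A i k = amul Z i + (amul z i + amul Y i).
    by rewrite -!amulD.
  have := ZE i iJ; have := YE i iJ => h1 h2.
  have -> : 0 + (amul Z i + (amul z i + amul Y i)) = 0 by lra.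
  by split=> //; right.
move=> /HR HZ.
have Z00 : Z = (fun=> 0).
  by apply: funext => i; have := HZ i; have := Z0 i; have := z0 i; have := Y0 i; lra.
by have := ZE i0 i0J; rewrite Z00 amul0 addr0 /d eqxx => /eqP; rewrite oner_eq0.
Qed.

End Viability.

(** * From long chains to backward value tables *)

Section Table.
Variables (R : realType) (N : nat).
Local Notation I := 'I_N.
Variable A : I -> I -> R.
Hypothesis A1 : forall i j, `|A i j| <= 1.
Variable J : {set I}.
Hypothesis Ad : forall i, i \in J -> A i i = 0.
Hypothesis Aout : forall i j, i \notin J -> j \in J -> 0 <= A i j.

(* Backward value tables: in state k.+1 player j quits at rate z k.+1 j relative to the move
   to state k, and w is the value. The slack b dominates both the errors in the balance of w
   and the effect of a player i who never quits, which is why only the rates of the other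
   players appear on the right-hand side. *)
Definition table T (z w b : nat -> I -> R) :=
  [/\ forall i, z 0%N i = 0,
      forall i, 0 <= w 0%N i,
      forall i, 1 + w 0%N i <= b 0%N i &
      forall k, (k < T)%N -> forall i,
        [/\ 0 <= z k.+1 i, 0 <= w k.+1 i, z k.+1 i = 0 \/ w k.+1 i = 0 &
         b k i + `|(1 + \sum_j z k.+1 j) * w k.+1 i - (w k i + amul A (z k.+1) i)|
           <= (1 + \sum_(j | j != i) z k.+1 j) * b k.+1 i]].

(** Chains control only the coordinates in [J]; elsewhere the value is what the quitters of [J] have
    paid so far, nonnegative by [Aout]. *)
Let fullW W Z i := if i \in J then W i else amul A Z i.

Lemma exprn_bernoulli (x : R) n : 0 <= x -> 1 + n%:R * x <= (1 + x) ^+ n.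
Proof.
move=> x0; elim: n => [|n IH]; first by rewrite mul0r addr0 expr0.
rewrite exprS -natr1; have : 0 <= n%:R * x ^+ 2 by rewrite mulr_ge0 ?sqr_ge0.
have : (1 + x) * (1 + n%:R * x) <= (1 + x) * (1 + x) ^+ n by rewrite ler_wpM2l ?addr_ge0.
lra.
Qed.

Section FromReach.
Variables (X : I -> R) (K : I -> nat).
Hypothesis Xb : bdry J X.
(** No player carries nearly all the mass, so the others end the game even if he never quits. *)
Hypothesis Kmass : forall W Z e, reach A J X W Z e -> e < 1 -> forall i,
  1 + \sum_j Z j <= (K i)%:R * (1 + \sum_(j | j != i) Z j).

(** Division by [1 + \sum_j Z j] turns masses into rates relative to one move down, and accumulated
    payoffs into values. The initial slack decays like the mass of the others to the power
    [-1 / K i], while the chain errors are bounded by their sum [e]. *)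
Lemma reach_table W Z e : reach A J X W Z e -> e < 1 ->
  exists T z w b (beta : I -> R), [/\ table T z w b,
    forall i, w T i = fullW W Z i / (1 + \sum_j Z j),
    forall i, b T i <= beta i + e, forall i, 0 <= beta i &
    forall i, beta i ^+ K i * (1 + \sum_(j | j != i) Z j) <= (1 + fullW X (fun=> 0) i) ^+ K i].
Proof.
have X0 i : 0 <= fullW X (fun=> 0) i.
  by rewrite /fullW; case: ifP => [/(proj1 Xb)//|_]; rewrite amul0.
elim=> {W Z e} [e1|W Z e z W' Z' e' rW IH z0 zJ zc Wb ZE E e'1].
  exists 0%N, (fun _ _ => 0), (fun _ => fullW X (fun=> 0)), (fun _ i => 1 + fullW X (fun=> 0) i),
    (fun i => 1 + fullW X (fun=> 0) i); split=> // i.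
  - by rewrite big1 // addr0 divr1.
  - by rewrite addr0.
  - by rewrite addr_ge0.
  - by rewrite big1 // addr0 mulr1.
have err0 : 0 <= \sum_(i in J) `|W' i - (W i + amul A z i)| by apply: sumr_ge0.
have e1 : e < 1 by lra.
have [T [zt [wt [bt [beta [[zt0 wt0 bt0 tab] wT bT beta0 betaK]]]]]] := IH e1.
have [e0 Z0 ZJ] := reach_ge0 rW.
pose m := 1 + \sum_j Z j.
have m1 : 1 <= m by rewrite /m lerDl sumr_ge0.
have m0 : 0 < m by lra.
pose y i := z i / m.
have y0 i : 0 <= y i by rewrite divr_ge0 // ltW.
have sz0 : 0 <= \sum_j z j by apply: sumr_ge0.
have m'E : 1 + \sum_j Z' j = m + \sum_j z j.
  by rewrite /m -addrA -big_split; congr (_ + _); apply: eq_bigr => j _; rewrite ZE.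
have ysum : \sum_j y j = (\sum_j z j) / m by rewrite mulr_suml.
pose wn i := fullW W' Z' i / (1 + \sum_j Z' j).
pose err i := fullW W' Z' i - (fullW W Z i + amul A z i).
have aZ' i : amul A Z' i = amul A Z i + amul A z i.
  by rewrite -amulD; congr amul; apply: funext.
have wTE i : wt T i = fullW W Z i / m by [].
have errE i : (1 + \sum_j y j) * wn i - (wt T i + amul A y i) = err i / m.
  have -> : amul A y i = amul A z i / m.
    by rewrite mulrC -amulZ; congr amul; apply: funext => j; rewrite mulrC.
  have msz : m + \sum_j z j != 0 by rewrite gt_eqF // ltr_pwDl.
  rewrite wTE ysum /wn m'E /err; field; rewrite msz gt_eqF //.
have err_le i : `|err i| <= \sum_(j in J) `|W' j - (W j + amul A z j)|.
  rewrite /err /fullW; case: ifP => iJ; last by rewrite aZ' subrr normr0.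
  by rewrite (bigD1 i) //= lerDl sumr_ge0.
pose s i := \sum_(j | j != i) y j.
have s0 i : 0 <= s i by apply: sumr_ge0.
have s1 i : 0 < 1 + s i by rewrite ltr_pwDl.
pose bn i := (bt T i + `|err i| / m) / (1 + s i).
pose ext (f : nat -> I -> R) g k := if k == T.+1 then g else f k.
have extT f g : ext f g T.+1 = g by rewrite /ext eqxx.
have extS f g k : (k <= T)%N -> ext f g k = f k.
  by move=> kT; rewrite /ext; case: eqP => // h; rewrite h ltnn in kT.
exists T.+1, (ext zt y), (ext wt wn), (ext bt bn), (fun i => beta i / (1 + s i)).
have wn0 i : 0 <= wn i.
  rewrite /wn divr_ge0 //; last by rewrite m'E addr_ge0 // ltW.
  rewrite /fullW; case: ifP => [/(proj1 Wb)//|/negbT iJ].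
  rewrite /amul; apply: sumr_ge0 => j _.
  have Z'j : 0 <= Z' j by rewrite ZE addr_ge0.
  have [jJ|jJ] := boolP (j \in J); first by rewrite mulr_ge0 // Aout.
  by rewrite ZE ZJ // zJ // addr0 mul0r.
split.
- split=> // k; rewrite ltnS leq_eqVlt => /orP[/eqP ->|kT] i; last first.
    by rewrite !extS // ?(ltnW kT) //; exact: tab.
  rewrite !extT !(extS _ _ _ (leqnn T)); split=> //.
    have [iJ|iJ] := boolP (i \in J); last by left; rewrite /y zJ // mul0r.
    case: (zc i iJ) => [zi|Wi]; first by left; rewrite /y zi mul0r.
    by right; rewrite /wn /fullW iJ Wi mul0r.
  rewrite errE -/(s i) /bn [leRHS]mulrC divfK ?gt_eqF // lerD2l normrM.
  by rewrite (gtr0_norm (x := m^-1)) // invr_gt0.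
- by move=> i; rewrite extT.
- move=> i; rewrite extT /bn mulrDl; have := bT i; have := err_le i => h1 h2.
  have h3 : `|err i| / m <= `|err i|.
    by rewrite ler_pdivrMr // ler_peMr.
  rewrite E -mulrDl ler_pdivrMr // mulrDl divfK ?gt_eqF //.
  have : 0 <= (e + \sum_(i0 in J) `|W' i0 - (W i0 + amul A z i0)|) * s i.
    by rewrite mulr_ge0 // addr_ge0.
  lra.
- by move=> i; rewrite divr_ge0 // ltW.
move=> i; apply: le_trans (betaK i).
rewrite expr_div_n mulrAC ler_pdivrMr ?exprn_gt0 // -mulrA ler_wpM2l ?exprn_ge0 //.
have -> : \sum_(j | j != i) Z' j = \sum_(j | j != i) Z j + \sum_(j | j != i) z j.
  by rewrite -big_split; apply: eq_bigr => j _; rewrite ZE.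
set a := \sum_(j | j != i) Z j; set d := \sum_(j | j != i) z j.
have a0 : 0 <= a by apply: sumr_ge0.
have d0 : 0 <= d by apply: sumr_ge0.
have sE : s i = d / m by rewrite /s mulr_suml.
have := Kmass rW e1 i; rewrite -/m -/a => Km.
(* [Kmass] says [m <= K i * (1 + a)], so the middle term is at least [1 + a + d]. *)
apply: (@le_trans _ _ ((1 + a) * (1 + (K i)%:R * s i))); last first.
  by rewrite ler_wpM2l ?exprn_bernoulli // addr_ge0.
have : d * m <= d * ((K i)%:R * (1 + a)) by rewrite ler_wpM2l.
rewrite sE => h; have : d <= (1 + a) * ((K i)%:R * (d / m)).
  by rewrite !mulrA ler_pdivlMr //; lra.
lra.
Qed.

End FromReach.

(** If the column of [i] were nonnegative on [J], his unit vector would be a homogeneous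
    solution. *)
Lemma R0_punisher i : R0_on A J -> i \in J -> exists2 j, j \in J & A j i < 0.
Proof.
move=> HR iJ; apply: contrapT => H.
pose d : I -> R := fun j => (j == i)%:R.
have dA j : \sum_k d k * A j k = A j i.
  rewrite (bigD1 i) //= /d eqxx mul1r big1 ?addr0 // => k /negbTE ->.
  by rewrite mul0r.
have : lcp A J (fun=> 0) d.
  split=> [j|j jJ|j jJ]; first by rewrite ler0n.
    by rewrite /d; case: eqP => // ji; rewrite ji iJ in jJ.
  rewrite dA add0r; split.
    by rewrite leNgt; apply/negP => h; apply: H; exists j.
  by rewrite /d; case: eqP => [->|_]; [right; rewrite Ad|left].
by move=> /HR /(_ i) /eqP; rewrite /d eqxx oner_eq0.
Qed.

Lemma table_exists X eps : R0_on A J -> bdry J X -> unb A J X -> 0 < eps ->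
  exists T z w b, table T z w b /\ forall i, b T i <= eps.
Proof.
move=> HR Xb Xu eps0.
have /choice[K hK] i : exists k : nat, (0 < k)%N /\
    forall W Z e, reach A J X W Z e -> e < 1 ->
    1 + \sum_j Z j <= k%:R * (1 + \sum_(j | j != i) Z j).
  have [iJ|iJ] := boolP (i \in J); last first.
    exists 1%N; split=> // W Z e rW _; have [_ _ ZJ] := reach_ge0 rW.
    by rewrite mul1r (bigD1 i) //= ZJ // add0r.
  have [j jJ Aji] := R0_punisher HR iJ.
  have Xj : 0 <= X j by case: Xb => + _; exact.
  set be := - A j i; have be0 : 0 < be by rewrite oppr_gt0.
  (* As [i] hurts [j], the condition [0 <= W j] bounds [be * Z i] by [X j + 1] plus the mass of the
     others. *)
  pose c := 1 + (X j + 1) / be.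
  have c0 : 0 <= c by rewrite addr_ge0 // divr_ge0 ?addr_ge0 // ltW.
  exists (Num.bound c).+1; split=> // W Z e rW e1.
  have [e0 Z0 ZJ] := reach_ge0 rW.
  have [W0 _] := reach_bdry Xb rW.
  have := reach_balance rW jJ; rewrite ler_norml => /andP[_]; have := W0 j jJ.
  have S0 : 0 <= \sum_(l | l != i) Z l by apply: sumr_ge0.
  have : amul A Z j <= - be * Z i + \sum_(l | l != i) Z l.
    rewrite /amul (bigD1 i) //= /be opprK mulrC lerD2l; apply: ler_sum => l _.
    rewrite ler_piMr //; apply: le_trans (ler_norm _) _; exact: A1.
  rewrite [X in 1 + X <= _](bigD1 i) //=; set S := \sum_(l | _) _ in S0 *.
  move=> h1 h2 h3.
  have h4 : be * Z i <= X j + 1 + S by lra.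
  have h5 : Z i <= (1 + S) * ((X j + 1) / be).
    rewrite mulrA ler_pdivlMr //; have : 0 <= S * X j by rewrite mulr_ge0.
    lra.
  have h6 : (1 + S) * c <= (1 + S) * (Num.bound c).+1%:R.
    rewrite ler_wpM2l ?addr_ge0 // -natr1; have := archi_boundP c0; lra.
  have : (1 + S) * c = (1 + S) + (1 + S) * ((X j + 1) / be) by rewrite /c mulrDr mulr1.
  lra.
pose B i := 1 + fullW X (fun=> 0) i.
have B0 i : 0 <= B i.
  rewrite addr_ge0 // /fullW; case: ifP => [/(proj1 Xb)//|_]; by rewrite amul0.
(* A mass beyond which the decay in [reach_table] forces [beta i <= eps / 2]. *)
pose Li i := (K i)%:R * (B i ^+ K i / (eps / 2) ^+ K i).
have e2 : 0 < eps / 2 by rewrite divr_gt0.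
have Li0 i : 0 <= Li i by rewrite mulr_ge0 // divr_ge0 ?exprn_ge0 // ltW.
have d0 : 0 < Num.min 1 (eps / 2) by rewrite lt_min ltr01.
have [W [Z [e [rW]]]] := Xu (\sum_i Li i) _ d0.
rewrite lt_min => /andP[e1 ee] LZ.
have Kmass W0 Z0 e0 : reach A J X W0 Z0 e0 -> e0 < 1 -> forall i,
    1 + \sum_j Z0 j <= (K i)%:R * (1 + \sum_(j | j != i) Z0 j).
  by move=> r1 h i; case: (hK i) => _; apply; [exact: r1|].
have [T [z [w [b [beta [tab wT bT beta0 betaK]]]]]] := reach_table Xb Kmass rW e1.
exists T, z, w, b; split=> // i; apply: le_trans (bT i) _.
suff : beta i <= eps / 2 by lra.
rewrite leNgt; apply/negP => hb.
have K0 : 0 < (K i)%:R :> R by rewrite ltr0n; case: (hK i).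
have := Kmass _ _ _ rW e1 i; have := betaK i; rewrite -/(B i).
have LiL : Li i <= \sum_j Li j by rewrite (bigD1 i) //= lerDl sumr_ge0.
set a := 1 + \sum_(j | j != i) Z j => h1 h2.
have a0 : 0 <= a.
  by rewrite addr_ge0 // sumr_ge0 // => j _; case: (reach_ge0 rW).
have h3 : (eps / 2) ^+ K i * a <= B i ^+ K i.
  apply: le_trans h1; rewrite ler_wpM2r // lerXn2r ?nnegrE ?(ltW hb) ?(ltW e2) //.
have h4 : a <= B i ^+ K i / (eps / 2) ^+ K i.
  by rewrite ler_pdivlMr ?exprn_gt0 // mulrC.
have : (K i)%:R * a <= Li i by rewrite ler_wpM2l // ltW.
lra.
Qed.
End Table.

(** * Integrals over one uniform signal *)

Section Unit_integral.
Variable R : realType.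
Local Notation mu := (@lebesgue_measure R).
Local Notation U01 := (`[0%R, 1%R]%classic : set R).
Local Notation int01 f := (Rintegral mu U01 f).

Definition bounded_meas (f : R -> R) :=
  measurable_fun [set: R] f /\ exists C, forall s, 0 <= s <= 1 -> `|f s| <= C.

Lemma mu_U01 : mu U01 = 1%E.
Proof. by rewrite lebesgue_measure_itv /= lte_fin ltr01 oppr0 adde0. Qed.

Lemma bounded_meas_integrable f : bounded_meas f -> mu.-integrable U01 (EFin \o f).
Proof.
move=> [mf [C fC]]; apply: measurable_bounded_integrable => //.
- by have h : (mu U01 < +oo)%E by rewrite mu_U01 ltry.
- exact: measurable_funS mf.
- exists C; split; first exact: num_real.
  move=> M CM s /=; rewrite in_itv /= => /fC h; apply: le_trans h _; exact: ltW.
Qed.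

Lemma bounded_measD f g : bounded_meas f -> bounded_meas g -> bounded_meas (fun s => f s + g s).
Proof.
move=> [mf [C fC]] [mg [D gD]]; split; first exact: measurable_funD.
exists (C + D) => s s01; apply: le_trans (ler_normD _ _) _; apply: lerD; [exact: fC|exact: gD].
Qed.

Lemma bounded_measM f g : bounded_meas f -> bounded_meas g -> bounded_meas (fun s => f s * g s).
Proof.
move=> [mf [C fC]] [mg [D gD]]; split; first exact: measurable_funM.
exists (C * D) => s s01; rewrite normrM; apply: ler_pM => //; [exact: fC|exact: gD].
Qed.

Lemma bounded_meas_cst c : bounded_meas (fun=> c).
Proof. by split; [exact: measurable_cst|exists `|c|]. Qed.

Lemma bounded_measZ c f : bounded_meas f -> bounded_meas (fun s => c * f s).
Proof. by move=> bf; apply: bounded_measM => //; exact: bounded_meas_cst. Qed.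

Lemma bounded_measB f g : bounded_meas f -> bounded_meas g -> bounded_meas (fun s => f s - g s).
Proof.
move=> bf bg; have -> : (fun s => f s - g s) = (fun s => f s + -1 * g s).
  by apply: funext => s; rewrite mulN1r.
by apply: bounded_measD => //; exact: bounded_measZ.
Qed.

Lemma bounded_meas_sum (I : finType) (F : I -> R -> R) :
  (forall i, bounded_meas (F i)) -> bounded_meas (fun s => \sum_i F i s).
Proof.
move=> bF; elim: (index_enum I) => [|i l IH].
  by under eq_fun do rewrite big_nil; exact: bounded_meas_cst.
by under eq_fun do rewrite big_cons; exact: bounded_measD.
Qed.

Lemma int01_cst c : int01 (fun=> c) = c.
Proof.
transitivity (c * fine (mu U01)); first exact: Rintegral_cst.
by rewrite mu_U01 mulr1.
Qed.

Lemma int01_le f g : bounded_meas f -> bounded_meas g ->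
  (forall s, 0 <= s <= 1 -> f s <= g s) -> int01 f <= int01 g.
Proof.
move=> bf bg fg; apply: le_Rintegral => //; try exact: bounded_meas_integrable.
Qed.

Lemma int01D f g : bounded_meas f -> bounded_meas g ->
  int01 (fun s => f s + g s) = int01 f + int01 g.
Proof. by move=> bf bg; apply: RintegralD => //; exact: bounded_meas_integrable. Qed.

Lemma int01B f g : bounded_meas f -> bounded_meas g ->
  int01 (fun s => f s - g s) = int01 f - int01 g.
Proof. by move=> bf bg; apply: RintegralB => //; exact: bounded_meas_integrable. Qed.

Lemma int01Z c f : bounded_meas f -> int01 (fun s => c * f s) = c * int01 f.
Proof. by move=> bf; apply: RintegralZl => //; exact: bounded_meas_integrable. Qed.

Lemma int01_sum (I : finType) (F : I -> R -> R) :
  (forall i, bounded_meas (F i)) -> int01 (fun s => \sum_i F i s) = \sum_i int01 (F i).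
Proof.
move=> bF.
suff [_ //] : bounded_meas (fun s => \sum_i F i s) /\ int01 (fun s => \sum_i F i s) = \sum_i int01 (F i).
elim: (index_enum I) => [|i l [bl El]].
  split; first by under eq_fun do rewrite big_nil; exact: bounded_meas_cst.
  by rewrite big_nil -[RHS](int01_cst 0); congr (Rintegral _ _); apply: funext => s; rewrite big_nil.
have E s : \sum_(j <- i :: l) F j s = F i s + \sum_(j <- l) F j s by rewrite big_cons.
split; first by rewrite (funext E); exact: bounded_measD.
by rewrite (funext E) int01D // El big_cons.
Qed.

Lemma int01_norm f C : bounded_meas f -> (forall s, 0 <= s <= 1 -> `|f s| <= C) -> `|int01 f| <= C.
Proof.
move=> bf fC; rewrite ler_norml -{1}(int01_cst (- C)) -{2}(int01_cst C).
apply/andP; split; apply: int01_le => //; try exact: bounded_meas_cst.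
  by move=> s /fC; rewrite ler_norml => /andP[].
by move=> s /fC; rewrite ler_norml => /andP[].
Qed.

Definition ind (c d s : R) : R := ((c <= s < d)%R)%:R.

Lemma bounded_meas_ind (c d : R) : bounded_meas (ind c d).
Proof.
split; last first.
  by exists 1 => s _; rewrite /ind; case: (_ && _); rewrite ?normr1 ?normr0.
have -> : ind c d = \1_(`[c, d[%classic : set R).
  by apply: funext => s; rewrite indicE /ind mem_setE in_itv.
exact: measurable_indic.
Qed.

Lemma int01_ind (c d : R) : 0 <= c -> c <= d -> d <= 1 -> int01 (ind c d) = d - c.
Proof.
move=> c0 cd d1.
have -> : ind c d = (cst 1 : R -> R) \_ (`[c, d[%classic : set R).
  by apply: funext => s; rewrite /ind patchE mem_setE in_itv /=; case: (_ && _).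
rewrite -Rintegral_mkcondr.
have -> : U01 `&` (`[c, d[%classic : set R) = (`[c, d[%classic : set R).
  apply/seteqP; split=> s /=; first by case.
  rewrite !in_itv /= => /andP[cs sd]; rewrite cs sd; split=> //.
  by rewrite (le_trans c0 cs) (le_trans (ltW sd) d1).
transitivity (1 * fine (mu (`[c, d[%classic : set R))); first exact: Rintegral_cst.
rewrite mul1r lebesgue_measure_itv /= lte_fin.
by move: cd; rewrite le_eqVlt => /orP[/eqP ->|->] //=; rewrite ltxx subrr.
Qed.

Lemma int01_step (I : finType) (u a0 c0 : R) (a c d : I -> R) : 0 <= c0 <= 1 ->
  (forall i, [/\ 0 <= c i, c i <= d i & d i <= 1]) ->
  bounded_meas (fun s => u + a0 * ind 0 c0 s + \sum_i a i * ind (c i) (d i) s) /\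
  int01 (fun s => u + a0 * ind 0 c0 s + \sum_i a i * ind (c i) (d i) s) =
    u + a0 * c0 + \sum_i a i * (d i - c i).
Proof.
move=> /andP[c00 c01] cd.
have b1 : bounded_meas (fun s => u + a0 * ind 0 c0 s).
  by apply: bounded_measD; [exact: bounded_meas_cst|apply: bounded_measZ; exact: bounded_meas_ind].
have b2 i : bounded_meas (fun s => a i * ind (c i) (d i) s).
  by apply: bounded_measZ; exact: bounded_meas_ind.
have b3 := bounded_meas_sum b2.
split; first exact: bounded_measD.
rewrite int01D // int01D; [|exact: bounded_meas_cst|apply: bounded_measZ; exact: bounded_meas_ind].
rewrite int01_cst int01Z ?int01_ind ?subr0 //; last exact: bounded_meas_ind.
congr (_ + _); rewrite int01_sum //; apply: eq_bigr => i _.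
by have [? ? ?] := cd i; rewrite int01Z ?int01_ind //; exact: bounded_meas_ind.
Qed.

(** Tonelli gives measurability in the parameter for nonnegative integrands, hence the split into
    positive and negative parts. *)
Lemma measurable_int01 d (X : measurableType d) (G : X * R -> R) :
  measurable_fun [set: X * R] G -> measurable_fun [set: X] (fun h => int01 (fun s => G (h, s))).
Proof.
move=> mG; rewrite /Rintegral; apply: measurableT_comp => //.
have mH : measurable_fun [set: X * R] (fun p => ((G p)%:E * (\1_U01 p.2)%:E)%E).
  apply: emeasurable_funM; first exact/measurable_EFinP.
  apply/measurable_EFinP; apply: (@measurableT_comp _ _ _ _ _ _ (\1_U01 : R -> R)) => //.
pose H (p : X * R) := ((G p)%:E * (\1_U01 p.2)%:E)%E.
have -> : (fun h => \int[mu]_(s in U01) (G (h, s))%:E)%E =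
   (fun h => (\int[mu]_s (H^\+ (h, s)) - \int[mu]_s (H^\- (h, s)))%E).
  apply: funext => h; rewrite integral_mkcond integralE; congr (_ - _)%E;
    apply: eq_integral => s _; rewrite ?funeposE ?funenegE /H patchE /= indicE;
    by case: (s \in U01); rewrite ?mulr1n ?mulr0n ?mulr1 ?mulr0 ?mule1 ?mule0.
apply: emeasurable_funB.
  apply: (@measurable_fun_fubini_tonelli_F _ _ _ _ _ mu (H^\+)%E) => //.
  exact: measurable_funepos.
apply: (@measurable_fun_fubini_tonelli_F _ _ _ _ _ mu (H^\-)%E) => //.
exact: measurable_funeneg.
Qed.

End Unit_integral.

(** * Convergence of payoffs in the sunspot game *)

Section Scont.
Variables (R : realType) (N : nat).
Local Notation I := 'I_N.
Local Notation mu := (@lebesgue_measure R).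
Local Notation U01 := (`[0%R, 1%R]%classic : set R).
Local Notation int01 f := (Rintegral mu U01 f).

Definition qprob (xi : sprofile R N) t (h : (t.+1).-tuple R) : I -> R := fun j => xi j t h.

Definition stage_value (r : game R N) (xi : sprofile R N) i k t (h : (t.+1).-tuple R) :=
  stage_quit r (qprob xi h) i + no_quit (qprob xi h) * scont r xi i k h.

Lemma scontS r xi i k t (h : t.-tuple R) :
  scont r xi i k.+1 h = int01 (fun s => stage_value r xi i k [tuple of s :: h]).
Proof. by []. Qed.

Variable xi : sprofile R N.
Hypothesis xis : forall j, is_sstrategy (xi j).

Lemma measurable_stage_value r i k t :
  (forall t, measurable_fun [set: t.-tuple R] (fun h : t.-tuple R => scont r xi i k h)) ->
  measurable_fun [set: (t.+1).-tuple R] (fun h : (t.+1).-tuple R => stage_value r xi i k h).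
Proof.
move=> mk.
have mx j : measurable_fun [set: (t.+1).-tuple R] (fun h : (t.+1).-tuple R => qprob xi h j).
  by case: (xis j t).
have m1x j : measurable_fun [set: (t.+1).-tuple R] (fun h : (t.+1).-tuple R => 1 - qprob xi h j).
  by apply: measurable_funB => //; exact: measurable_cst.
have mprod (P : pred I) (F : I -> (t.+1).-tuple R -> R) : (forall j, measurable_fun setT (F j)) ->
    measurable_fun setT (fun h => \prod_(j | P j) F j h).
  move=> mF; under eq_fun do rewrite big_mkcond.
  by apply: measurable_prod => j _; case: (P j); [exact: mF|exact: measurable_cst].
rewrite /stage_value; apply: measurable_funD.
  rewrite /stage_quit; under eq_fun do rewrite big_mkcond.
  apply: measurable_sum => S; case: (S != _); last exact: measurable_cst.
  apply: measurable_funM; last exact: measurable_cst.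
  by rewrite /probS; apply: measurable_funM; apply: mprod.
by apply: measurable_funM; [apply: (mprod xpredT)|exact: mk].
Qed.

Lemma measurable_scont r i k t :
  measurable_fun [set: t.-tuple R] (fun h : t.-tuple R => scont r xi i k h).
Proof.
elim: k t => [|k IH] t; first exact: measurable_cst.
apply: (@measurable_int01 R _ (t.-tuple R)
  (fun p => stage_value r xi i k [tuple of p.2 :: p.1])).
apply: (@measurableT_comp _ _ _ _ _ _ (fun h : (t.+1).-tuple R => stage_value r xi i k h)).
  exact: measurable_stage_value.
exact: measurable_cons.
Qed.

Lemma sig_hist_cons t (h : t.-tuple R) s : sig_hist h -> 0 <= s <= 1 ->
  sig_hist [tuple of s :: h].
Proof.
move=> hh s01 k; rewrite (tnth_nth 0) /=; case: k => -[|k] hk //=.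
by rewrite ltnS in hk; have := hh (Ordinal hk); rewrite (tnth_nth 0).
Qed.

Lemma qprob_01 t (h : (t.+1).-tuple R) : sig_hist h -> forall j, 0 <= qprob xi h j <= 1.
Proof. by move=> hh j; case: (xis j t) => _; apply. Qed.

(** Both claims go in one induction: the bound on an integral needs an integrable integrand, and its
    boundedness comes from the shorter horizon. *)
Lemma scont_norm r i k t (h : t.-tuple R) : payoffs_bounded r -> sig_hist h ->
  `|scont r xi i k h| <= 1 /\
  forall l t' (h' : t'.-tuple R), (l < k)%N -> sig_hist h' ->
    bounded_meas (fun s => stage_value r xi i l [tuple of s :: h']).
Proof.
move=> rb; suff H : forall t (h : t.-tuple R), sig_hist h -> `|scont r xi i k h| <= 1 /\
  forall l t' (h' : t'.-tuple R), (l < k)%N -> sig_hist h' ->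
    bounded_meas (fun s => stage_value r xi i l [tuple of s :: h']) by exact: H.
elim: k {t h} => [|k IH] t h hh; first by split=> //; exact: r_norm.
have val t' (h' : t'.-tuple R) s : sig_hist h' -> 0 <= s <= 1 ->
    `|stage_value r xi i k [tuple of s :: h']| <= 1.
  move=> hh' s01; have hs := sig_hist_cons hh' s01.
  have [sk _] := IH _ _ hs.
  have p01 := qprob_01 hs; have := stage_quit_norm rb i p01; rewrite -/(no_quit _) => hq.
  have /andP[n0 n1] := no_quit_01 p01.
  apply: le_trans (ler_normD _ _) _; rewrite normrM (ger0_norm n0).
  have : no_quit (qprob xi [tuple of s :: h']) * `|scont r xi i k [tuple of s :: h']| <=
    no_quit (qprob xi [tuple of s :: h']) by rewrite ler_piMr.
  lra.
have bm t' (h' : t'.-tuple R) : sig_hist h' ->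
    bounded_meas (fun s => stage_value r xi i k [tuple of s :: h']).
  move=> hh'; split; last by exists 1 => s; exact: val.
  apply: (@measurableT_comp _ _ _ _ _ _ (fun g : (t'.+1).-tuple R => stage_value r xi i k g)).
    by apply: measurable_stage_value => ?; exact: measurable_scont.
  by apply: measurable_cons => //; exact: measurable_cst.
split; first by rewrite scontS; apply: int01_norm => [|s]; [exact: bm|exact: val].
move=> l t' h'; rewrite ltnS leq_eqVlt => /orP[/eqP -> /bm //|lk hh'].
by have [_ +] := IH _ _ hh; apply.
Qed.

Lemma stage_value_bounded r i k t (h : t.-tuple R) : payoffs_bounded r -> sig_hist h ->
  bounded_meas (fun s => stage_value r xi i k [tuple of s :: h]).
Proof. by move=> rb hh; have [_] := scont_norm i k.+1 rb hh; apply. Qed.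

Lemma sig_hist0 : sig_hist ([tuple] : 0.-tuple R).
Proof. by case. Qed.

(** Its continuation payoff is the probability that nobody quits before the horizon, the analogue of
    [surv]. *)
Definition survival_game : game R N := fun S _ => (S == finset.set0)%:R.

Lemma survival_game_bounded : payoffs_bounded survival_game.
Proof. by move=> S i; rewrite /survival_game; case: eqP => _; rewrite /= ?lexx; lra. Qed.

Lemma stage_quit_survival p i : stage_quit survival_game p i = 0.
Proof. by rewrite /stage_quit big1 // => S /negbTE S0; rewrite /survival_game S0 mulr0. Qed.

(** The two horizons pay differently only if the first quit falls in the extra stage, and the
    survival game measures that probability. *)
Lemma scont_variation r i k t (h : t.-tuple R) : payoffs_bounded r -> sig_hist h ->
  `|scont r xi i k.+1 h - scont r xi i k h| <=
  2 * (scont survival_game xi i k h - scont survival_game xi i k.+1 h).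
Proof.
move=> rb; have sb := survival_game_bounded.
suff H : forall s : R, s = 1 \/ s = -1 -> sig_hist h ->
    s * (scont r xi i k.+1 h - scont r xi i k h) <=
    2 * (scont survival_game xi i k h - scont survival_game xi i k.+1 h).
  move=> hh; rewrite ler_norml; have := H 1 (or_introl erefl) hh.
  by have := H (-1) (or_intror erefl) hh; lra.
move=> s s1; elim: k t h => [|k IH] t h hh.
  have E : scont r xi i 0 h = int01 (fun=> r finset.set0 i) by rewrite int01_cst.
  have E' : scont survival_game xi i 0 h = int01 (fun=> 1) by rewrite int01_cst /= /survival_game eqxx.
  rewrite E E' !scontS.
  have b1 := stage_value_bounded i 0 rb hh; have b2 := stage_value_bounded i 0 sb hh.
  have bc c := bounded_meas_cst c : bounded_meas (fun=> c).
  rewrite -!int01B // -!int01Z; [|exact: bounded_measB|exact: bounded_measB].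
  apply: int01_le; [apply: bounded_measZ; exact: bounded_measB|
    apply: bounded_measZ; exact: bounded_measB|] => u u01.
  have p01 := qprob_01 (sig_hist_cons hh u01).
  rewrite /stage_value stage_quit_survival /= /survival_game eqxx add0r mulr1.
  have := stage_quit_norm rb i p01; rewrite -/(no_quit _) ler_norml => /andP[].
  have := r_norm rb finset.set0 i; rewrite ler_norml => /andP[].
  have /andP[] := no_quit_01 p01.
  set n := no_quit _; set q := stage_quit _ _ _; set e := r _ _ => n0 n1 e1 e2 q1 q2.
  have h1 : 0 <= (1 - n) * (1 - e) by rewrite mulr_ge0 // subr_ge0.
  have h2 : 0 <= (1 - n) * (e - -1) by rewrite mulr_ge0 // subr_ge0.
  by case: s1 => ->; lra.
rewrite ![scont _ _ _ _.+2 _]scontS [scont r _ _ k.+1 _]scontS [scont survival_game _ _ k.+1 _]scontS.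
have b1 l := stage_value_bounded i l rb hh; have b2 l := stage_value_bounded i l sb hh.
rewrite -!int01B // -!int01Z; [|exact: bounded_measB|exact: bounded_measB].
apply: int01_le; [apply: bounded_measZ; exact: bounded_measB|
  apply: bounded_measZ; exact: bounded_measB|] => u u01.
have hs := sig_hist_cons hh u01; have p01 := qprob_01 hs.
have := IH _ _ hs; have /andP[] := no_quit_01 p01.
rewrite /stage_value; set n := no_quit _; set q := stage_quit _ _ _; set q' := stage_quit _ _ _.
set v1 := scont _ _ _ _ _; set v2 := scont _ _ _ _ _; set v3 := scont _ _ _ _ _; set v4 := scont _ _ _ _ _.
move=> n0 _ h1; have := ler_wpM2l n0 h1; lra.
Qed.

Lemma sgamma_cvg r i : payoffs_bounded r -> cvgn (fun T => scont r xi i T [tuple]).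
Proof.
move=> rb; apply: (@cvg_variation _ _ (fun T => scont survival_game xi i T [tuple])) => T.
  suff H : forall t (h : t.-tuple R), sig_hist h -> 0 <= scont survival_game xi i T h.
    exact: H sig_hist0.
  elim: T => [|T IH] t h hh; first by rewrite /= /survival_game eqxx.
  rewrite scontS -[leLHS](int01_cst 0); apply: int01_le; first exact: bounded_meas_cst.
    by apply: stage_value_bounded => //; exact: survival_game_bounded.
  move=> s s01; have hs := sig_hist_cons hh s01.
  rewrite /stage_value stage_quit_survival add0r mulr_ge0 ?IH //.
  by case/andP: (no_quit_01 (qprob_01 hs)).
exact: scont_variation sig_hist0.
Qed.

End Scont.

(** Serves for strategies that depend on past signals through an integer state. *)
Lemma measurable_nat_select d d' (X : measurableType d) (Y : measurableType d')
    (g : X -> nat) (f : nat -> X -> Y) :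
  (forall k, measurable [set x | g x = k]) -> (forall k, measurable_fun [set: X] (f k)) ->
  measurable_fun [set: X] (fun x => f (g x) x).
Proof.
move=> mg mf _ B mB; rewrite setTI.
have -> : (fun x => f (g x) x) @^-1` B = \bigcup_k ([set x | g x = k] `&` (f k @^-1` B)).
  apply/seteqP; split=> x /=; first by exists (g x).
  by move=> [k _ [/= <-]].
apply: bigcupT_measurable => k; apply: measurableI => //.
by rewrite -[X in measurable X]setTI; exact: mf.
Qed.

(** * The sunspot equilibrium driven by a value table *)

Section Sunspot.
Variables (R : realType) (N : nat) (r : game R N).
Local Notation I := 'I_N.
Hypothesis rb : payoffs_bounded r.
Hypothesis r0 : forall i, r [set i]%SET i = 0.
Let A : I -> I -> R := fun i j => r [set j]%SET i.
Variables (T : nat) (z w b : nat -> I -> R).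
Hypothesis Htab : table A T z w b.
Variable eta : R.
Hypothesis eta0 : 0 < eta.
Hypothesis eta2 : eta <= 1 / 2.

Let z_ge0 k i : (k <= T)%N -> 0 <= z k i.
Proof.
case: Htab => z0 _ _ tab; case: k => [|k] kT; first by rewrite z0.
by case: (tab k kT i).
Qed.

Let w_ge0 k i : (k <= T)%N -> 0 <= w k i.
Proof. by case: Htab => _ w0 _ tab; case: k => [|k] kT //; case: (tab k kT i). Qed.

Let b_ge0 k i : (k <= T)%N -> 0 <= b k i.
Proof.
case: Htab => _ w0 b0 tab; elim: k => [|k IH] kT.
  by apply: le_trans (b0 i); rewrite addr_ge0.
have [_ _ _ h] := tab k kT i.
have S0 : 0 <= \sum_(j | j != i) z k.+1 j by apply: sumr_ge0 => j _; exact: z_ge0.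
have : 0 <= (1 + \sum_(j | j != i) z k.+1 j) * b k.+1 i.
  by apply: le_trans h; rewrite addr_ge0 // IH // ltnW.
by rewrite pmulr_rge0 // ltr_pwDl.
Qed.

Let tot k := eta + \sum_j z k j.

Let tot_gt0 k : (k <= T)%N -> 0 < tot k.
Proof. by move=> kT; rewrite /tot ltr_pwDl // sumr_ge0 // => j _; exact: z_ge0. Qed.

(* In state k the signals in [0, cum k 0) move the state down, those in
   [cum k j, cum k j.+1) call player j to quit with probability eta. *)
Definition cum k (n : nat) : R := (eta + \sum_(j < N | (j < n)%N) z k j) / tot k.

(** State 0 is absorbing and calls nobody, since [z 0] vanishes. Play there may never end; the slack
    [1 + w 0 i <= b 0 i] covers the payoff of that. *)
Fixpoint state (h : seq R) : nat :=
  if h is s :: h' then if s < cum (state h') 0 then (state h').-1 else state h' else T.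

(** A move down has weight [eta], and a quit by [j] has weight [eta * z k j]: the odds are those of
    the table for every [eta]. *)
Definition sunspot : sprofile R N := fun j t h =>
  eta * ind (cum (state (behead h)) j) (cum (state (behead h)) j.+1) (thead h).

Let state_le h : (state h <= T)%N.
Proof. by elim: h => //= s h IH; case: ifP => _ //; rewrite (leq_trans (leq_pred _)). Qed.

Let cum0 k : cum k 0 = eta / tot k.
Proof. by rewrite /cum big_pred0 // addr0. Qed.

Let cum_le k m n : (k <= T)%N -> (m <= n)%N -> cum k m <= cum k n.
Proof.
move=> kT mn; rewrite /cum ler_pM2r ?invr_gt0 ?tot_gt0 // lerD2l.
rewrite big_mkcond [leRHS]big_mkcond; apply: ler_sum => j _.
case: ifP => jm; first by rewrite (leq_trans jm mn).
by case: ifP => // _; exact: z_ge0.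
Qed.

Let cumN k : (k <= T)%N -> cum k N = 1.
Proof.
move=> kT; rewrite /cum (eq_bigl xpredT) => [|j]; last by rewrite ltn_ord.
by rewrite divff // gt_eqF // tot_gt0.
Qed.

Let cumB k (j : I) : cum k j.+1 - cum k j = z k j / tot k.
Proof.
rewrite /cum -mulrBl; congr (_ / _).
rewrite [in X in X - _](bigD1 j) //= [X in _ + (_ + X)](eq_bigl (fun l : I => (l < j)%N)); first by ring.
by move=> l; rewrite ltnS [RHS]ltn_neqAle andbC.
Qed.

Let cum_itv k (j : I) : (k <= T)%N ->
  [/\ 0 <= cum k j, cum k j <= cum k j.+1 & cum k j.+1 <= 1].
Proof.
move=> kT; split; last by rewrite -(cumN kT) cum_le.
  apply: le_trans (cum_le kT (leq0n j)); rewrite cum0 divr_ge0 // ltW //; exact: tot_gt0.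
exact: cum_le.
Qed.

Let cum0_01 k : (k <= T)%N -> 0 <= cum k 0 <= 1.
Proof.
move=> kT; have := cum_le kT (leq0n N); rewrite cumN // => ->.
by rewrite andbT cum0 divr_ge0 // ltW //; exact: tot_gt0.
Qed.

Let ind1 (c d s : R) : ind c d s = 1 -> c <= s < d.
Proof. by rewrite /ind; case: (_ <= _ < _) => // /eqP; rewrite eq_sym oner_eq0. Qed.

Let ind01 (c d s : R) : ind c d s = 0 \/ ind c d s = 1.
Proof. by rewrite /ind; case: (_ <= _ < _); [right|left]. Qed.

Let calls k (j : I) s := ind (cum k j) (cum k j.+1) s.

Let calls_uniq k j l s : (k <= T)%N -> calls k j s = 1 -> calls k l s = 1 -> j = l.
Proof.
move=> kT /ind1/andP[j1 j2] /ind1/andP[l1 l2]; apply/val_inj => /=.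
case: (ltngtP j l) => // h.
  by have := cum_le kT h; rewrite leNgt (le_lt_trans l1 j2).
by have := cum_le kT h; rewrite leNgt (le_lt_trans j1 l2).
Qed.

Let calls_move k j s : (k <= T)%N -> calls k j s = 1 -> cum k 0 <= s.
Proof. by move=> kT /ind1/andP[+ _]; apply: le_trans; exact: cum_le. Qed.

Let state_thead t (h : (t.+1).-tuple R) : state h =
  if thead h < cum (state (behead h)) 0 then (state (behead h)).-1 else state (behead h).
Proof. by case/tupleP: h => s h; rewrite theadE. Qed.

Let measurable_state t k : measurable [set h : t.-tuple R | state h = k].
Proof.
elim: t k => [|t IH] k.
  case: (eqVneq T k) => [Tk|Tk].
    have -> : [set h : 0.-tuple R | state h = k] = setT by apply/seteqP; split=> // h _; rewrite /= tuple0.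
    exact: measurableT.
  have -> : [set h : 0.-tuple R | state h = k] = set0.
    apply/seteqP; split=> // h /=; rewrite tuple0 /= => h0; by rewrite h0 eqxx in Tk.
  exact: measurable0.
have -> : [set h : (t.+1).-tuple R | state h = k] = \bigcup_m
   ([set h : (t.+1).-tuple R | state (behead h) = m] `&`
    [set h | (if thead h < cum m 0 then m.-1 else m) = k]).
  apply/seteqP; split=> h /=.
    by rewrite state_thead => hk; exists (state (behead h)).
  by move=> [m _ [/= <-]]; rewrite state_thead.
apply: bigcupT_measurable => m; apply: measurableI.
  have := measurable_behead (T := R) (n := t) measurableT (IH m).
  by rewrite setTI.
have mt : measurable [set h : (t.+1).-tuple R | thead h < cum m 0].
  have mth := measurable_tnth (T := R) (@ord0 t).
  have := mth measurableT _ (measurable_itv `]-oo, (cum m 0)[%R).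
  by rewrite setTI; congr measurable; apply/seteqP; split=> h /=; rewrite in_itv.
have -> : [set h : (t.+1).-tuple R | (if thead h < cum m 0 then m.-1 else m) = k] =
  ([set h | thead h < cum m 0] `&` (if m.-1 == k then setT else set0)) `|`
  (~` [set h | thead h < cum m 0] `&` (if m == k then setT else set0)).
  apply/seteqP; split=> h /=.
    case: ifP => hm E; [left|right]; rewrite E eqxx; split=> //=; by rewrite hm.
  by move=> [[hm]|[/negP/negbTE hm]]; rewrite hm; case: eqP.
apply: measurableU; apply: measurableI => //; try exact: measurableC.
  by case: ifP => _; [exact: measurableT|exact: measurable0].
by case: ifP => _; [exact: measurableT|exact: measurable0].
Qed.

Lemma sunspot_strategy j : is_sstrategy (sunspot j).
Proof.
move=> t; split.
  apply: (@measurable_nat_select _ _ _ _ (fun h : (t.+1).-tuple R => state (behead h))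
    (fun k (h : (t.+1).-tuple R) => eta * calls k j (thead h))) => k.
    have := measurable_behead (T := R) (n := t) measurableT (@measurable_state t k).
    by rewrite setTI.
  apply: measurable_funM; first exact: measurable_cst.
  apply: (@measurableT_comp _ _ _ _ _ _ (calls k j)).
    by case: (bounded_meas_ind (cum k j) (cum k j.+1)).
  exact: measurable_tnth.
move=> h _; rewrite /sunspot; case: (ind01 (cum (state (behead h)) j) (cum (state (behead h)) j.+1) (thead h)) => ->.
  by rewrite mulr0 lexx ler01.
by rewrite mulr1 (ltW eta0) /=; have := eta2; lra.
Qed.

Lemma sunspot_at_most_one : at_most_one_quits sunspot.
Proof.
move=> t h _ j k; rewrite /sunspot.
case: (ind01 (cum (state (behead h)) j) (cum (state (behead h)) j.+1) (thead h)) => Ej;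
  case: (ind01 (cum (state (behead h)) k) (cum (state (behead h)) k.+1) (thead h)) => Ek;
  rewrite Ej Ek ?mulr0 ?ltxx // => _ _.
exact: calls_uniq (state_le _) Ej Ek.
Qed.

Let sunspot_cons t (h : t.-tuple R) s j :
  sunspot j [tuple of s :: h] = eta * calls (state h) j s.
Proof. by rewrite /sunspot theadE. Qed.

(* g bounds the weight of the event that the state is still positive after n stages. *)
Let Zmax := \sum_(k < T.+1) \sum_j z k j.
Let pmin := eta / (eta + Zmax).
Let rho := 1 - pmin / 2.
Let G := 1 + \sum_(k < T.+1) \sum_i w k i.
Let g n k := G * (2 ^+ k - 1) * rho ^+ n.

Let Zmax0 : 0 <= Zmax.
Proof. by apply: sumr_ge0 => k _; apply: sumr_ge0 => j _; apply: z_ge0; rewrite -ltnS. Qed.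

Let pmin01 : 0 < pmin <= 1.
Proof. by rewrite /pmin divr_gt0 ?ltr_pwDl //= ler_pdivrMr ?ltr_pwDl // mul1r lerDl. Qed.

Let rho01 : 0 <= rho < 1.
Proof. by rewrite /rho; have /andP[? ?] := pmin01; apply/andP; split; lra. Qed.

Let G1 : 1 <= G.
Proof.
rewrite /G lerDl sumr_ge0 // => k _; apply: sumr_ge0 => j _; apply: w_ge0.
by rewrite -ltnS.
Qed.

Let wG k i : (k <= T)%N -> 1 + w k i <= G.
Proof.
move=> kT; rewrite /G lerD2l (bigD1 (Ordinal (kT : (k < T.+1)%N))) //= (bigD1 i) //= -addrA lerDl.
rewrite addr_ge0 // sumr_ge0 // => [j _|l _]; first exact: w_ge0.
by apply: sumr_ge0 => j _; apply: w_ge0; rewrite -ltnS.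
Qed.

Let pmin_tot k : (k <= T)%N -> pmin * tot k <= eta.
Proof.
move=> kT; rewrite /pmin mulrAC ler_pdivrMr ?ltr_pwDl // ler_wpM2l ?(ltW eta0) // /tot lerD2l.
rewrite /Zmax (bigD1 (Ordinal (kT : (k < T.+1)%N))) //= lerDl sumr_ge0 // => l _.
by apply: sumr_ge0 => j _; apply: z_ge0; rewrite -ltnS.
Qed.

Let two_ge1 k : 1 <= 2 ^+ k :> R.
Proof. by apply: exprn_ege1; rewrite ler1n. Qed.

Let g_ge0 n k : 0 <= g n k.
Proof.
rewrite /g !mulr_ge0 ?subr_ge0 ?exprn_ge0 //; first by apply: le_trans G1.
by case/andP: rho01.
Qed.

Let g0 n : g n 0 = 0.
Proof. by rewrite /g expr0 subrr mulr0 mul0r. Qed.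

Let g_start k : G <= g 0 k.+1.
Proof.
rewrite /g expr0 mulr1 ler_peMr ?(le_trans ler01 G1) //.
by rewrite exprS; have := two_ge1 k; lra.
Qed.

(** A move down takes [2 ^+ k.+1 - 1] to less than half of it and has probability at least [pmin],
    so the mean shrinks by the factor [rho] or more. *)
Let g_step n k : (k.+1 <= T)%N ->
  eta * g n k + (tot k.+1 - eta) * g n k.+1 <= tot k.+1 * g n.+1 k.+1.
Proof.
move=> kT; rewrite -subr_ge0; pose X : R := 2 ^+ k; have X1 : 1 <= X := two_ge1 k.
have E m : g m k.+1 = G * (2 * X - 1) * rho ^+ m by rewrite /g exprS.
have -> : tot k.+1 * g n.+1 k.+1 - (eta * g n k + (tot k.+1 - eta) * g n k.+1) =
  (G * rho ^+ n) * (eta * X - pmin * tot k.+1 * (2 * X - 1) / 2).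
  by rewrite !E /g -/X exprSr /rho; field.
rewrite mulr_ge0 //; first by rewrite mulr_ge0 ?exprn_ge0 ?(le_trans ler01 G1) //; case/andP: rho01.
have := pmin_tot kT; have : 0 <= 2 * X - 1 by lra.
move=> h1 h2; have := ler_wpM2r h1 h2; have := eta0; lra.
Qed.

Let g_cvg k : g n k @[n --> \oo] --> (0 : R).
Proof.
rewrite -[X in _ --> X](mulr0 (G * (2 ^+ k - 1))); apply: cvgMr.
by apply: cvg_expr; have /andP[? ?] := rho01; rewrite ger0_norm.
Qed.

Let sum_calls k s (a : I -> R) j0 : (k <= T)%N -> calls k j0 s = 1 ->
  \sum_j a j * calls k j s = a j0.
Proof.
move=> kT c1; rewrite (bigD1 j0) //= c1 mulr1 big1 ?addr0 // => j jj0.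
case: (ind01 (cum k j) (cum k j.+1) s) => [|cj]; first by rewrite -/(calls k j s) => ->; rewrite mulr0.
by rewrite (calls_uniq kT cj c1) eqxx in jj0.
Qed.

Let no_calls k s (a : I -> R) : (forall j, a j != 0 -> calls k j s = 0) ->
  \sum_j a j * calls k j s = 0.
Proof.
move=> c0; rewrite big1 // => j _; have [->|aj] := eqVneq (a j) 0; first by rewrite mul0r.
by rewrite c0 ?mulr0.
Qed.

Let ind_move k s : 0 <= s -> ind 0 (cum k 0) s = (s < cum k 0)%R%:R.
Proof. by move=> s0; rewrite /ind s0. Qed.

Let state_integral k u a0 (a : I -> R) : (k <= T)%N ->
  bounded_meas (fun s => u + a0 * ind 0 (cum k 0) s + \sum_j a j * calls k j s) /\
  Rintegral (@lebesgue_measure R) `[0%R, 1%R]%classic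
    (fun s => u + a0 * ind 0 (cum k 0) s + \sum_j a j * calls k j s) =
  u + (a0 * eta + \sum_j a j * z k j) / tot k.
Proof.
move=> kT.
have [h1 h2] := int01_step u a0 a (cum0_01 kT) (fun j => cum_itv j kT).
split=> //; rewrite h2 -addrA; congr (_ + _); rewrite mulrDl cum0 mulrA; congr (_ + _).
by rewrite mulr_suml; apply: eq_bigr => j _; rewrite cumB mulrA.
Qed.

Let A0 i : A i i = 0. Proof. exact: r0. Qed.

Section Deviation.
Variables (i : I) (dv : forall t : nat, (t.+1).-tuple R -> R).
Hypothesis dvs : is_sstrategy dv.
Let dxi := sdev sunspot i dv.

Let dxis j : is_sstrategy (dxi j).
Proof. by rewrite /dxi /sdev; case: eqP => // _; exact: sunspot_strategy. Qed.

(** [w] is the intended value and [b] the slack of the table; [4 * eta] pays for quitting together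
    with a called player, and [g] for the finite horizon. *)
Let V n k := w k i + b k i + 4 * eta + g n k.

Let V_ge n k : (k <= T)%N -> 4 * eta <= V n k.
Proof. by move=> kT; rewrite /V; have := w_ge0 i kT; have := b_ge0 i kT; have := g_ge0 n k; lra. Qed.

Lemma deviation_bound n t (h : t.-tuple R) : sig_hist h -> scont r dxi i n h <= V n (state h).
Proof.
have e0 := eta0; have e2 := eta2.
elim: n t h => [|n IH] t h hh.
  have := state_le h; case: (state h) => [|k] kT /=; rewrite /V.
    have := w_ge0 i kT; rewrite g0; case: Htab => _ _ /(_ i) hb _.
    by have := rb finset.set0 i; lra.
  have := w_ge0 i kT; have := b_ge0 i kT; have := g_start k; have := rb finset.set0 i.
  by have := G1; lra.
set k := state h; have kT : (k <= T)%N := state_le h.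
pose V0 := V n k; pose V1 := V n k.-1.
(* When [i] himself is called, nobody else quits and the state stays, so [V0] is a bound whatever he
   does. *)
pose a j := if j == i then 0 else eta * (A i j - V0).
have [bm Ei] := state_integral V0 (V1 - V0) a kT.
rewrite scontS; apply: (@le_trans _ _ (V0 + ((V1 - V0) * eta + \sum_j a j * z k j) / tot k)).
  rewrite -Ei; apply: int01_le => //; first exact: stage_value_bounded.
  move=> s s01; have s0 : 0 <= s by case/andP: s01.
  have hs := sig_hist_cons hh s01.
  set h' := [tuple of s :: h] in hs *.
  pose p := qprob dxi h'.
  have p01 : forall j, 0 <= p j <= 1 := qprob_01 dxis hs.
  have pj j : j != i -> p j = eta * calls k j s.
    by move=> ji; rewrite /p /qprob /dxi /sdev (negbTE ji) sunspot_cons.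
  have /andP[y0 y1] := p01 i.
  have cV := IH _ _ hs; rewrite /stage_value -/p.
  have sE : state h' = if s < cum k 0 then k.-1 else k by [].
  set c := scont _ _ _ _ _ in cV *.
  have [[j0 [j0i cj0]]|nocall] := pselect (exists j, j != i /\ calls k j s = 1).
    have sm := calls_move kT cj0.
    rewrite (sum_calls _ kT cj0) /a (negbTE j0i) ind_move // ltNge sm mulr0 addr0.
    have ij0 : i != j0 by rewrite eq_sym.
    have pz l : l != i -> l != j0 -> p l = 0.
      move=> li lj; rewrite pj //; case: (ind01 (cum k l) (cum k l.+1) s) => [|cl].
        by rewrite -/(calls k l s) => ->; rewrite mulr0.
      by rewrite (calls_uniq kT cl cj0) eqxx in lj.
    have pj0 : p j0 = eta by rewrite pj // cj0 mulr1.
    rewrite (stage_quit_pair _ _ ij0 pz) (no_quit_pair ij0 pz) pj0 r0 mulr0 addr0 -/(A i j0).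
    move: cV; rewrite sE ltNge sm /= -/V0 => cV.
    have V4 : 4 * eta <= V0 by exact: V_ge.
    have /andP[x1 x2] := rb [set i; j0]%SET i; have /andP[x3 x4] := rb [set j0]%SET i.
    rewrite -/(A i j0) in x3 x4.
    set y := p i in y0 y1 *; set x := r _ i in x1 x2 *; set x' := A i j0 in x3 x4 *.
    have e1 : 0 <= 1 - eta by lra.
    have k1 : (1 - eta) * c <= (1 - eta) * V0 by exact: ler_wpM2l.
    (* Quitting together with [j0] yields at most [eta]. As [V0 >= 4 * eta] and [eta <= 1 / 2],
       continuing is worth at least [2 * eta], and the quit of [j0] costs at most [eta]. *)
    have k2 : eta <= eta * x' + (1 - eta) * V0.
      have : (1 - eta) * (4 * eta) <= (1 - eta) * V0 by exact: ler_wpM2l.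
      have : eta * (-1) <= eta * x' by rewrite ler_wpM2l // ltW.
      have : 0 <= eta * (1 / 2 - eta) by rewrite mulr_ge0 ?(ltW eta0) // subr_ge0.
      lra.
    have k3 : eta * x <= eta by rewrite ger_pMr.
    have k4 : y * (eta * x) <= y * (eta * x' + (1 - eta) * V0).
      by rewrite ler_wpM2l // (le_trans k3 k2).
    have k5 : (1 - y) * ((1 - eta) * c) <= (1 - y) * ((1 - eta) * V0).
      by rewrite ler_wpM2l // subr_ge0.
    lra.
  have nc j : j != i -> calls k j s = 0.
    move=> ji; case: (ind01 (cum k j) (cum k j.+1) s) => // cj.
    by exfalso; apply: nocall; exists j.
  rewrite no_calls ?addr0; last by move=> j; rewrite /a; case: (eqVneq j i) => [_|/nc //]; rewrite eqxx.
  have pz l : l != i -> p l = 0 by move=> li; rewrite pj // nc // mulr0.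
  rewrite (stage_quit_single _ _ pz) r0 mulr0 add0r.
  have -> : no_quit p = 1 - p i.
    by rewrite /no_quit (bigD1 i) //= big1 ?mulr1 // => l /pz ->; rewrite subr0.
  rewrite ind_move //; move: cV; rewrite sE.
  have kT' : (k.-1 <= T)%N by exact: leq_trans (leq_pred _) kT.
  have V00 : 0 <= V0 by apply: le_trans (V_ge n kT); rewrite mulr_ge0 // ltW.
  have V10 : 0 <= V1 by apply: le_trans (V_ge n kT'); rewrite mulr_ge0 // ltW.
  have y1' : 0 <= 1 - p i by rewrite subr_ge0.
  case: ifP => _ cV.
    rewrite mulr1 subrKC; apply: (le_trans (ler_wpM2l y1' cV)).
    by rewrite -/V1 ler_piMl // gerBl.
  rewrite mulr0 addr0; apply: (le_trans (ler_wpM2l y1' cV)).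
  by rewrite -/V0 ler_piMl // gerBl.
have t0 := tot_gt0 kT.
rewrite -lerBrDl ler_pdivrMr //.
rewrite /a (bigD1 i) //= eqxx mul0r add0r.
rewrite (eq_bigr (fun j => eta * (z k j * A i j) - eta * V0 * z k j)); last first.
  by move=> j /negbTE ->; ring.
rewrite sumrB -!mulr_sumr.
set L := \sum_(j | _) z k j * A i j; set S := \sum_(j | _) z k j.
have totE : tot k = eta + (z k i + S) by rewrite /tot (bigD1 i).
have S0 : 0 <= S by apply: sumr_ge0 => j _; exact: z_ge0.
have zi0 := z_ge0 i kT.
case kE : k kT => [|k'] kT.
  have z0 j : z k j = 0 by rewrite kE; case: Htab.
  have SE : S = 0 by rewrite /S big1.
  have LE : L = 0 by rewrite /L big1 // => j _; rewrite z0 mul0r.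
  rewrite SE LE /V1 /V0 kE /V !g0; lra.
have [_ _ _ tab] := Htab; have [_ _ zw] := tab k' kT i.
rewrite (bigD1 i) //= -kE => hb.
have LE : amul A (z k) i = L by rewrite /amul (bigD1 i) //= A0 mulr0 add0r.
rewrite LE -/S -kE in hb zw *.
have gs := g_step n kT; rewrite -kE in gs.
(* By complementarity the own rate of [i] drops out of the balance of [w], so ignoring calls does
   not change his value. *)
have zw0 : z k i * w k i = 0 by case: zw => ->; rewrite ?mul0r ?mulr0.
have := ler_norm (- ((1 + (z k i + S)) * w k i - (w k' i + L))); rewrite normrN => hn.
rewrite /V1 /V0 /V kE /= -kE totE in gs *.
set g0' := g n k in gs *; set g1 := g n k' in gs *; set g2 := g n.+1 k in gs *.
have gg : 0 <= eta * (S * g0').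
  by apply: mulr_ge0; [exact: ltW|apply: mulr_ge0 => //; exact: g_ge0].
have B1 : eta * (w k' i + b k' i + L) <= eta * ((1 + S) * (w k i + b k i)).
  by rewrite ler_wpM2l ?(ltW eta0) //; lra.
have e3 : 0 <= eta * eta * S by rewrite !mulr_ge0 // ltW.
lra.
Qed.

Lemma deviation_payoff : sgamma r dxi i <= w T i + b T i + 4 * eta.
Proof.
have gV : V n T @[n --> \oo] --> w T i + b T i + 4 * eta + 0.
  by apply: cvgD; [exact: cvg_cst|exact: g_cvg].
have c : cvgn (fun n => scont r dxi i n [tuple]) by exact: sgamma_cvg.
rewrite -[leRHS]addr0 /sgamma; apply: (ler_cvg_to c gV).
by apply: nearW => n; exact: deviation_bound (@sig_hist0 R).
Qed.

End Deviation.

Section Equilibrium.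
Variable i : I.
Let U n k := w k i - b k i - g n k.

(** On the path nobody quits together with another player, so no term in [eta] is lost. *)
Lemma equilibrium_bound n t (h : t.-tuple R) : sig_hist h ->
  U n (state h) <= scont r sunspot i n h.
Proof.
have e0 := eta0; have e2 := eta2.
elim: n t h => [|n IH] t h hh.
  have := state_le h; case: (state h) => [|k] kT /=; rewrite /U.
    have := w_ge0 i kT; rewrite g0; case: Htab => _ _ /(_ i) hb _.
    by have := rb finset.set0 i; lra.
  have := wG i kT; have := b_ge0 i kT; have := g_start k; have := rb finset.set0 i.
  by lra.
set k := state h; have kT : (k <= T)%N := state_le h.
pose U0 := U n k; pose U1 := U n k.-1.
pose a j := eta * (A i j - U0).
have [bm Ei] := state_integral U0 (U1 - U0) a kT.
rewrite scontS; apply: (@le_trans _ _ (U0 + ((U1 - U0) * eta + \sum_j a j * z k j) / tot k)); last first.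
  rewrite -Ei; apply: int01_le => //.
    by apply: stage_value_bounded => //; exact: sunspot_strategy.
  move=> s s01; have s0 : 0 <= s by case/andP: s01.
  have hs := sig_hist_cons hh s01.
  set h' := [tuple of s :: h] in hs *.
  pose p := qprob sunspot h'.
  have pj j : p j = eta * calls k j s by rewrite /p /qprob sunspot_cons.
  have cU := IH _ _ hs; rewrite /stage_value -/p.
  have sE : state h' = if s < cum k 0 then k.-1 else k by [].
  set c := scont _ _ _ _ _ in cU *.
  have [[j0 cj0]|nocall] := pselect (exists j, calls k j s = 1).
    have sm := calls_move kT cj0.
    rewrite (sum_calls _ kT cj0) /a ind_move // ltNge sm mulr0 addr0.
    have pz l : l != j0 -> p l = 0.
      move=> lj; rewrite pj //; case: (ind01 (cum k l) (cum k l.+1) s) => [|cl].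
        by rewrite -/(calls k l s) => ->; rewrite mulr0.
      by rewrite (calls_uniq kT cl cj0) eqxx in lj.
    rewrite (stage_quit_single _ _ pz) -/(A i j0).
    have -> : no_quit p = 1 - p j0.
      by rewrite /no_quit (bigD1 j0) //= big1 ?mulr1 // => l /pz ->; rewrite subr0.
    rewrite pj cj0 mulr1; move: cU; rewrite sE ltNge sm /= -/U0 => cU.
    have e1 : 0 <= 1 - eta by lra.
    by have := ler_wpM2l e1 cU; lra.
  have nc j : calls k j s = 0.
    case: (ind01 (cum k j) (cum k j.+1) s) => // cj.
    by exfalso; apply: nocall; exists j.
  rewrite no_calls ?addr0; last by move=> j _; exact: nc.
  have pz l : p l = 0 by rewrite pj nc mulr0.
  rewrite (stage_quit_none _ _ pz) add0r.
  have -> : no_quit p = 1 by rewrite /no_quit big1 // => l _; rewrite pz subr0.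
  rewrite mul1r ind_move //; move: cU; rewrite sE; case: ifP => _.
    by rewrite mulr1 subrKC.
  by rewrite mulr0 addr0.
have t0 := tot_gt0 kT.
rewrite -lerBlDl ler_pdivlMr //.
rewrite /a (eq_bigr (fun j => eta * (z k j * A i j) - eta * U0 * z k j)); last by move=> j _; ring.
rewrite sumrB -!mulr_sumr -/(amul A (z k) i).
set L := amul A (z k) i; set Z := \sum_j z k j.
have totE : tot k = eta + Z by [].
have Z0 : 0 <= Z by apply: sumr_ge0 => j _; exact: z_ge0.
case kE : k kT => [|k'] kT.
  have z0 j : z k j = 0 by rewrite kE; case: Htab.
  have ZE : Z = 0 by rewrite /Z big1.
  have LE : L = 0 by rewrite /L /amul big1 // => j _; rewrite z0 mul0r.
  rewrite ZE LE /U1 /U0 kE /U !g0; lra.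
have [_ _ _ tab] := Htab; have [_ _ _ hb] := tab k' kT i.
have gs := g_step n kT; rewrite -kE -/L -/Z in hb gs.
have SZ : \sum_(j | j != i) z k j <= Z by rewrite [leRHS](bigD1 i) //= lerDr z_ge0 ?kE.
have bk : 0 <= b k i by rewrite kE; exact: b_ge0.
have := ler_norm ((1 + Z) * w k i - (w k' i + L)) => hn.
rewrite /U1 /U0 /U kE /= -kE totE in gs *.
set g0' := g n k in gs *; set g1 := g n k' in gs *; set g2 := g n.+1 k in gs *.
have gg : 0 <= eta * (Z * g0').
  by apply: mulr_ge0; [exact: ltW|apply: mulr_ge0 => //; exact: g_ge0].
have h1 := ler_wpM2r bk SZ.
have B1 : eta * ((1 + Z) * (w k i - b k i)) <= eta * (w k' i - b k' i + L).
  by rewrite ler_wpM2l ?(ltW eta0) //; lra.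
lra.
Qed.

Lemma equilibrium_payoff : w T i - b T i <= sgamma r sunspot i.
Proof.
have gU : U n T @[n --> \oo] --> w T i - b T i - 0.
  by apply: cvgB; [exact: cvg_cst|exact: g_cvg].
have c : cvgn (fun n => scont r sunspot i n [tuple]).
  by apply: sgamma_cvg => //; exact: sunspot_strategy.
rewrite -[leLHS]subr0 /sgamma; apply: (ler_cvg_to gU c).
by apply: nearW => n; exact: equilibrium_bound (@sig_hist0 R).
Qed.

End Equilibrium.

Lemma sunspot_eq eps : (forall i, 2 * b T i + 4 * eta <= eps) ->
  sunspot_eps_equilibrium r eps sunspot.
Proof.
move=> be; split; first exact: sunspot_strategy.
move=> i dv dvs; have := deviation_payoff i dvs; have := equilibrium_payoff i.
by have := be i; lra.
Qed.

End Sunspot.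

(** * Assembly of the two cases *)

Lemma Q_sunspot (R : realType) (N : nat) (r : game R N) : payoffs_bounded r ->
  (forall i : 'I_N, r [set i]%SET i = 0) -> Istar r != finset.set0 ->
  R0_on (fun i j => r [set j]%SET i) (Istar r) -> Q_on (fun i j => r [set j]%SET i) (Istar r) ->
  forall eps : R, 0 < eps -> exists xi : sprofile R N,
    sunspot_eps_equilibrium r eps xi /\ at_most_one_quits xi.
Proof.
move=> rb r0 I0 HR HQ eps e0; pose A i j := r [set j]%SET i.
have A1 i j : `|A i j| <= 1 by exact: r_norm.
have Ad i : i \in Istar r -> A i i = 0 by move=> _; exact: r0.
have Aout i j : i \notin Istar r -> j \in Istar r -> 0 <= A i j.
  move=> iI jI; have [l [_ h]] := notin_Istar iI.
  by apply/ltW/h; [move/in_Istar: jI; apply|apply: contraNneq iI => <-].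
have [X Xb Xu] := viable A1 I0 Ad HR HQ.
have e4 : 0 < eps / 4 by rewrite divr_gt0.
have [T [z [w [b [tab hb]]]]] := table_exists A1 Ad Aout HR Xb Xu e4.
(* Twice the slack [eps / 4] plus [4 * eta] is at most [eps]. *)
pose eta : R := Num.min (eps / 8) (1 / 2).
have eta0 : 0 < eta by rewrite /eta lt_min !divr_gt0.
have eta8 : eta <= eps / 8 by rewrite /eta ge_min lexx.
have eta2 : eta <= 1 / 2 by rewrite /eta ge_min lexx orbT.
exists (sunspot T z eta); split; last exact: (sunspot_at_most_one tab eta0).
apply: (sunspot_eq rb r0 tab eta0 eta2) => i; have := hb i; lra.
Qed.

Local Close Scope classical_set_scope.

Theorem theorem2 (R : realType) (N : nat) (r : game R N) :
  payoffs_bounded r ->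
  (forall i : 'I_N, r [set i]%SET i = 0) ->
  Istar r != finset.set0 ->
  (forall w z0 z, LCP_sol (Rhat r) 0 w z0 z -> ~ (z0 < 1)) ->
  (~ Q_matrix (Rhat r) ->
     forall eps : R, 0 < eps ->
       exists x : profile R N, stationary x /\ eps_equilibrium r eps x) /\
  (Q_matrix (Rhat r) ->
     forall eps : R, 0 < eps ->
       exists xi : sprofile R N,
         sunspot_eps_equilibrium r eps xi /\ at_most_one_quits xi).
Proof.
move=> rb r0 I0 H; have HR := Rhat_R0 H; split=> HQ; last first.
  by apply: Q_sunspot => //; exact: Rhat_Q.
have /existsNP[q Hq] : ~ Q_on (fun i j => r [set j]%SET i) (Istar r).
  by move=> /Q_Rhat.
(* The problem on the normal players sees only the values of [q] there, so 1 may be put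
   elsewhere. *)
apply: (@not_Q_stationary _ _ _ rb r0 (fun i => if i \in Istar r then q i else 1)) => //.
  by move=> i /negbTE ->.
move=> z [z0 zI zc]; apply: Hq; exists z; split=> // i iI.
by have := zc i iI; rewrite iI.
Qed.
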